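(* Let $\alpha,\phi\in\mathbb{R}$, let $B:L^2(\mathbb{R})\to F^2$ be the Bargmann transform, let $H^\alpha_\phi$ be the fractional Hilbert transform on $L^2(\mathbb{R})$ with parameters $\alpha,\phi$, and let $A_\phi$ be the entire function $$A_\phi(z)=\sqrt{\pi}\cos\phi-2i\sin\phi\int_0^z e^{-u^2}\,du .$$ Then the operator $T=BH^\alpha_\phi B^{-1}:F^2\to F^2$ is given by $$Tf(z)=\frac{1}{\sqrt{\pi}}\int_{\mathbb{C}} f(w)\,e^{z\overline{w}}\,A_\phi\!\left(\frac{e^{i\alpha}z+e^{-i\alpha}\overline{w}}{\sqrt{2}}\right)d\lambda(w),\qquad z\in\mathbb{C},$$ for all $f\in F^2$.
   Context: The Fock space $F^2$ is the Hilbert space of all entire functions $f$ on $\mathbb{C}$ with $\|f\|^2=\int_{\mathbb{C}}|f(z)|^2\,d\lambda(z)<\infty$, where $d\lambda(z)=\frac1\pi e^{-|z|^2}\,dA(z)$ and $dA$ is area (Lebesgue) measure; its inner product is that of $L^2(\mathbb{C},d\lambda)$. $L^2(\mathbb{R})=L^2(\mathbb{R},dx)$ consists of complex-valued functions. The Bargmann transform $B:L^2(\mathbb{R})\to F^2$ is $$Bf(z)=c\int_{\mathbb{R}} f(x)e^{2xz-x^2-(z^2/2)}\,dx,\qquad c=(2/\pi)^{1/4};$$ it is a well-known fact that $B$ is a unitary operator from $L^2(\mathbb{R})$ onto $F^2$. For $\alpha\in\mathbb{R}$ with $\sin\alpha\ne0$, the $\alpha$-angle fractional Fourier transform is $$\mathcal{F}_\alpha(f)(x)=\frac{\sqrt{1-i\cot\alpha}}{\sqrt{\pi}}\,e^{ix^2\cot\alpha}\int_{\mathbb{R}}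 e^{-2i\left(xt\csc\alpha-\frac{\cot\alpha}{2}t^2\right)}f(t)\,dt,$$ where the square root is chosen with $\arg\sqrt{1-i\cot\alpha}\in(-\pi/2,\pi/2]$. The integral formula is used for $f\in L^1(\mathbb{R})\cap L^2(\mathbb{R})$, and $\mathcal{F}_\alpha$ on $L^2(\mathbb{R})$ is its extension by continuity. For $\alpha=0$ set $\mathcal{F}_\alpha(f)(x)=f(x)$, for $\alpha=\pm\pi$ set $\mathcal{F}_\alpha(f)(x)=f(-x)$, and for other integer multiples of $\pi$ extend $2\pi$-periodically in $\alpha$. Each $\mathcal{F}_\alpha$ is a unitary operator on $L^2(\mathbb{R})$. Let $h$ be the Heaviside function, $h(x)=1$ for $x\ge0$ and $h(x)=0$ for $x<0$. The fractional Hilbert transform is the operator on $L^2(\mathbb{R})$ $$H^\alpha_\phi f=\mathcal{F}_\alpha^{-1}\left[\left(e^{-i\phi}h(x)+e^{i\phi}h(-x)\right)\mathcal{F}_\alpha(f)(x)\right].$$ *)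

(* Defs.v *)
From HB Require Import structures.
From mathcomp Require Import all_boot all_order all_algebra.
From mathcomp Require Import all_classical all_reals all_analysis.
From mathcomp Require Export complex.

Set Implicit Arguments.
Unset Strict Implicit.
Unset Printing Implicit Defensive.

Import Order.TTheory GRing.Theory Num.Theory.
Import numFieldNormedType.Exports.

Local Open Scope classical_set_scope.
Local Open Scope ring_scope.
Local Open Scope complex_scope.

Notation cabs := Normc.normc.

Section complex_integral.
Context {R : realType}.
Implicit Types z w : R[i].

Definition cexp z : R[i] :=
  (expR (complex.Re z) * cos (complex.Im z)) +i*
  (expR (complex.Re z) * sin (complex.Im z)).

Context {d : measure_display} {T : measurableType d}.
Implicit Types (mu : {measure set T -> \bar R}) (f : T -> R[i]).

Definition cmeasurable f :=
  measurable_fun setT (fun x => complex.Re (f x)) /\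
  measurable_fun setT (fun x => complex.Im (f x)).

Definition cintegrable mu (D : set T) f :=
  mu.-integrable D (fun x => (complex.Re (f x))%:E) /\
  mu.-integrable D (fun x => (complex.Im (f x))%:E).

Definition cintegral mu (D : set T) f : R[i] :=
  (\int[mu]_(x in D) complex.Re (f x)) +i*
  (\int[mu]_(x in D) complex.Im (f x)).

End complex_integral.

(* L^2(R) and F^2 are handled through representatives: elements of L^2(R) are
   functions R -> R[i], and operators on L^2(R) are defined up to almost
   everywhere equality. An operator characterized by a property of its value
   picks with xget a representative having this property; the default 0 is
   only returned when there is none, e.g. outside the domain. *)
Section spaces.
Context {R : realType}.

Local Notation leb := (@lebesgue_measure R).

Definition L2norm (f : R -> R[i]) : \bar R :=
  Lnorm leb 2%:E (fun x => (cabs (f x))%:E).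

Definition L2 (f : R -> R[i]) := cmeasurable f /\ (L2norm f < +oo)%E.

Definition L1 (f : R -> R[i]) := cintegrable leb setT f.

Definition area : {measure set (measurableTypeR R * measurableTypeR R) -> \bar R}
  := (leb \x leb)%E.

Definition to_C (p : R * R) : R[i] := p.1 +i* p.2.

(* density of lambda with respect to the area measure *)
Definition gauss (z : R[i]) : R := pi^-1 * expR (- cabs z ^+ 2).

Definition gauss_integrable (f : R[i] -> R[i]) :=
  cintegrable area setT (fun p => f (to_C p) * (gauss (to_C p))%:C).

Definition gauss_integral (f : R[i] -> R[i]) : R[i] :=
  cintegral area setT (fun p => f (to_C p) * (gauss (to_C p))%:C).

(* derivability over the scalar field R[i], i.e. complex differentiability *)
Definition entire (f : R[i] -> R[i]) :=
  forall z : R[i], derivable (f : R[i]^o -> R[i]^o) z 1.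

Definition fock (f : R[i] -> R[i]) :=
  entire f /\
  (\int[area]_p (cabs (f (to_C p)) ^+ 2 * gauss (to_C p))%:E < +oo)%E.

End spaces.

Section operators.
Context {R : realType}.

Local Notation leb := (@lebesgue_measure R).

Definition bargmann (f : R -> R[i]) : R[i] -> R[i] := fun z =>
  (powR (2 / pi) (1 / 4))%:C *
  cintegral leb setT
    (fun x : R => f x * cexp (2 * x%:C * z - x%:C ^+ 2 - z ^+ 2 / 2)).

(* some representative of the preimage in L^2(R) *)
Definition inv_bargmann (f : R[i] -> R[i]) : R -> R[i] :=
  xget (fun=> 0) [set g : R -> R[i] | L2 g /\ bargmann g = f].

Definition cot (a : R) : R := cos a / sin a.
Definition csc (a : R) : R := (sin a)^-1.

(* sqrtc is the square root with argument in ]-pi/2, pi/2] *)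
Definition frft_integral (a : R) (f : R -> R[i]) : R -> R[i] := fun x =>
  sqrtc (1 - 'i%C * (cot a)%:C) / (Num.sqrt pi)%:C *
  cexp ('i%C * (x ^+ 2 * cot a)%:C) *
  cintegral leb setT
    (fun t : R =>
       cexp (- 2 * 'i%C * (x * t * csc a - cot a / 2 * t ^+ 2)%:C) * f t).

(* g is the value at f of the continuous extension to L^2(R) of the integral
   transform on L^1(R) `&` L^2(R) *)
Definition is_frft_ext (a : R) (f g : R -> R[i]) :=
  L2 g /\
  forall u : nat -> R -> R[i], (forall n, L1 (u n) /\ L2 (u n)) ->
    L2norm (fun x => u n x - f x) @[n --> \oo] --> 0%E ->
    L2norm (fun x => frft_integral a (u n) x - g x) @[n --> \oo] --> 0%E.

(* the last two cases are a \in 2 pi Z and a \in pi + 2 pi Z *)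
Definition frft (a : R) (f : R -> R[i]) : R -> R[i] :=
  if sin a != 0 then xget (fun=> 0) [set g | is_frft_ext a f g]
  else if a / (2 * pi) \is a Num.int then f
  else fun x => f (- x).

Definition inv_frft (a : R) (f : R -> R[i]) : R -> R[i] :=
  xget (fun=> 0)
    [set g : R -> R[i] | L2 g /\ {ae leb, forall x, frft a g x = f x}].

Definition heaviside (x : R) : R[i] := if 0 <= x then 1 else 0.

Definition frac_hilbert (a phi : R) (f : R -> R[i]) : R -> R[i] :=
  inv_frft a (fun x : R =>
    (cexp (- ('i%C * phi%:C)) * heaviside x +
     cexp ('i%C * phi%:C) * heaviside (- x)) * frft a f x).

(* the contour integral from 0 to z is taken along the segment u = t z *)
Definition A_fun (phi : R) (z : R[i]) : R[i] :=
  (Num.sqrt pi * cos phi)%:C -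
  2 * 'i%C * (sin phi)%:C *
    cintegral leb `[0, 1] (fun t : R => cexp (- (t%:C * z) ^+ 2) * z).

End operators.

(* Main.v *)
(* Conjugation by the Bargmann transform B turns the fractional Fourier transform of angle a into
   k times the rotation f |-> f(e^{-ia} z), by a Gaussian integral. Hence B H B^-1 f(z) = B(m p)(e^{ia} z) / k,
   where m is the multiplier and B p = k f(e^{-ia} .), and polarization of |B h| = |h| gives
   B(m p)(zeta) = int B p(w) N(zeta, w) dlambda(w), where N(zeta, w) is the Gaussian integral over R
   of m against two kernels of B; the half-line Gaussian integrals produce the error function in A_phi.
   Rotating w yields the formula.
   Unitarity of B is proved along the way. Isometry: for fixed u, v |-> B h(u + iv) is a Fourier
   transform of a windowed h, so Plancherel's formula in v and integration over u apply. Surjectivity: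
   Goursat's theorem gives the reproducing formula f(w) = int f(z) e^{w zbar} dlambda(z) on F^2, and
   a preimage of f is the limit in L^2(R) of the images of truncations of f under the adjoint of B. *)
From HB Require Import structures.
Require Import Defs.
From mathcomp Require Import all_boot all_order all_algebra.
From mathcomp Require Import all_classical all_reals all_analysis.
From mathcomp Require Import measurable_realfun lebesgue_Rintegral.
From mathcomp Require Import ring lra.
Set Implicit Arguments.
Unset Strict Implicit.
Unset Printing Implicit Defensive.

Import Order.TTheory GRing.Theory Num.Theory.
Import numFieldNormedType.Exports.

Local Open Scope classical_set_scope.
Local Open Scope ring_scope.
Local Open Scope complex_scope.

Local Notation Re := complex.Re.
Local Notation Im := complex.Im.

(** * Complex numbers and complex-valued integrals *)

Section complex_basics.
Context {R : realType}.
Implicit Types (z w : R[i]) (x y : R).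

(** [bargmann] is a pointwise integral which sees exactly the almost everywhere class of its
    argument. All transforms of the line are therefore compared after applying it, and the arbitrary
    representatives returned by [xget] do no harm as soon as one suitable representative exists;
    surjectivity provides it. The isometry is an identity in the extended reals, valid on all of
    [wL2] with both sides possibly infinite. This matters twice. The fractional Fourier integral of
    an integrable function is visibly bounded but not visibly square integrable, and the identity
    itself controls its distance to the candidate limit. And a function of modulus one, whose norm
    is infinite, shows that the constant k is nonzero, although the complex Gaussian integral that
    defines it is never evaluated. Contours are shifted by real means: for Gaussians by integrating
    a derivative in a deformation parameter, which also yields the error function as a boundary
    term; for entire functions by Goursat's theorem on parallelograms, applied after the
    substitution e^s, which turns circles into segments. *)

Lemma cReD z w : Re (z + w) = Re z + Re w. Proof. by case: z; case: w. Qed.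
Lemma cImD z w : Im (z + w) = Im z + Im w. Proof. by case: z; case: w. Qed.
Lemma cReN z : Re (- z) = - Re z. Proof. by case: z. Qed.
Lemma cImN z : Im (- z) = - Im z. Proof. by case: z. Qed.
Lemma cReM z w : Re (z * w) = Re z * Re w - Im z * Im w.
Proof. by case: z; case: w. Qed.
Lemma cImM z w : Im (z * w) = Re z * Im w + Im z * Re w.
Proof. by case: z => a b; case: w => c d /=; rewrite (addrC (a * d)). Qed.
Lemma cReJ z : Re z^* = Re z. Proof. by case: z. Qed.
Lemma cImJ z : Im z^* = - Im z. Proof. by case: z. Qed.

Definition reimE := (cReD, cImD, cReN, cImN, cReM, cImM, cReJ, cImJ).

Lemma complexP z w : Re z = Re w -> Im z = Im w -> z = w.
Proof. by case: z; case: w => ? ? ? ? /= -> ->. Qed.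

Lemma natrC (n : nat) : (n%:R : R[i]) = (n%:R : R)%:C.
Proof. by rewrite rmorph_nat. Qed.

Lemma complexX x n : (x ^+ n)%:C = x%:C ^+ n :> R[i]. Proof. exact: rmorphXn. Qed.
Lemma complexB x y : (x - y)%:C = x%:C - y%:C :> R[i]. Proof. exact: rmorphB. Qed.
Lemma complexN x : (- x)%:C = - x%:C :> R[i]. Proof. exact: rmorphN. Qed.
Lemma complexM x y : (x * y)%:C = x%:C * y%:C :> R[i]. Proof. exact: rmorphM. Qed.
Lemma complexD x y : (x + y)%:C = x%:C + y%:C :> R[i]. Proof. exact: rmorphD. Qed.
Lemma complexV x : (x^-1)%:C = x%:C^-1 :> R[i]. Proof. exact: fmorphV. Qed.
Lemma complexn (n : nat) : (n%:R : R)%:C = n%:R :> R[i]. Proof. exact: rmorph_nat. Qed.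

Definition castC := (complexX, complexB, complexN, complexM, complexD, complexV, complexn).

Lemma sqr_cabs z : cabs z ^+ 2 = Re z ^+ 2 + Im z ^+ 2.
Proof. by case: z => a b /=; rewrite sqr_sqrtr// addr_ge0 ?sqr_ge0. Qed.

Lemma cabs_ge0 z : 0 <= cabs z. Proof. by case: z => a b /=; rewrite sqrtr_ge0. Qed.

Hint Resolve cabs_ge0 : core.

Lemma cabsM z w : cabs (z * w) = cabs z * cabs w.
Proof. exact: Normc.normcM. Qed.

Lemma cabsD z w : cabs (z + w) <= cabs z + cabs w.
Proof. exact: le_normcD. Qed.

Lemma cabsN z : cabs (- z) = cabs z.
Proof. exact: normcN. Qed.

Lemma cabs0 : cabs (0 : R[i]) = 0. Proof. exact: Normc.normc0. Qed.

Lemma cabs1 : cabs (1 : R[i]) = 1. Proof. exact: Normc.normc1. Qed.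

Lemma cabs_eq0 z : (cabs z == 0) = (z == 0).
Proof.
apply/eqP/eqP => [|->]; first exact: Normc.eq0_normc.
by rewrite cabs0.
Qed.

Lemma cabs_gt0 z : (0 < cabs z) = (z != 0).
Proof. by rewrite lt_neqAle cabs_ge0 andbT eq_sym cabs_eq0. Qed.

Lemma cabsV z : cabs z^-1 = (cabs z)^-1.
Proof. exact: Normc.normcV. Qed.

Lemma cabsC x : cabs x%:C = `|x|.
Proof. by rewrite /= expr0n addr0 sqrtr_sqr. Qed.

Lemma cabsi : cabs ('i%C : R[i]) = 1.
Proof. by rewrite /= expr0n add0r expr1n sqrtr1. Qed.

Lemma cabsJ z : cabs z^* = cabs z.
Proof. by case: z => a b /=; rewrite sqrrN. Qed.

Lemma cabsX z n : cabs (z ^+ n) = cabs z ^+ n.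
Proof. by elim: n => [|n ih]; rewrite ?expr0 ?cabs1// !exprS cabsM ih. Qed.

Lemma abs_Re z : `|Re z| <= cabs z.
Proof.
by rewrite -(@ler_pXn2r _ 2)// ?nnegrE// sqr_cabs real_normK ?num_real// lerDl sqr_ge0.
Qed.

Lemma abs_Im z : `|Im z| <= cabs z.
Proof.
by rewrite -(@ler_pXn2r _ 2)// ?nnegrE// sqr_cabs real_normK ?num_real// lerDr sqr_ge0.
Qed.

Lemma Re_le_cabs z : Re z <= cabs z.
Proof. exact: le_trans (ler_norm _) (abs_Re _). Qed.

Lemma cabs_le z : cabs z <= `|Re z| + `|Im z|.
Proof.
rewrite -(@ler_pXn2r _ 2)// ?nnegrE ?addr_ge0// sqr_cabs sqrrD.
rewrite !real_normK ?num_real//.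
have : 0 <= `|Re z| * `|Im z| by rewrite mulr_ge0.
by lra.
Qed.

Lemma mulJ z : z * z^* = (cabs z ^+ 2)%:C.
Proof. by rewrite sqr_cabs; apply: complexP; rewrite !reimE /=; ring. Qed.

Lemma cabsD_sqr_le z w : cabs (z + w) ^+ 2 <= 2 * (cabs z ^+ 2 + cabs w ^+ 2).
Proof.
rewrite !sqr_cabs !reimE.
have := sqr_ge0 (Re z - Re w); have := sqr_ge0 (Im z - Im w).
by nra.
Qed.

Lemma cexp0 : cexp (0 : R[i]) = 1.
Proof. by rewrite /cexp /= expR0 cos0 sin0 mulr1 mulr0. Qed.

Lemma cexpD z w : cexp (z + w) = cexp z * cexp w.
Proof.
by apply: complexP; rewrite /cexp /= !reimE expRD ?cosD ?sinD; ring.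
Qed.

Lemma cabs_cexp z : cabs (cexp z) = expR (Re z).
Proof.
apply/eqP; rewrite -(@eqrXn2 _ 2)// ?expR_ge0//; apply/eqP.
rewrite sqr_cabs /= !exprMn -mulrDr cos2Dsin2 mulr1//.
Qed.

Lemma cexp_neq0 z : cexp z != 0.
Proof. by rewrite -cabs_gt0 cabs_cexp expR_gt0. Qed.

Lemma cexpN z : cexp (- z) = (cexp z)^-1.
Proof.
apply: (mulIf (cexp_neq0 z)); rewrite mulVf ?cexp_neq0// -cexpD addNr cexp0//.
Qed.

Lemma cexpJ z : (cexp z)^* = cexp z^*.
Proof.
by apply: complexP; rewrite /cexp /= ?reimE /= ?reimE ?cosN ?sinN ?mulrN.
Qed.

Lemma cexpC x : cexp x%:C = (expR x)%:C.
Proof. by rewrite /cexp /= cos0 sin0 mulr1 mulr0. Qed.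

Lemma cexp_i x : cexp ('i%C * x%:C) = cos x +i* sin x.
Proof. by rewrite /cexp /= !mul0r !mul1r !subr0 !add0r expR0 !mul1r. Qed.

End complex_basics.
#[global] Hint Extern 0 (is_true (Order.le _ (Normc.normc _))) => solve [exact: cabs_ge0] : core.

(** * Measurability of complex-valued functions *)

Section measurability.
Context {R : realType} {d : measure_display} {T : measurableType d}.
Implicit Types (D : set T) (f g : T -> R[i]) (u v : T -> R).

Definition cmeas D f :=
  measurable_fun D (fun x => Re (f x)) /\ measurable_fun D (fun x => Im (f x)).

Lemma eq_cmeas D f g : f =1 g -> cmeas D f -> cmeas D g.
Proof. by move=> /funext ->. Qed.

Lemma cmeasS D E f : measurable E -> D `<=` E -> cmeas E f -> cmeas D f.
Proof. by move=> mE DE [? ?]; split; apply: measurable_funS mE DE _. Qed.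

Lemma cmeasT D f : cmeas setT f -> cmeas D f.
Proof. by apply: cmeasS => //; exact: measurableT. Qed.

Lemma cmeas_cst D (c : R[i]) : cmeas D (fun=> c).
Proof. by split; exact: measurable_cst. Qed.

Lemma cmeasC D u : measurable_fun D u -> cmeas D (fun x => (u x)%:C).
Proof. by move=> mu; split => //=; exact: measurable_cst. Qed.

Lemma cmeas_pair D u v : measurable_fun D u -> measurable_fun D v ->
  cmeas D (fun x => u x +i* v x).
Proof. by move=> mu mv; split. Qed.

Lemma cmeasD D f g : cmeas D f -> cmeas D g -> cmeas D (fun x => f x + g x).
Proof.
move=> [fr fi] [gr gi]; split.
  by under eq_fun do rewrite cReD; exact: measurable_funD.
by under eq_fun do rewrite cImD; exact: measurable_funD.
Qed.

Lemma cmeasN D f : cmeas D f -> cmeas D (fun x => - f x).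
Proof.
move=> [fr fi]; split.
  by under eq_fun do rewrite cReN; exact: measurable_funN.
by under eq_fun do rewrite cImN; exact: measurable_funN.
Qed.

Lemma cmeasB D f g : cmeas D f -> cmeas D g -> cmeas D (fun x => f x - g x).
Proof. by move=> mf mg; apply: cmeasD => //; exact: cmeasN. Qed.

Lemma cmeasM D f g : cmeas D f -> cmeas D g -> cmeas D (fun x => f x * g x).
Proof.
move=> [fr fi] [gr gi]; split.
  by under eq_fun do rewrite cReM; apply: measurable_funB; exact: measurable_funM.
by under eq_fun do rewrite cImM; apply: measurable_funD; exact: measurable_funM.
Qed.

Lemma cmeasX D f n : cmeas D f -> cmeas D (fun x => f x ^+ n).
Proof.
move=> mf; elim: n => [|n ih]; first by under eq_fun do rewrite expr0; exact: cmeas_cst.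
by under eq_fun do rewrite exprS; exact: cmeasM.
Qed.

Lemma cmeasJ D f : cmeas D f -> cmeas D (fun x => (f x)^*).
Proof.
move=> [fr fi]; split; first by under eq_fun do rewrite cReJ.
by under eq_fun do rewrite cImJ; exact: measurable_funN.
Qed.

Lemma measurable_cabs D f : cmeas D f -> measurable_fun D (fun x => cabs (f x)).
Proof.
move=> [fr fi]; rewrite (_ : (fun x => _) =
  (fun x => Num.sqrt (Re (f x) ^+ 2 + Im (f x) ^+ 2))); last first.
  by apply/funext => x; case: (f x).
apply: measurableT_comp => //.
  by apply: continuous_measurable_fun; exact: sqrt_continuous.
by apply: measurable_funD; exact: measurable_funX.
Qed.

Lemma measurable_sqr_cabs D f : cmeas D f -> measurable_fun D (fun x => cabs (f x) ^+ 2).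
Proof. by move=> mf; apply: measurable_funX; exact: measurable_cabs. Qed.

Lemma measurable_cos_comp D u : measurable_fun D u -> measurable_fun D (fun x => cos (u x)).
Proof.
move=> mu; apply: measurableT_comp mu.
by apply: continuous_measurable_fun; exact: continuous_cos.
Qed.

Lemma measurable_sin_comp D u : measurable_fun D u -> measurable_fun D (fun x => sin (u x)).
Proof.
move=> mu; apply: measurableT_comp mu.
by apply: continuous_measurable_fun; exact: continuous_sin.
Qed.

Lemma measurable_expR_comp D u : measurable_fun D u -> measurable_fun D (fun x => expR (u x)).
Proof. by move=> mu; apply: measurableT_comp mu. Qed.

Lemma measurable_norm_comp D u : measurable_fun D u -> measurable_fun D (fun x => `|u x|).
Proof. by move=> mu; apply: measurableT_comp mu. Qed.

Lemma cmeas_cexp D f : cmeas D f -> cmeas D (fun x => cexp (f x)).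
Proof.
move=> [fr fi]; split => /=; apply: measurable_funM.
- exact: measurable_expR_comp.
- exact: measurable_cos_comp.
- exact: measurable_expR_comp.
- exact: measurable_sin_comp.
Qed.

End measurability.

Lemma cmeas_comp {R : realType} {d d' : measure_display} {T : measurableType d}
    {T' : measurableType d'} (h : T -> T') (f : T' -> R[i]) :
  measurable_fun setT h -> cmeas setT f -> cmeas setT (fun x => f (h x)).
Proof. by move=> mh [fr fi]; split; [apply: (measurableT_comp fr mh)|apply: (measurableT_comp fi mh)]. Qed.

Ltac cmeas_step := lazymatch goal with
  | |- cmeas _ (fun _ => ?c) => exact: cmeas_cst
  | |- cmeas _ (fun x => @?f x - @?g x) => refine (@cmeasB _ _ _ _ f g _ _)
  | |- cmeas _ (fun x => @?f x + @?g x) => refine (@cmeasD _ _ _ _ f g _ _)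
  | |- cmeas _ (fun x => - (@?f x)) => refine (@cmeasN _ _ _ _ f _)
  | |- cmeas _ (fun x => @?f x * @?g x) => refine (@cmeasM _ _ _ _ f g _ _)
  | |- cmeas _ (fun x => (@?f x) ^+ ?n) => refine (@cmeasX _ _ _ _ f n _)
  | |- cmeas _ (fun x => cexp (@?f x)) => refine (@cmeas_cexp _ _ _ _ f _)
  | |- cmeas _ (fun x => (@?f x)^*) => refine (@cmeasJ _ _ _ _ f _)
  | |- cmeas _ (fun x => (@?u x)%:C) => refine (@cmeasC _ _ _ _ u _)
  | |- cmeas _ (fun x => (@?u x) +i* (@?v x)) => refine (@cmeas_pair _ _ _ _ u v _ _)
  | |- measurable_fun _ (fun _ => ?c) => exact: measurable_cst
  | |- measurable_fun _ (fun x => x) => exact: measurable_id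
  | |- measurable_fun _ (fun x => fst x) => exact: measurable_fst
  | |- measurable_fun _ (fun x => snd x) => exact: measurable_snd
  | |- measurable_fun _ (fun x => @?f x - @?g x) => apply: measurable_funB
  | |- measurable_fun _ (fun x => @?f x + @?g x) => apply: measurable_funD
  | |- measurable_fun _ (fun x => - (@?f x)) => apply: measurable_funN
  | |- measurable_fun _ (fun x => @?f x * @?g x) => apply: measurable_funM
  | |- measurable_fun _ (fun x => (@?f x) ^+ ?n) => apply: measurable_funX
  | |- measurable_fun _ (fun x => expR (@?f x)) => refine (@measurable_expR_comp _ _ _ _ f _)
  | |- measurable_fun _ (fun x => cos (@?f x)) => refine (@measurable_cos_comp _ _ _ _ f _)
  | |- measurable_fun _ (fun x => sin (@?f x)) => refine (@measurable_sin_comp _ _ _ _ f _)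
  | |- measurable_fun _ (fun x => Normc.normc (@?f x)) => refine (@measurable_cabs _ _ _ _ f _)
  | |- measurable_fun _ (fun x => `| @?f x |) => refine (@measurable_norm_comp _ _ _ _ f _)
  | _ => assumption
  end.

Ltac cmeas_tac := repeat (cbv beta; cmeas_step).

(** * Integrals of complex-valued functions *)

Section integrals.
Context {R : realType} {d : measure_display} {T : measurableType d}.
Variables (mu : {measure set T -> \bar R}) (D : set T).
Hypothesis mD : measurable D.
Implicit Types (f g : T -> R[i]) (u v : T -> R).

Local Notation int f := (cintegral mu D f).

Lemma eq_cintegral f g : {in D, f =1 g} -> int f = int g.
Proof.
by move=> fg; congr (_ +i* _); apply: eq_Rintegral => x xD /=; rewrite fg.
Qed.

Lemma cintegrable_cmeas f : cintegrable mu D f -> cmeas D f.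
Proof. by move=> [fr fi]; split; apply/measurable_EFinP; [exact: measurable_int fr|exact: measurable_int fi]. Qed.

Lemma le_integrableR u v : measurable_fun D u -> (forall x, D x -> `|u x| <= v x) ->
  mu.-integrable D (EFin \o v) -> mu.-integrable D (EFin \o u).
Proof.
move=> mu' uv iv; apply: (le_integrable mD _ _ iv).
  exact/measurable_EFinP.
by move=> x Dx /=; rewrite lee_fin (le_trans (uv _ Dx))// ler_norm.
Qed.

Lemma integrableRZ (k : R) u : mu.-integrable D (EFin \o u) ->
  mu.-integrable D (EFin \o (fun x => k * u x)).
Proof. by move=> /(integrableZl mD k). Qed.

Lemma integrableRD u v : mu.-integrable D (EFin \o u) -> mu.-integrable D (EFin \o v) ->
  mu.-integrable D (EFin \o (fun x => u x + v x)).
Proof. exact: integrableD. Qed.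

Lemma le_cintegrable f v : cmeas D f -> (forall x, D x -> cabs (f x) <= v x) ->
  mu.-integrable D (EFin \o v) -> cintegrable mu D f.
Proof.
move=> [fr fi] fv iv; split; apply: (le_integrableR _ _ iv) => // x Dx.
  by rewrite (le_trans (abs_Re _))// fv.
by rewrite (le_trans (abs_Im _))// fv.
Qed.

Lemma eq_cintegrable f g : {in D, f =1 g} -> cintegrable mu D f -> cintegrable mu D g.
Proof.
by move=> fg [fr fi]; split;
  [apply: eq_integrable fr|apply: eq_integrable fi] => // x xD /=; rewrite fg.
Qed.

Lemma integrable_cabs f : cintegrable mu D f ->
  mu.-integrable D (EFin \o (fun x => cabs (f x))).
Proof.
move=> fi; apply: (@le_integrableR _ (fun x => `|Re (f x)| + `|Im (f x)|)).
- by apply: measurable_cabs; exact: cintegrable_cmeas.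
- by move=> x _; rewrite [leLHS]ger0_norm//; exact: cabs_le.
- rewrite (_ : _ \o _ = (EFin \o ((fun t : R => `|t|) \o (fun x => Re (f x)))) \+ (EFin \o ((fun t : R => `|t|) \o (fun x => Im (f x)))))//.
  by case: fi => fr fi; apply: integrableD => //; apply: integrable_norm.
Qed.

Lemma cintegrableP f : cmeas D f ->
  cintegrable mu D f <-> (\int[mu]_(x in D) (cabs (f x))%:E < +oo)%E.
Proof.
move=> mf; split => [/integrable_cabs/integrableP[_]|h].
  by under eq_integral do rewrite /= ger0_norm//.
apply: (@le_cintegrable _ (fun x => cabs (f x))) => //.
apply/integrableP; split; first exact/measurable_EFinP/measurable_cabs.
by under eq_integral do rewrite /= ger0_norm//.
Qed.

Lemma cintegrableD f g : cintegrable mu D f -> cintegrable mu D g ->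
  cintegrable mu D (fun x => f x + g x).
Proof.
move=> [fr fi] [gr gi]; split.
  rewrite (_ : (fun _ => _) = (fun x => (Re (f x))%:E) \+ (fun x => (Re (g x))%:E)).
    exact: integrableD.
  by apply/funext => x /=; rewrite cReD.
rewrite (_ : (fun _ => _) = (fun x => (Im (f x))%:E) \+ (fun x => (Im (g x))%:E)).
  exact: integrableD.
by apply/funext => x /=; rewrite cImD.
Qed.

Lemma cintegrableMb c f g : cmeas D g -> (forall x, D x -> cabs (g x) <= c) ->
  cintegrable mu D f -> cintegrable mu D (fun x => g x * f x).
Proof.
move=> mg gc fi.
apply: (@le_cintegrable _ (fun x => c * cabs (f x))).
- by apply: cmeasM => //; exact: cintegrable_cmeas.
- by move=> x Dx; rewrite cabsM ler_wpM2r// gc.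
- rewrite (_ : _ \o _ = (fun x => c%:E * (EFin \o (fun x => cabs (f x))) x))%E//.
  by apply: integrableZl => //; exact: integrable_cabs.
Qed.

Lemma cintegrableZ c f : cintegrable mu D f -> cintegrable mu D (fun x => c * f x).
Proof. by apply: (@cintegrableMb (cabs c)) => //; exact: cmeas_cst. Qed.

Lemma cintegrableN f : cintegrable mu D f -> cintegrable mu D (fun x => - f x).
Proof.
move=> /(cintegrableZ (-1)); apply: eq_cintegrable => x _.
by rewrite mulN1r.
Qed.

Lemma cintegrableB f g : cintegrable mu D f -> cintegrable mu D g ->
  cintegrable mu D (fun x => f x - g x).
Proof. by move=> fi gi; apply: cintegrableD => //; exact: cintegrableN. Qed.

Lemma cintegrableJ f : cintegrable mu D f -> cintegrable mu D (fun x => (f x)^*).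
Proof.
move=> fi; apply: (@le_cintegrable _ (fun x => cabs (f x))).
- by apply: cmeasJ; exact: cintegrable_cmeas.
- by move=> x _; rewrite cabsJ.
- exact: integrable_cabs.
Qed.

Lemma cintegralD f g : cintegrable mu D f -> cintegrable mu D g ->
  int (fun x => f x + g x) = int f + int g.
Proof.
move=> [fr fi] [gr gi]; apply: complexP; rewrite reimE /=.
  rewrite -RintegralD//; apply: eq_Rintegral => x _; exact: cReD.
rewrite -RintegralD//; apply: eq_Rintegral => x _; exact: cImD.
Qed.

Lemma cintegralZ c f : cintegrable mu D f -> int (fun x => c * f x) = c * int f.
Proof.
move=> [fr fi]; apply: complexP; rewrite reimE /=.
  rewrite -!RintegralZl// -RintegralB//; last 2 first.
  - by apply: (integrableZl mD (Re c) fr).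
  - by apply: (integrableZl mD (Im c) fi).
  by apply: eq_Rintegral => x _; exact: cReM.
rewrite -!RintegralZl// -RintegralD//; last 2 first.
- by apply: (integrableZl mD (Re c) fi).
- by apply: (integrableZl mD (Im c) fr).
by apply: eq_Rintegral => x _; exact: cImM.
Qed.

Lemma cintegralN f : cintegrable mu D f -> int (fun x => - f x) = - int f.
Proof.
move=> fi; rewrite -mulN1r -cintegralZ//; apply: eq_cintegral => x _.
by rewrite mulN1r.
Qed.

Lemma cintegralB f g : cintegrable mu D f -> cintegrable mu D g ->
  int (fun x => f x - g x) = int f - int g.
Proof.
by move=> fi gi; rewrite cintegralD// ?cintegralN//; exact: cintegrableN.
Qed.

Lemma cintegralJ f : cintegrable mu D f -> int (fun x => (f x)^*) = (int f)^*.
Proof.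
move=> [fr fi]; apply: complexP; rewrite reimE /=.
  by apply: eq_Rintegral => x _; exact: cReJ.
rewrite -mulN1r -RintegralZl//; apply: eq_Rintegral => x _.
by rewrite cImJ mulN1r.
Qed.

Lemma cintegralC u : int (fun x => (u x)%:C) = (\int[mu]_(x in D) u x)%:C.
Proof.
apply: complexP => //=; rewrite /Rintegral.
by rewrite integral0.
Qed.

Lemma cintegral0 : int (fun=> 0) = 0.
Proof. by apply: complexP; rewrite /= /Rintegral integral0. Qed.

(** Multiplying by the unimodular [c] that makes the integral a nonnegative real reduces the claim
    to monotonicity of the real integral, because Re z <= |z|. *)
Lemma cabs_cintegral f : cintegrable mu D f ->
  cabs (int f) <= \int[mu]_(x in D) cabs (f x).
Proof.
move=> fi; have [->|nz] := eqVneq (int f) 0.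
  by rewrite cabs0; apply: Rintegral_ge0.
have nz' : cabs (int f) != 0 by rewrite cabs_eq0.
pose c := (cabs (int f))^-1%:C * (int f)^*.
have ce : (cabs (int f))%:C = c * int f.
  rewrite /c -mulrA (mulrC _ (int f)) mulJ -rmorphM /=; congr _%:C.
  by rewrite expr2 mulrA mulVf ?mul1r// cabs_eq0.
have c1 : cabs c = 1.
  by rewrite cabsM cabsJ cabsC ger0_norm ?invr_ge0// mulVf.
rewrite (_ : cabs (int f) = Re (c * int f)); last by rewrite -ce.
have fic := cintegrableZ c fi.
rewrite -cintegralZ//=; apply: le_Rintegral => //.
- by case: fic.
- exact: integrable_cabs.
- by move=> x _; rewrite (le_trans (Re_le_cabs _))// cabsM c1 mul1r.
Qed.

Lemma cabs_cintegral_le f v : cmeas D f -> (forall x, D x -> cabs (f x) <= v x) ->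
  mu.-integrable D (EFin \o v) -> cabs (int f) <= \int[mu]_(x in D) v x.
Proof.
move=> mf fv iv; have fi := le_cintegrable mf fv iv.
apply: (le_trans (cabs_cintegral fi)); apply: le_Rintegral => //.
exact: integrable_cabs.
Qed.

Lemma ae_eq_cintegral f g : cmeas D f -> cmeas D g ->
  {ae mu, forall x, f x = g x} -> int f = int g.
Proof.
move=> [fr fi] [gr gi] fg; congr (_ +i* _); rewrite /Rintegral; congr fine;
  apply: ae_eq_integral => //; try exact/measurable_EFinP.
- by move: fg; apply: filterS => x -> _.
- by move: fg; apply: filterS => x -> _.
Qed.

Lemma ge0_intZ (k : R) u : 0 <= k -> measurable_fun D u -> (forall x, 0 <= u x) ->
  (\int[mu]_(x in D) (k * u x)%:E = k%:E * \int[mu]_(x in D) (u x)%:E)%E.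
Proof.
move=> k0 /measurable_EFinP mu' u0; rewrite -(ge0_integralZl mu mD mu')//.
by move=> x _; rewrite lee_fin.
Qed.

Lemma ge0_intD u v : measurable_fun D u -> measurable_fun D v ->
  (forall x, 0 <= u x) -> (forall x, 0 <= v x) ->
  (\int[mu]_(x in D) (u x + v x)%:E =
   \int[mu]_(x in D) (u x)%:E + \int[mu]_(x in D) (v x)%:E)%E.
Proof.
move=> /measurable_EFinP mu' /measurable_EFinP mv u0 v0.
rewrite -(ge0_integralD mu mD _ mu' _ mv)//; first by move=> x _; rewrite lee_fin.
by move=> x _; rewrite lee_fin.
Qed.

Lemma ge0_int_le u v : measurable_fun D u -> measurable_fun D v ->
  (forall x, 0 <= u x) -> (forall x, u x <= v x) ->
  (\int[mu]_(x in D) (u x)%:E <= \int[mu]_(x in D) (v x)%:E)%E.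
Proof.
move=> /measurable_EFinP mu' /measurable_EFinP mv u0 uv.
by apply: ge0_le_integral => // x _; rewrite lee_fin.
Qed.

Lemma ae_imply (P Q : T -> Prop) : (forall x, P x -> Q x) ->
  {ae mu, forall x, P x} -> {ae mu, forall x, Q x}.
Proof. by move=> PQ; apply: filterS. Qed.

(** Stated through moduli, so that squeezing takes place among real sequences and no topology on
    [R[i]] intervenes. *)
Definition ccvg (u : nat -> R[i]) (l : R[i]) := cabs (u n - l) @[n --> \oo] --> (0 : R).

Lemma ccvgP (u : nat -> R[i]) l : ccvg u l <->
  (Re (u n) @[n --> \oo] --> Re l /\ Im (u n) @[n --> \oo] --> Im l).
Proof.
split=> [h|[hr hi]].
  split; apply/subr_cvg0; apply: norm_cvg0;
   apply: (squeeze_cvgr _ (cvg_cst 0) h); near=> n; rewrite normr_ge0 /=.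
  - by rewrite -cReN -cReD abs_Re.
  - by rewrite -cImN -cImD abs_Im.
have {}h : `|Re (u n) - Re l| + `|Im (u n) - Im l| @[n --> \oo] --> (0 : R).
  rewrite -[X in _ --> X]addr0; apply: cvgD; apply/norm_cvg0P; exact/subr_cvg0.
apply: (squeeze_cvgr _ (cvg_cst 0) h); near=> n; rewrite cabs_ge0 /=.
by rewrite (le_trans (cabs_le _))// !reimE.
Unshelve. all: by end_near. Qed.

Lemma cdominated_cvg (f_ : nat -> T -> R[i]) f v :
  (forall n, cmeas D (f_ n)) -> (forall x, D x -> ccvg (f_ ^~ x) (f x)) ->
  mu.-integrable D (EFin \o v) ->
  (forall n x, D x -> cabs (f_ n x) <= v x) ->
  cintegrable mu D f /\ ccvg (fun n => int (f_ n)) (int f).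
Proof.
move=> mf cf iv fv.
have key (p : R[i] -> R) : (forall z, `|p z| <= cabs z) ->
    (forall n, measurable_fun D (fun x => p (f_ n x))) ->
    (forall x, D x -> p (f_ n x) @[n --> \oo] --> p (f x)) ->
    mu.-integrable D (fun x => (p (f x))%:E) /\
    \int[mu]_(x in D) p (f_ n x) @[n --> \oo] --> \int[mu]_(x in D) p (f x).
  move=> pc mp cp.
  have [] := @dominated_convergence _ _ _ mu D mD (fun n x => (p (f_ n x))%:E)
     (fun x => (p (f x))%:E) (EFin \o v).
  - by move=> n; exact/measurable_EFinP.
  - by apply/measurable_EFinP; apply: measurable_fun_cvg cp.
  - by apply: aeW => x Dx; apply: cvg_EFin; [exact: nearW|exact: cp].
  - exact: iv.
  - by apply: aeW => x n Dx /=; rewrite lee_fin (le_trans (pc _))// fv.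
  move=> ip _ c; split => //; apply: fine_cvg; rewrite fineK//.
  exact: integrable_fin_num.
have [ir cr] := key (@complex.Re R) (@abs_Re R) (fun n => (mf n).1)
  (fun x Dx => ((ccvgP _ _).1 (cf x Dx)).1).
have [ii ci] := key (@complex.Im R) (@abs_Im R) (fun n => (mf n).2)
  (fun x Dx => ((ccvgP _ _).1 (cf x Dx)).2).
by split => //; apply/ccvgP.
Qed.

End integrals.

Section indicator.
Context {R : realType} {d : measure_display} {T : measurableType d}.
Variable mu : {measure set T -> \bar R}.

Lemma indic_ge0 (D : set T) x : 0 <= \1_D x :> R.
Proof. by rewrite indicE; case: (_ \in _). Qed.

Lemma indic_le1 (D : set T) x : \1_D x <= 1 :> R.
Proof. by rewrite indicE; case: (_ \in _). Qed.

Lemma Rintegral_indic (D : set T) (u : T -> R) :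
  \int[mu]_(x in D) u x = \int[mu]_x (\1_D x * u x).
Proof.
rewrite Rintegral_mkcond; apply: eq_Rintegral => x _.
by rewrite patchE indicE; case: ifPn => _; rewrite ?mul1r ?mul0r.
Qed.

Lemma cintegral_indic (D : set T) (f : T -> R[i]) :
  cintegral mu D f = cintegral mu setT (fun x => (\1_D x)%:C * f x).
Proof.
apply: complexP => /=; rewrite Rintegral_indic; apply: eq_Rintegral => x _.
  by rewrite cReM /= mul0r subr0.
by rewrite cImM /= mul0r addr0.
Qed.

Lemma cintegrable_indic (D : set T) (f : T -> R[i]) : measurable D ->
  cintegrable mu D f <-> cintegrable mu setT (fun x => (\1_D x)%:C * f x).
Proof.
move=> mD; split=> [[fr fi]|[fr fi]].
  split.
    move/(integrable_mkcond _ mD) : fr; apply: eq_integrable => // x _.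
    by rewrite cReM /= mul0r subr0 patchE indicE; case: ifPn => _; rewrite ?mul1r ?mul0r.
  move/(integrable_mkcond _ mD) : fi; apply: eq_integrable => // x _.
  by rewrite cImM /= mul0r addr0 patchE indicE; case: ifPn => _; rewrite ?mul1r ?mul0r.
split; apply/(integrable_mkcond _ mD).
  move: fr; apply: eq_integrable => // x _.
  by rewrite cReM /= mul0r subr0 patchE indicE; case: ifPn => _; rewrite ?mul1r ?mul0r.
move: fi; apply: eq_integrable => // x _.
by rewrite cImM /= mul0r addr0 patchE indicE; case: ifPn => _; rewrite ?mul1r ?mul0r.
Qed.

Lemma cmeas_indic (D : set T) : measurable D ->
  cmeas setT (fun x => (\1_D x : R)%:C).
Proof. by move=> mD; apply: cmeasC. Qed.

Lemma cintegrableS (D E : set T) (f : T -> R[i]) : measurable D -> measurable E ->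
  D `<=` E -> cintegrable mu E f -> cintegrable mu D f.
Proof. by move=> mD mE DE [fr fi]; split; apply: integrableS mE mD DE _. Qed.

End indicator.

(** * Fubini's theorem *)

Section fubini.
Context {R : realType} {d1 d2 : measure_display} {T1 : measurableType d1}
  {T2 : measurableType d2}.
Variables (m1 : {sigma_finite_measure set T1 -> \bar R})
  (m2 : {sigma_finite_measure set T2 -> \bar R}).
Implicit Types F : T1 * T2 -> R[i].

(** Every slice, and not only almost every one, is assumed integrable: the real-valued inner
    integral then agrees at each point with the extended-real [fubini_F]. *)
Lemma Rfubini1 (f : T1 * T2 -> R) : (m1 \x m2)%E.-integrable setT (EFin \o f) ->
  (forall x, m2.-integrable setT (fun y => (f (x, y))%:E)) ->
  m1.-integrable setT (EFin \o (fun x => \int[m2]_y f (x, y))) /\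
  \int[m1]_x \int[m2]_y f (x, y) = \int[(m1 \x m2)%E]_p f p.
Proof.
move=> fi f2.
have e x : (\int[m2]_y f (x, y))%:E = fubini_F m2 (EFin \o f) x.
  by rewrite /Rintegral fineK//; exact: integrable_fin_num.
split.
  by apply: eq_integrable (integrable_fubini_F fi) => // x _; rewrite /= e.
rewrite /Rintegral; congr fine.
rewrite -(integral12_prod_meas1 fi); apply: eq_integral => x _; exact: e.
Qed.

Lemma Rfubini2 (f : T1 * T2 -> R) : (m1 \x m2)%E.-integrable setT (EFin \o f) ->
  (forall y, m1.-integrable setT (fun x => (f (x, y))%:E)) ->
  \int[m2]_y \int[m1]_x f (x, y) = \int[(m1 \x m2)%E]_p f p.
Proof.
move=> fi f2.
have e y : (\int[m1]_x f (x, y))%:E = fubini_G m1 (EFin \o f) y.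
  by rewrite /Rintegral fineK//; exact: integrable_fin_num.
rewrite /Rintegral; congr fine.
rewrite -(integral21_prod_meas1 fi); apply: eq_integral => x _; exact: e.
Qed.

Lemma cfubini1 F : cintegrable (m1 \x m2)%E setT F ->
  (forall x, cintegrable m2 setT (fun y => F (x, y))) ->
  cintegrable m1 setT (fun x => cintegral m2 setT (fun y => F (x, y))) /\
  cintegral m1 setT (fun x => cintegral m2 setT (fun y => F (x, y))) =
  cintegral (m1 \x m2)%E setT F.
Proof.
move=> [Fr Fi] F2.
have [ir er] := Rfubini1 Fr (fun x => (F2 x).1).
have [ii ei] := Rfubini1 Fi (fun x => (F2 x).2).
by split => //; apply: complexP.
Qed.

Lemma cfubini F : cintegrable (m1 \x m2)%E setT F ->
  (forall x, cintegrable m2 setT (fun y => F (x, y))) ->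
  (forall y, cintegrable m1 setT (fun x => F (x, y))) ->
  cintegral m1 setT (fun x => cintegral m2 setT (fun y => F (x, y))) =
  cintegral m2 setT (fun y => cintegral m1 setT (fun x => F (x, y))).
Proof.
move=> [Fr Fi] F2 F1; apply: complexP => /=.
  by rewrite (Rfubini1 Fr (fun x => (F2 x).1)).2 (Rfubini2 Fr (fun x => (F1 x).1)).
by rewrite (Rfubini1 Fi (fun x => (F2 x).2)).2 (Rfubini2 Fi (fun x => (F1 x).2)).
Qed.

Lemma cmeas_slice1 F x : cmeas setT F -> cmeas setT (fun y => F (x, y)).
Proof. by move=> mF; apply: (cmeas_comp (h := pair x)) mF; exact: pair1_measurable. Qed.

Lemma cmeas_slice2 F y : cmeas setT F -> cmeas setT (fun x => F (x, y)).
Proof. by move=> mF; apply: (cmeas_comp (h := pair^~ y)) mF; exact: pair2_measurable. Qed.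

Lemma integrable_prodM (A : T1 -> R) (B : T2 -> R) :
  (forall x, 0 <= A x) -> (forall y, 0 <= B y) ->
  m1.-integrable setT (EFin \o A) -> m2.-integrable setT (EFin \o B) ->
  (m1 \x m2)%E.-integrable setT (EFin \o (fun p => A p.1 * B p.2)).
Proof.
move=> A0 B0 iA iB.
have mA : measurable_fun setT A by apply/measurable_EFinP; exact: measurable_int iA.
have mB : measurable_fun setT B by apply/measurable_EFinP; exact: measurable_int iB.
have mAB : measurable_fun setT (EFin \o (fun p : T1 * T2 => A p.1 * B p.2)).
  apply/measurable_EFinP; apply: measurable_funM.
    exact: (measurableT_comp mA measurable_fst).
  exact: (measurableT_comp mB measurable_snd).
apply/(integrable12ltyP _ _ mAB) => /=.
under eq_integral => x _.
  under eq_integral do rewrite ger0_norm ?mulr_ge0// EFinM.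
  rewrite ge0_integralZl//; last 3 first.
  - exact/measurable_EFinP.
  - by move=> y _; rewrite lee_fin.
  - by rewrite lee_fin.
  over.
rewrite /=.
have iB0 : (0 <= \int[m2]_y (B y)%:E)%E by apply: integral_ge0 => y _; rewrite lee_fin.
rewrite ge0_integralZr//; last 2 first.
- exact/measurable_EFinP.
- by move=> x _; rewrite lee_fin.
rewrite lte_mul_pinfty//.
- by apply: integral_ge0 => x _; rewrite lee_fin.
- exact: integrable_fin_num.
- exact: integrable_lty.
Qed.

(** A bound by a product makes all slices integrable at once, which is what [cfubini] asks for. *)
Lemma cfubini_bound F (A : T1 -> R) (B : T2 -> R) : cmeas setT F ->
  (forall x, 0 <= A x) -> (forall y, 0 <= B y) ->
  m1.-integrable setT (EFin \o A) -> m2.-integrable setT (EFin \o B) ->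
  (forall x y, cabs (F (x, y)) <= A x * B y) ->
  [/\ cintegrable (m1 \x m2)%E setT F,
     (forall x, cintegrable m2 setT (fun y => F (x, y))),
     (forall y, cintegrable m1 setT (fun x => F (x, y))),
     cintegrable m1 setT (fun x => cintegral m2 setT (fun y => F (x, y))) &
     cintegral m1 setT (fun x => cintegral m2 setT (fun y => F (x, y))) =
     cintegral m2 setT (fun y => cintegral m1 setT (fun x => F (x, y)))].
Proof.
move=> mF A0 B0 iA iB FAB.
have iF : cintegrable (m1 \x m2)%E setT F.
  apply: (le_cintegrable _ mF _ (integrable_prodM A0 B0 iA iB)) => //.
  by move=> [x y] _; exact: FAB.
have F2 x : cintegrable m2 setT (fun y => F (x, y)).
  apply: (@le_cintegrable _ _ _ _ _ _ _ (fun y => A x * B y)) => //.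
    exact: cmeas_slice1.
  rewrite (_ : _ \o _ = (fun y => (A x)%:E * (EFin \o B) y))%E//.
  exact: integrableZl.
have F1 y : cintegrable m1 setT (fun x => F (x, y)).
  apply: (@le_cintegrable _ _ _ _ _ _ _ (fun x => B y * A x)) => //.
  - exact: cmeas_slice2.
  - by move=> x _; rewrite mulrC.
  rewrite (_ : _ \o _ = (fun x => (B y)%:E * (EFin \o A) x))%E//.
  exact: integrableZl.
split => //; first exact: (cfubini1 iF F2).1.
exact: cfubini.
Qed.

End fubini.

(** * Measure-preserving maps of the line and the plane *)

Section measure_preserving.
Context {R : realType} {d : measure_display} {T : measurableType d}.
Variable mu : {measure set T -> \bar R}.

(** Measure preservation is phrased with nonnegative integrals instead of preimages: this is the
    form that Tonelli's theorem delivers slice by slice, and it passes to complex integrals through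
    positive and negative parts. *)
Definition mpres (Phi : T -> T) := measurable_fun setT Phi /\
  forall f : T -> \bar R, measurable_fun setT f -> (forall x, 0 <= f x)%E ->
    (\int[mu]_x f (Phi x) = \int[mu]_x f x)%E.

Lemma mpres_comp (Phi Psi : T -> T) : mpres Phi -> mpres Psi -> mpres (Phi \o Psi).
Proof.
move=> [mPhi iPhi] [mPsi iPsi]; split; first exact: measurableT_comp.
move=> f mf f0; rewrite -(iPhi f)//.
by apply: (iPsi (f \o Phi)) => [|x]; [exact: measurableT_comp|exact: f0].
Qed.

Lemma mpres_integral Phi (f : T -> \bar R) : mpres Phi -> measurable_fun setT f ->
  (\int[mu]_x f (Phi x) = \int[mu]_x f x)%E.
Proof.
move=> [mPhi iPhi] mf; rewrite [LHS]integralE [RHS]integralE; congr (_ - _)%E.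
  rewrite -(iPhi _ (measurable_funepos mf) (funepos_ge0 _)).
  by apply: eq_integral => x _; rewrite -[RHS]/(((f^\+)%E \o Phi) x) -funepos_comp.
rewrite -(iPhi _ (measurable_funeneg mf) (funeneg_ge0 _)).
by apply: eq_integral => x _; rewrite -[RHS]/(((f^\-)%E \o Phi) x) -funeneg_comp.
Qed.

Lemma mpres_Rintegral Phi (u : T -> R) : mpres Phi -> measurable_fun setT u ->
  \int[mu]_x u (Phi x) = \int[mu]_x u x.
Proof.
move=> hP mu'; congr fine; apply: (mpres_integral (f := EFin \o u)) => //.
exact/measurable_EFinP.
Qed.

Lemma mpres_integrable Phi (u : T -> R) : mpres Phi ->
  mu.-integrable setT (EFin \o u) -> mu.-integrable setT (EFin \o (u \o Phi)).
Proof.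
move=> hP /integrableP[/measurable_EFinP mu' ui]; apply/integrableP; split.
  by apply/measurable_EFinP; apply: measurableT_comp hP.1.
rewrite (mpres_integral (f := fun x => `|(u x)%:E|%E) hP)//.
by apply/measurable_EFinP; apply: measurableT_comp.
Qed.

Lemma mpres_cintegral Phi (f : T -> R[i]) : mpres Phi -> cmeas setT f ->
  cintegral mu setT (fun x => f (Phi x)) = cintegral mu setT f.
Proof.
move=> hP [fr fi]; congr (_ +i* _).
  exact: (mpres_Rintegral (u := fun x => Re (f x))).
exact: (mpres_Rintegral (u := fun x => Im (f x))).
Qed.

Lemma mpres_cintegrable Phi (f : T -> R[i]) : mpres Phi -> cintegrable mu setT f ->
  cintegrable mu setT (fun x => f (Phi x)).
Proof.
move=> hP [fr fi]; split.
  exact: (mpres_integrable (u := fun x => Re (f x))).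
exact: (mpres_integrable (u := fun x => Im (f x))).
Qed.

End measure_preserving.

Section line.
Context {R : realType}.
Local Notation leb := (@lebesgue_measure R).

Lemma affine_preimage_oc (c a u v : R) : 0 < c ->
  (fun x => c * x + a) @^-1` `]u, v] = `](u - a) / c, (v - a) / c]%classic.
Proof.
move=> c0; apply/seteqP; split => x /=; rewrite !in_itv/= => /andP[h1 h2].
  by rewrite ltr_pdivrMr// ler_pdivlMr// ltrBlDr lerBrDr (mulrC x) h1 h2.
by move: h1 h2; rewrite ltr_pdivrMr// ler_pdivlMr// ltrBlDr lerBrDr (mulrC x) => -> ->.
Qed.

Lemma measurable_affine (c a : R) :
  measurable_fun setT ((fun x => c * x + a) : measurableTypeR R -> measurableTypeR R).
Proof. by apply: measurable_funD => //; exact: measurable_funM. Qed.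

(** The image of Lebesgue measure under the affine map, multiplied by [c], gives each half-open
    interval its length, so it is Lebesgue measure by uniqueness. *)
Lemma ge0_integral_affine (c a : R) (f : R -> \bar R) : 0 < c ->
  measurable_fun setT f -> (forall x, 0 <= f x)%E ->
  (\int[leb]_x f (c * x + a)%R = (c^-1)%:E * \int[leb]_x f x)%E.
Proof.
move=> c0 mf f0.
pose phi : measurableTypeR R -> measurableTypeR R := fun x => c * x + a.
have mphi : measurable_fun setT phi by exact: measurable_affine.
pose c' := NngNum (ltW c0).
have e A : measurable A -> leb A = mscale c' (pushforward leb phi) A.
  apply: lebesgue_measure_unique => _ [[u v]] _ <-.
  rewrite /= /mscale/= /pushforward affine_preimage_oc// !lebesgue_measure_itv/=.
  rewrite !lte_fin ltr_pM2r ?invr_gt0// ltrD2r; case: ifP => _; last by rewrite mule0.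
  rewrite -!EFinB -EFinM; congr EFin.
  have : c != 0 by rewrite gt_eqF.
  by move=> ?; field.
have -> : (\int[leb]_x f x = c%:E * \int[leb]_x f (c * x + a)%R)%E.
  rewrite (eq_measure_integral (mscale c' (pushforward leb phi))); last first.
    by move=> A mA _; exact: e.
  rewrite ge0_integral_mscale//; congr (_ * _)%E.
  by rewrite ge0_integral_pushforward.
by rewrite muleA -EFinM mulVf ?mul1e// gt_eqF.
Qed.

Lemma mpres_shift (a : R) : mpres leb (fun x => x + a).
Proof.
split; first by apply: measurable_funD.
move=> f mf f0; transitivity ((1^-1)%:E * \int[leb]_x f x)%E.
  by rewrite -(ge0_integral_affine a ltr01)//; under [RHS]eq_integral do rewrite mul1r.
by rewrite invr1 mul1e.
Qed.

Lemma mpres_opp : mpres leb (fun x => - x).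
Proof.
split; first by apply: measurable_funN.
move=> f mf f0.
transitivity (\int[pushforward leb (-%R : _ -> measurableTypeR R)]_x f x)%E.
  by rewrite ge0_integral_pushforward.
by apply: eq_measure_integral => A mA _; exact: lebesgue_measureN.
Qed.

Lemma Rintegral_scale (c : R) (u : R -> R) : 0 < c ->
  leb.-integrable setT (EFin \o u) ->
  leb.-integrable setT (EFin \o (fun x => u (c * x))) /\
  \int[leb]_x u (c * x) = c^-1 * \int[leb]_x u x.
Proof.
move=> c0 iu.
have mu : measurable_fun setT u by apply/measurable_EFinP; exact: measurable_int iu.
have mc : measurable_fun setT (fun x : R => c * x) by exact: measurable_funM.
have e (f : R -> \bar R) : measurable_fun setT f -> (forall x, 0 <= f x)%E ->
    (\int[leb]_x f (c * x)%R = (c^-1)%:E * \int[leb]_x f x)%E.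
  move=> mf f0; rewrite -(ge0_integral_affine 0 c0 mf f0).
  by under [RHS]eq_integral do rewrite addr0.
split.
  apply/integrableP; split; first by apply/measurable_EFinP; apply: measurableT_comp mc.
  rewrite (e (fun x => `|(u x)%:E|%E))//; last first.
    by apply/measurable_EFinP; apply: measurableT_comp.
  case/integrableP : iu => _ iu.
  by rewrite lte_mul_pinfty// ?lee_fin ?invr_ge0 ?ltW// ge0_fin_numE.
have -> : c^-1 * \int[leb]_x u x = fine ((c^-1)%:E * \int[leb]_x (u x)%:E)%E.
  by rewrite fineM//; exact: integrable_fin_num.
rewrite /Rintegral; congr fine.
rewrite [LHS]integralE [in RHS]integralE muleBr//; last first.
  rewrite fin_num_adde_defr//; exact: integrable_pos_fin_num.
congr (_ - _)%E.
  rewrite -(e _ _ (funepos_ge0 _)); last exact/measurable_funepos/measurable_EFinP.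
  by apply: eq_integral => x _; rewrite -[RHS]/((((EFin \o u)^\+)%E \o (fun x => c * x)) x) -funepos_comp.
rewrite -(e _ _ (funeneg_ge0 _)); last exact/measurable_funeneg/measurable_EFinP.
by apply: eq_integral => x _; rewrite -[RHS]/((((EFin \o u)^\-)%E \o (fun x => c * x)) x) -funeneg_comp.
Qed.

Lemma cintegral_scale (c : R) (f : R -> R[i]) : 0 < c -> cintegrable leb setT f ->
  cintegrable leb setT (fun x => f (c * x)) /\
  cintegral leb setT (fun x => f (c * x)) = (c^-1)%:C * cintegral leb setT f.
Proof.
move=> c0 [fr fi].
have [ir er] := Rintegral_scale c0 fr; have [ii ei] := Rintegral_scale c0 fi.
split => //; apply: complexP; rewrite ?cReM ?cImM /= ?mul0r ?subr0 ?addr0.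
  exact: er.
exact: ei.
Qed.

Lemma Rintegral_gauss : \int[leb]_x expR (- x ^+ 2) = Num.sqrt pi.
Proof. by rewrite /Rintegral [X in fine X]integralT_gauss. Qed.

Lemma integrable_gauss : leb.-integrable setT (EFin \o (fun x => expR (- x ^+ 2))).
Proof. exact: integrableT_gauss. Qed.

Lemma Rintegral_gauss_scale (c : R) : 0 < c ->
  leb.-integrable setT (EFin \o (fun x => expR (- (c * x ^+ 2)))) /\
  \int[leb]_x expR (- (c * x ^+ 2)) = Num.sqrt (pi / c).
Proof.
move=> c0.
have [] := @Rintegral_scale (Num.sqrt c) _ _ integrable_gauss; first by rewrite sqrtr_gt0.
have e x : expR (- (Num.sqrt c * x) ^+ 2) = expR (- (c * x ^+ 2)).
  by rewrite exprMn sqr_sqrtr// ltW.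
move=> i1 i2; split.
  by apply: eq_integrable i1 => // x _ /=; rewrite e.
under eq_Rintegral do rewrite -e.
rewrite i2 Rintegral_gauss mulrC sqrtrM ?pi_ge0// sqrtrV ?ltW//.
Qed.

End line.

Section plane.
Context {R : realType}.
Local Notation leb := (@lebesgue_measure R).
Local Notation R2 := (measurableTypeR R * measurableTypeR R)%type.

Lemma mpres_slice1 (Phi : R -> R -> R) :
  measurable_fun setT ((fun p => (Phi p.1 p.2, p.2)) : R2 -> R2) ->
  (forall y, mpres leb (Phi^~ y)) ->
  mpres area ((fun p => (Phi p.1 p.2, p.2)) : R2 -> R2).
Proof.
move=> mP hP; split => // f mf f0.
rewrite /area fubini_tonelli2//=; last first.
  by apply: measurableT_comp mP.
rewrite [RHS]fubini_tonelli2//=; apply: eq_integral => y _.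
by apply: ((hP y).2 (fun x => f (x, y))) => //; exact: measurableT_comp.
Qed.

Lemma mpres_slice2 (Phi : R -> R -> R) :
  measurable_fun setT ((fun p => (p.1, Phi p.1 p.2)) : R2 -> R2) ->
  (forall x, mpres leb (Phi x)) ->
  mpres area ((fun p => (p.1, Phi p.1 p.2)) : R2 -> R2).
Proof.
move=> mP hP; split => // f mf f0.
rewrite /area fubini_tonelli1//=; last first.
  by apply: measurableT_comp mP.
rewrite [RHS]fubini_tonelli1//=; apply: eq_integral => x _.
by apply: ((hP x).2 (fun y => f (x, y))) => //; exact: measurableT_comp.
Qed.

Lemma mpres_shear1 (a b : R) : mpres area ((fun p => (p.1 + (a * p.2 + b), p.2)) : R2 -> R2).
Proof.
apply: (@mpres_slice1 (fun x y => x + (a * y + b))); last by move=> y; exact: mpres_shift.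
apply: measurable_fun_pair => //; apply: measurable_funD => //.
by apply: measurable_funD => //; exact: measurable_funM.
Qed.

Lemma mpres_shear2 (a b : R) : mpres area ((fun p => (p.1, p.2 + (a * p.1 + b))) : R2 -> R2).
Proof.
apply: (@mpres_slice2 (fun x y => y + (a * x + b))); last by move=> y; exact: mpres_shift.
apply: measurable_fun_pair => //; apply: measurable_funD => //.
by apply: measurable_funD => //; exact: measurable_funM.
Qed.

Lemma mpres_translation (a b : R) : mpres area ((fun p => (p.1 + a, p.2 + b)) : R2 -> R2).
Proof.
have := mpres_comp (mpres_shear1 0 a) (mpres_shear2 0 b).
by congr mpres; apply/funext => -[x y] /=; rewrite !mul0r !add0r.
Qed.

(* away from the half turn, a rotation is a product of three shears *)
Lemma mpres_rotation (a b : R) : a ^+ 2 + b ^+ 2 = 1 ->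
  mpres area ((fun p => (a * p.1 - b * p.2, b * p.1 + a * p.2)) : R2 -> R2).
Proof.
have rot a' b' : a' ^+ 2 + b' ^+ 2 = 1 -> a' != -1 ->
  mpres area ((fun p => (a' * p.1 - b' * p.2, b' * p.1 + a' * p.2)) : R2 -> R2).
  (* [t] is the tangent of half the angle. The identities t (1 + a') = b' and 1 - t b' = a' are all
     that the product of the three shears requires. *)
  move=> ab an1; pose t := b' / (1 + a').
  have a1 : 1 + a' != 0 by rewrite addrC addr_eq0.
  have := mpres_comp (mpres_shear1 (- t) 0) (mpres_comp (mpres_shear2 b' 0) (mpres_shear1 (- t) 0)).
  congr mpres; apply/funext => -[x y] /=; rewrite !addr0.
  have tt : t * (1 + a') = b' by rewrite /t -mulrA mulVf ?mulr1.
  clearbody t.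
  have bb : b' ^+ 2 = 1 - a' ^+ 2 by rewrite -ab; ring.
  have tb : 1 - t * b' = a'.
    apply: (mulfI a1); transitivity ((1 + a') - t * (1 + a') * b'); first by ring.
    by rewrite tt -expr2 bb; ring.
  congr (_, _).
    transitivity ((1 - t * b') * x - t * (1 + (1 - t * b')) * y); first by ring.
    by rewrite tb tt.
  transitivity (b' * x + (1 - t * b') * y); first by ring.
  by rewrite tb.
move=> ab; have [a1|] := eqVneq a (-1); last exact: rot.
have b0 : b = 0.
  by apply/eqP; rewrite -sqrf_eq0; apply/eqP; move: ab; rewrite a1; lra.
(* The half turn, where the half-angle tangent is infinite, is the square of the quarter turn. *)
have h : mpres area ((fun p => (0 * p.1 - 1 * p.2, 1 * p.1 + 0 * p.2)) : R2 -> R2).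
  by apply: rot; [ring|rewrite eq_sym oppr_eq0 oner_eq0].
have := mpres_comp h h.
congr mpres; apply/funext => -[x y] /=.
by rewrite a1 b0; congr (_, _); ring.
Qed.

End plane.

(** * Complex differentiability *)

Section complex_derivative.
Context {R : realType}.
Implicit Types (f g : R[i] -> R[i]) (z w l : R[i]).

(** Continuity at 0 together with the value 0 there: the choice h = 0 is allowed and forces r 0 =
    0. *)
Definition cont0 (r : R[i] -> R[i]) := forall e : R, 0 < e ->
  exists2 d : R, 0 < d & forall h, cabs h < d -> cabs (r h) <= e.

Lemma cont0_id : cont0 id.
Proof. by move=> e e0; exists e => // h /ltW. Qed.

Lemma cont0D r s : cont0 r -> cont0 s -> cont0 (fun h => r h + s h).
Proof.
move=> cr cs e e0; have e2 : 0 < e / 2 by rewrite divr_gt0.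
have [d d0 hr] := cr _ e2; have [d' d'0 hs] := cs _ e2.
exists (Num.min d d'); first by rewrite lt_min d0.
move=> h; rewrite lt_min => /andP[h1 h2].
by rewrite (le_trans (cabsD _ _))// [leRHS]splitr lerD ?hr ?hs.
Qed.

Lemma cont0M r s : cont0 r -> cont0 s -> cont0 (fun h => r h * s h).
Proof.
move=> cr cs e e0.
have [d d0 hr] := cr _ e0; have [d' d'0 hs] := cs _ ltr01.
exists (Num.min d d'); first by rewrite lt_min d0.
move=> h; rewrite lt_min => /andP[h1 h2].
by rewrite cabsM -[leRHS]mulr1 ler_pM ?hr ?hs.
Qed.

Lemma cont0Z c r : cont0 r -> cont0 (fun h => c * r h).
Proof.
move=> cr e e0; have c0 : 0 < cabs c + 1 by rewrite ltr_wpDl.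
have [d d0 hr] := cr (e / (cabs c + 1)) ltac:(by rewrite divr_gt0).
exists d => // h hd; rewrite cabsM (@le_trans _ _ ((cabs c + 1) * cabs (r h)))//.
  by rewrite ler_wpM2r// lerDl.
by rewrite mulrC -ler_pdivlMr// hr.
Qed.

Lemma cont0_comp r s : cont0 r -> cont0 s -> cont0 (fun h => r (s h)).
Proof.
move=> cr cs e e0; have [d d0 hr] := cr _ e0.
have d2 : 0 < d / 2 by rewrite divr_gt0.
have [d' d'0 hs] := cs _ d2; exists d' => // h /hs h'; apply: hr.
by rewrite (le_lt_trans h')// ltr_pdivrMr// ltr_pMr// ltr1n.
Qed.

(* Caratheodory's formulation of complex differentiability *)
Definition cderiv f z l := exists2 r, cont0 r & forall h, f (z + h) = f z + (l + r h) * h.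

Lemma cderiv_cst (c : R[i]) z : cderiv (fun=> c) z 0.
Proof.
exists (fun=> 0); last by move=> h; rewrite addr0 mul0r addr0.
by move=> e e0; exists 1 => // h _; rewrite cabs0 ltW.
Qed.

Lemma cderiv_id z : cderiv id z 1.
Proof.
exists (fun=> 0); last by move=> h; rewrite addr0 mul1r.
by move=> e e0; exists 1 => // h _; rewrite cabs0 ltW.
Qed.

Lemma cderivD f g z l m : cderiv f z l -> cderiv g z m ->
  cderiv (fun x => f x + g x) z (l + m).
Proof.
move=> [r cr fr] [s cs gs]; exists (fun h => r h + s h); first exact: cont0D.
by move=> h; rewrite fr gs; ring.
Qed.

Lemma cderivM f g z l m : cderiv f z l -> cderiv g z m ->
  cderiv (fun x => f x * g x) z (l * g z + f z * m).
Proof.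
move=> [r cr fr] [s cs gs].
(* The remainder is what the expanded product leaves beyond the first order term, divided by [h];
   each summand contains a factor that vanishes at 0. *)
exists (fun h => g z * r h + f z * s h + (l * m) * h + l * (s h * h) + m * (r h * h)
  + r h * (s h * h)); last by move=> h; rewrite fr gs; ring.
have ci := cont0_id.
have cM (a b : R[i] -> R[i]) := @cont0M a b.
apply: cont0D; last by apply: (cM) => //; exact: cM.
apply: cont0D; last by apply: cont0Z; exact: cM.
apply: cont0D; last by apply: cont0Z; exact: cM.
apply: cont0D; last exact: cont0Z.
by apply: cont0D; exact: cont0Z.
Qed.

Lemma cderivZ c f z l : cderiv f z l -> cderiv (fun x => c * f x) z (c * l).
Proof.
move=> /(cderivM (cderiv_cst c z)); rewrite mul0r add0r; exact.
Qed.

Lemma cderiv_comp f g z l m : cderiv f (g z) l -> cderiv g z m ->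
  cderiv (fun x => f (g x)) z (l * m).
Proof.
move=> [r cr fr] [s cs gs].
pose k h := (m + s h) * h.
have ck : cont0 k.
  have -> : k = (fun h => m * h + s h * h) by apply/funext => h; rewrite /k mulrDl.
  by apply: cont0D; [apply: cont0Z|apply: cont0M => //]; exact: cont0_id.
exists (fun h => l * s h + m * r (k h) + r (k h) * s h).
  have crk : cont0 (fun h => r (k h)) by exact: cont0_comp.
  apply: cont0D; last exact: cont0M.
  by apply: cont0D; exact: cont0Z.
by move=> h; rewrite gs fr -/(k h) [in RHS]/k {2}/k; ring.
Qed.

Lemma cderiv_eps f z l :
  (forall e : R, 0 < e -> exists2 d : R, 0 < d & forall h, cabs h < d ->
    cabs (f (z + h) - f z - l * h) <= e * cabs h) -> cderiv f z l.
Proof.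
move=> H; exists (fun h => (f (z + h) - f z - l * h) / h); last first.
  move=> h; have [->|h0] := eqVneq h 0; first by rewrite mulr0 !addr0.
  by rewrite mulrDl divfK//; ring.
move=> e e0; have [d d0 hd] := H e e0; exists d => // h /hd.
rewrite cabsM cabsV; have [->|h0] := eqVneq h 0.
  by move=> _; rewrite cabs0 invr0 !mulr0 ltW.
by rewrite ler_pdivrMr ?cabs_gt0.
Qed.

Lemma normCE z : `|z| = (cabs z)%:C. Proof. by []. Qed.

(** The topological derivative over [R[i]] has its tolerances in [R[i]]; positivity there forces a
    zero imaginary part, so they reduce to real ones. *)
Lemma cderivP f z l : cderiv f z l <->
  (fun h : R[i]^o => h^-1 *: (((f : R[i]^o -> R[i]^o) \o shift z) (h *: (1 : R[i]^o)) - f z)) @ 0^'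
    --> (l : R[i]^o).
Proof.
split=> [[r cr fr]|].
  apply/cvgrPdist_le => e; rewrite ltcE => /andP[/= /eqP ie re].
  have [d d0 hd] := cr _ re; near=> h.
  have h0 : h != 0 by near: h; exact: nbhs_dnbhs_neq.
  have hl : cabs h < d.
    rewrite -ltcR; near: h; apply: (@dnbhs0_lt _ R[i]^o).
    by rewrite ltcR.
  have E : f (h * 1 + z) = f z + (l + r h) * h by rewrite mulr1 addrC fr.
  rewrite -[X in `|X|]/(l - h^-1 * (f (h * 1 + z) - f z)) E addrAC subrr add0r mulrCA.
  rewrite mulVf// mulr1 opprD addrA subrr add0r normrN normCE.
  by rewrite lecE /= ie eqxx hd.
move=> /cvgrPdist_le H; apply: cderiv_eps => e e0.
have /H : (0 : R[i]) < e%:C by rewrite ltcR.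
move=> /nbhs_ballP[d /=]; rewrite ltcE => /andP[/= /eqP id rd] hd.
exists (Re d) => // h hl; have [->|h0] := eqVneq h 0.
  by rewrite addr0 subrr mulr0 subrr cabs0 mulr0.
have /= := hd h; rewrite /ball/= sub0r normrN normCE ltcE /= id eqxx hl.
move=> /(_ isT h0).
rewrite -[X in `|X|]/(l - h^-1 * (f (h * 1 + z) - f z)) normCE lecR mulr1 (addrC h).
set A := f (z + h) - f z => hA.
have -> : A - l * h = - ((l - h^-1 * A) * h) by rewrite mulrBl mulrAC mulVf// mul1r opprB.
by rewrite cabsN cabsM ler_wpM2r.
Unshelve. all: by end_near. Qed.

Lemma entireP f : entire f <-> forall z, exists l, cderiv f z l.
Proof.
split=> H z; first by have /cvg_ex[l /cderivP] := H z; exists l.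
by have [l /cderivP hl] := H z; apply/cvg_ex; exists l.
Qed.

Lemma cderiv_cont f z l : cderiv f z l ->
  forall e : R, 0 < e -> exists2 d : R, 0 < d & forall h, cabs h < d -> cabs (f (z + h) - f z) <= e.
Proof.
move=> [r cr fr].
have : cont0 (fun h => l * h + r h * h).
  by apply: cont0D; [apply: cont0Z; exact: cont0_id|apply: cont0M => //; exact: cont0_id].
move=> c e /c[d d0 hd]; exists d => // h /hd.
by rewrite fr addrAC subrr add0r mulrDl.
Qed.

Lemma is_derive_eps (u : R -> R) (x m : R) :
  (forall e : R, 0 < e -> exists2 d : R, 0 < d & forall h, `|h| < d ->
    `|u (x + h) - u x - m * h| <= e * `|h|) -> is_derive x (1 : R) u m.
Proof.
move=> H.
suff c : (fun h : R => h^-1 *: ((u \o shift x) (h *: (1 : R)) - u x)) @ 0^' --> m.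
  by split; [apply/cvg_ex; exists m|exact/cvg_lim].
apply/cvgrPdist_le => e e0; have [d d0 hd] := H e e0; near=> h.
have h0 : h != 0 by near: h; exact: nbhs_dnbhs_neq.
have hl : `|h| < d by near: h; exact: dnbhs0_lt.
have := hd h hl; rewrite -ler_pdivrMr ?normr_gt0// -normf_div.
have -> // : (u (x + h) - u x - m * h) / h = - (m - h^-1 *: ((u \o shift x) (h *: (1 : R)) - u x)).
  by rewrite /= /GRing.scale /= mulr1 (addrC h); field.
by rewrite normrN.
Unshelve. all: by end_near. Qed.

Lemma cderiv_line f (z w l : R[i]) (x : R) : cderiv f (z + x%:C * w) l ->
  is_derive x (1 : R) (fun t : R => Re (f (z + t%:C * w))) (Re (l * w)) /\
  is_derive x (1 : R) (fun t : R => Im (f (z + t%:C * w))) (Im (l * w)).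
Proof.
move=> [r cr fr].
have H e : 0 < e -> exists2 d : R, 0 < d & forall h : R, `|h| < d ->
    cabs (f (z + (x + h)%:C * w) - f (z + x%:C * w) - (l * w) * h%:C) <= e * `|h|.
  move=> e0; have w0 : 0 < cabs w + 1 by rewrite ltr_wpDl.
  have [d d0 hd] := cr (e / (cabs w + 1)) ltac:(by rewrite divr_gt0).
  exists (d / (cabs w + 1)) => [|h hl]; first by rewrite divr_gt0.
  have -> : z + (x + h)%:C * w = (z + x%:C * w) + h%:C * w by rewrite rmorphD /=; ring.
  rewrite fr (_ : _ - _ = r (h%:C * w) * w * h%:C); last by ring.
  rewrite !cabsM cabsC ler_wpM2r//.
  have : cabs (r (h%:C * w)) <= e / (cabs w + 1).
    apply: hd; rewrite cabsM cabsC (@le_lt_trans _ _ (`|h| * (cabs w + 1)))//.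
      by rewrite ler_wpM2l// lerDl.
    by rewrite -ltr_pdivlMr.
  rewrite ler_pdivlMr//; apply: le_trans; rewrite ler_wpM2l// lerDl//.
split; apply: is_derive_eps => e /H[d d0 hd]; exists d => // h /hd; apply: le_trans.
  apply: le_trans (abs_Re _); rewrite !cReD !cReN.
  by rewrite (cReM (l * w) h%:C) [Im h%:C]/= mulr0 subr0.
apply: le_trans (abs_Im _); rewrite !cImD !cImN.
by rewrite (cImM (l * w) h%:C) [Im h%:C]/= mulr0 add0r.
Qed.

End complex_derivative.

(** * Taylor estimates and the derivative of the exponential *)

Section cexp_estimates.
Context {R : realType}.
Implicit Types (x y : R) (z w : R[i]).

Lemma MVT_abs_le (u du : R -> R) (M y : R) : (forall x : R, is_derive x (1 : R) u (du x)) ->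
  (forall c, `|c| <= `|y| -> `|du c| <= M) -> `|u y - u 0| <= M * `|y|.
Proof.
move=> hd hM.
have cu (a b : R) : {within `[a, b], continuous u}.
  by apply: derivable_within_continuous => x _; have := hd x; case.
have [y0|y0] := leP 0 y.
  have [c cin ->] := MVT_segment y0 (fun x _ => hd x) (cu 0 y).
  move: cin; rewrite in_itv/= => /andP[c0 cy].
  by rewrite subr0 normrM ler_wpM2r// hM// !ger0_norm.
have [c cin] := MVT_segment (ltW y0) (fun x _ => hd x) (cu y 0).
move: cin; rewrite in_itv/= => /andP[c0 cy] e.
rewrite distrC e sub0r normrM normrN ler_wpM2r// hM//.
by rewrite !ler0_norm ?lerN2// ltW.
Qed.

Lemma abs_sin_le y : `|sin y| <= `|y|.
Proof.
have := @MVT_abs_le sin cos 1 y _ _.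
rewrite sin0 subr0 mul1r; apply => // c _.
by rewrite ler_norml cos_geN1 cos_le1.
Qed.

Lemma abs_cosB1_le y : `|cos y - 1| <= y ^+ 2.
Proof.
have := @MVT_abs_le cos (fun x => - sin x) `|y| y _ _.
rewrite cos0 -expr2 real_normK ?num_real//; apply => // c cy.
by rewrite normrN (le_trans (abs_sin_le _)).
Qed.

Lemma abs_cosB1_le1 y : `|cos y - 1| <= `|y|.
Proof.
have := @MVT_abs_le cos (fun x => - sin x) 1 y _ _.
rewrite cos0 mul1r; apply => // c cy.
by rewrite normrN ler_norml sin_geN1 sin_le1.
Qed.

Lemma abs_sinB_le y : `|sin y - y| <= y ^+ 2.
Proof.
have := @MVT_abs_le (fun x => sin x - x) (fun x => cos x - 1) `|y| y _ _.
rewrite sin0 subrr subr0 -expr2 real_normK ?num_real//; apply => // c cy.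
by rewrite (le_trans (abs_cosB1_le1 _)).
Qed.

Lemma abs_expRB1_le x : `|expR x - 1| <= `|x| * expR `|x|.
Proof.
have [x0|x0] := leP 0 x.
  rewrite !ger0_norm ?subr_ge0 -?expR0 ?ler_expR//.
  have := expR_ge1Dx (- x); rewrite expRN => h.
  have := ler_wpM2l (expR_ge0 x) h; rewrite divff ?gt_eqF ?expR_gt0// expR0.
  by lra.
have ex : expR x <= 1 by rewrite -expR0 ler_expR ltW.
rewrite ler0_norm ?subr_le0// (ltr0_norm x0).
have h := expR_ge1Dx x.
have h2 : 1 <= expR (- x) by rewrite -expR0 ler_expR; lra.
by nra.
Qed.

Lemma abs_expRB1B_le x : `|expR x - 1 - x| <= x ^+ 2 * expR `|x|.
Proof.
have h1 := expR_ge1Dx x.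
have h2 : expR x - 1 <= x * expR x.
  have := expR_ge1Dx (- x); rewrite expRN => h.
  have := ler_wpM2l (expR_ge0 x) h; rewrite divff ?gt_eqF ?expR_gt0//.
  by lra.
rewrite ger0_norm; last by lra.
have [x0|x0] := leP 0 x; first by rewrite ger0_norm//; nra.
have h3 : 1 <= expR `|x| by rewrite -expR0 ler_expR.
by have := sqr_ge0 x; nra.
Qed.

(** The constant 3 is crude: the real part contributes 1 and the imaginary part 2, and [cabs_le]
    adds them. *)
Lemma cabs_cexpB_le z : cabs (cexp z - 1 - z) <= 3 * (cabs z ^+ 2 * expR (cabs z)).
Proof.
set E := expR (cabs z).
have xz := abs_Re z; have yz := abs_Im z.
have Ex : expR `|Re z| <= E by rewrite ler_expR.
have ExE : expR (Re z) <= E by rewrite ler_expR Re_le_cabs.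
have h1 := abs_expRB1B_le (Re z); have h2 := abs_expRB1_le (Re z).
have h3 := abs_cosB1_le (Im z); have h4 := abs_sinB_le (Im z).
have E0 := expR_ge0 (Re z).
have E1 : 0 <= E by exact: expR_ge0.
have cz := sqr_cabs z.
have hre : `|Re (cexp z - 1 - z)| <= cabs z ^+ 2 * E.
  rewrite !reimE /= (_ : _ - _ = (expR (Re z) - 1 - Re z) + expR (Re z) * (cos (Im z) - 1)); last by ring.
  rewrite (le_trans (ler_normD _ _))// cz mulrDl lerD//.
    by rewrite (le_trans h1)// ler_wpM2l// sqr_ge0.
  by rewrite normrM (ger0_norm E0) mulrC ler_pM.
have him : `|Im (cexp z - 1 - z)| <= 2 * (cabs z ^+ 2 * E).
  rewrite !reimE /= subr0 (_ : _ - _ = expR (Re z) * (sin (Im z) - Im z) + (expR (Re z) - 1) * Im z); last by ring.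
  rewrite (le_trans (ler_normD _ _))// [leRHS]mulr_natl mulr2n lerD//.
    rewrite normrM (ger0_norm E0) mulrC ler_pM// (le_trans h4)//.
    by rewrite cz lerDr sqr_ge0.
  rewrite normrM expr2 mulrAC ler_pM// (le_trans h2)// ler_pM//.
apply: (le_trans (cabs_le _)); lra.
Qed.

Lemma cderiv_cexp z : cderiv cexp z (cexp z).
Proof.
apply: cderiv_eps => e e0.
pose K := cabs (cexp z) * 3 * expR 1.
have K0 : 0 < K by rewrite !mulr_gt0 ?expR_gt0// cabs_gt0 cexp_neq0.
exists (Num.min 1 (e / K)); first by rewrite lt_min ltr01 divr_gt0.
move=> h; rewrite lt_min => /andP[h1 h2].
rewrite cexpD (_ : _ - _ = cexp z * (cexp h - 1 - h)); last by ring.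
have hE : expR (cabs h) <= expR 1 by rewrite ler_expR ltW.
have hK : cabs (cexp h - 1 - h) <= 3 * expR 1 * cabs h * cabs h.
  by have := cabs_cexpB_le h; have := ler_wpM2l (sqr_ge0 (cabs h)) hE; lra.
rewrite cabsM (le_trans (ler_wpM2l _ hK))// !mulrA -/K.
by rewrite ler_wpM2r// mulrC -ler_pdivlMr// ltW.
Qed.

Lemma cexp_entire_scale (c : R[i]) z : cderiv (fun w => cexp (c * w)) z (cexp (c * z) * c).
Proof.
by have := cderiv_comp (cderiv_cexp (c * z)) (cderivZ c (cderiv_id z)); rewrite mulr1.
Qed.

End cexp_estimates.

Section complex_limits.
Context {R : realType}.
Implicit Types (u v : nat -> R[i]) (l m : R[i]).

Lemma ccvg_unique u l m : ccvg u l -> ccvg u m -> l = m.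
Proof.
move=> /ccvgP[lr li] /ccvgP[mr mi].
by apply: complexP; [apply: (cvg_unique _ lr)|apply: (cvg_unique _ li)].
Qed.

Lemma ccvg_cst l : ccvg (fun=> l) l.
Proof. by rewrite /ccvg subrr cabs0; exact: cvg_cst. Qed.

Lemma ccvgD u v l m : ccvg u l -> ccvg v m -> ccvg (fun n => u n + v n) (l + m).
Proof.
move=> /ccvgP[lr li] /ccvgP[mr mi]; apply/ccvgP; rewrite !reimE; split.
  by under eq_fun do rewrite cReD; exact: cvgD.
by under eq_fun do rewrite cImD; exact: cvgD.
Qed.

Lemma ccvgZ (c : R[i]) u l : ccvg u l -> ccvg (fun n => c * u n) (c * l).
Proof.
move=> h; rewrite /ccvg; under eq_fun do rewrite -mulrBr cabsM.
by rewrite -(mulr0 (cabs c)); apply: cvgM => //; exact: cvg_cst.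
Qed.

Lemma ccvgB u v l m : ccvg u l -> ccvg v m -> ccvg (fun n => u n - v n) (l - m).
Proof.
move=> ul /(ccvgZ (-1)) vm; have := ccvgD ul vm; rewrite mulN1r.
by congr ccvg; apply/funext => n; rewrite mulN1r.
Qed.

Lemma ccvg_le u l (a : nat -> R) : (forall n, cabs (u n - l) <= a n) ->
  a n @[n --> \oo] --> (0 : R) -> ccvg u l.
Proof.
move=> h; apply: (squeeze_cvgr _ (cvg_cst 0)); near=> n; first by rewrite cabs_ge0 h.
Unshelve. all: by end_near. Qed.

End complex_limits.

(** * The fundamental theorem of calculus along real paths *)

Section real_paths.
Context {R : realType}.
Local Notation leb := (@lebesgue_measure R).
Implicit Types F f : R -> R[i].

Definition ccont f := continuous (fun t : R => Re (f t)) /\ continuous (fun t : R => Im (f t)).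

Definition cis_derive F (x : R) (l : R[i]) :=
  is_derive x (1 : R) (fun t => Re (F t)) (Re l) /\ is_derive x (1 : R) (fun t => Im (F t)) (Im l).

Lemma cis_derive_ccont F f : (forall x, cis_derive F x (f x)) -> ccont F.
Proof.
move=> H; split => x; apply: differentiable_continuous; apply/derivable1_diffP.
  by have [[]] := H x.
by have [_ []] := H x.
Qed.

Lemma ccont_cmeas f : ccont f -> cmeas setT f.
Proof. by move=> [c1 c2]; split; exact: continuous_measurable_fun. Qed.

Lemma FTC_cont (F f : R -> R) (a b : R) : a <= b ->
  (forall x, is_derive x (1 : R) F (f x)) -> continuous f ->
  leb.-integrable `[a, b] (EFin \o f) /\ \int[leb]_(x in `[a, b]) f x = F b - F a.
Proof.
move=> ab hF cf; split.
  apply: continuous_compact_integrable; first exact: segment_compact.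
  exact: continuous_subspaceT.
move: ab; rewrite le_eqVlt => /predU1P[<-|ab].
  by rewrite set_itv1 Rintegral_set1 subrr.
rewrite /Rintegral (@continuous_FTC2 _ f F)//.
- exact: continuous_subspaceT.
- have cF : continuous F.
    by move=> x; apply: differentiable_continuous; apply/derivable1_diffP; have [] := hF x.
  split.
  + by move=> x _; have [] := hF x.
  + by apply: cvg_at_right_filter; exact: cF.
  + by apply: cvg_at_left_filter; exact: cF.
- by move=> x _; rewrite derive1E; have [] := hF x.
Qed.

Lemma cFTC F f (a b : R) : a <= b -> (forall x, cis_derive F x (f x)) -> ccont f ->
  cintegrable leb `[a, b] f /\ cintegral leb `[a, b] f = F b - F a.
Proof.
move=> ab hF [c1 c2].
have [i1 e1] := FTC_cont ab (fun x => (hF x).1) c1.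
have [i2 e2] := FTC_cont ab (fun x => (hF x).2) c2.
by split => //; apply: complexP; rewrite !reimE /=.
Qed.

(** The limit of [cFTC] on the intervals [0, n + 1], by dominated convergence with |f| as the
    bound. *)
Lemma cFTCy F f (l : R[i]) : (forall x, cis_derive F x (f x)) -> ccont f ->
  cintegrable leb `[0, +oo[ f -> ccvg (fun n => F n.+1%:R) l ->
  cintegral leb `[0, +oo[ f = l - F 0.
Proof.
move=> hF cf fi Fl.
have mf := ccont_cmeas cf.
have [] := @cdominated_cvg _ _ _ leb setT measurableT
  (fun n x => (\1_`[0, n.+1%:R] x)%:C * f x) (fun x => (\1_`[0, +oo[ x)%:C * f x)
  (fun x => cabs ((\1_`[0, +oo[ x)%:C * f x)) _ _ _ _.
- by move=> n; apply: cmeasM => //; exact: cmeas_indic.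
- move=> x _; rewrite /ccvg; apply: cvg_near_cst; near=> n.
  have xn : x <= n%:R by near: n; exact: nbhs_infty_ger.
  suff -> : \1_`[0, n.+1%:R] x = \1_`[0, +oo[ x :> R by rewrite subrr cabs0.
  rewrite !indicE; congr (nat_of_bool _)%:R; rewrite !mem_setE !in_itv/= andbT.
  by apply: andb_idr => _; rewrite (le_trans xn) ?ler_nat.
- apply: integrable_cabs => //; apply: (cintegrable_indic _ _ _).1 => //.
- move=> n x _; rewrite !cabsM ler_wpM2r// !cabsC !ger0_norm// ?indicE//.
  rewrite ler_nat; case: (x \in `[0, n.+1%:R]%classic) / boolP => // xn.
  suff -> : x \in `[0, +oo[%classic by [].
  by move: xn; rewrite !mem_setE !in_itv/= => /andP[->].
move=> _ /= h1.
have e n : cintegral leb setT (fun x => (\1_`[0, n.+1%:R] x)%:C * f x) = F n.+1%:R - F 0.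
  by rewrite -cintegral_indic; apply: (cFTC _ hF cf).2.
rewrite cintegral_indic; apply: (ccvg_unique h1).
rewrite (_ : (fun n => _) = (fun n => F n.+1%:R - F 0)); last by apply/funext => n; exact: e.
by apply: ccvgB => //; exact: ccvg_cst.
Unshelve. all: by end_near. Qed.

Lemma cderiv_path (G : R[i] -> R[i]) (l z w : R[i]) (x : R) :
  cderiv G (z + x%:C * w) l -> cis_derive (fun t => G (z + t%:C * w)) x (l * w).
Proof. exact: cderiv_line. Qed.

Lemma cderiv_ccont (G G' : R[i] -> R[i]) (z w : R[i]) :
  (forall s, cderiv G s (G' s)) -> ccont (fun t : R => G (z + t%:C * w)).
Proof. by move=> H; apply: cis_derive_ccont => x; apply: cderiv_path (H _). Qed.

End real_paths.

(** * Gaussian integrals *)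

Section gaussian.
Context {R : realType}.
Local Notation leb := (@lebesgue_measure R).

(** Completing the square: half of the Gaussian decay is spent on absorbing the exponential growth,
    the other half remains. *)
Lemma gauss_tail_le (a c x : R) : 0 < a ->
  expR (c * `|x| - a * x ^+ 2) <= expR (c ^+ 2 / (2 * a)) * expR (- (a / 2 * x ^+ 2)).
Proof.
move=> a0; rewrite -expRD ler_expR.
have -> : x ^+ 2 = `|x| ^+ 2 by rewrite real_normK ?num_real.
rewrite -subr_ge0 (_ : _ - _ = a / 2 * (`|x| - c / a) ^+ 2).
  by rewrite mulr_ge0 ?sqr_ge0// divr_ge0// ltW.
by field; rewrite gt_eqF.
Qed.

Lemma integrable_gauss_exp (a c : R) : 0 < a ->
  leb.-integrable setT (EFin \o (fun x => expR (c * `|x| - a * x ^+ 2))).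
Proof.
move=> a0; have a2 : 0 < a / 2 by rewrite divr_gt0.
refine (@le_integrableR R _ _ leb setT measurableT _
  (fun x => expR (c ^+ 2 / (2 * a)) * expR (- (a / 2 * x ^+ 2))) _ _ _).
- by cmeas_tac.
- by move=> x _; rewrite ger0_norm ?expR_ge0// gauss_tail_le.
by apply: integrableRZ => //; exact: (Rintegral_gauss_scale a2).1.
Qed.

Lemma cvg_gauss_tail (a c K : R) : 0 < a ->
  K * expR (c * `|n.+1%:R| - a * n.+1%:R ^+ 2) @[n --> \oo] --> (0 : R).
Proof.
move=> a0; rewrite -(mulr0 K); apply: cvgM; first exact: cvg_cst.
pose b := expR (- (a / 2)).
have b1 : b < 1 by rewrite -expR0 ltr_expR oppr_lt0 divr_gt0.
apply: (@squeeze_cvgr _ _ _ _ (fun=> 0) (fun n => expR (c ^+ 2 / (2 * a)) * b ^+ n)).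
- near=> n; rewrite expR_ge0/= (le_trans (gauss_tail_le _ _ a0))// ler_wpM2l ?expR_ge0//.
  rewrite -expRM_natl ler_expR mulrN lerN2 mulrC ler_wpM2l ?divr_ge0 ?(ltW a0)//.
  by rewrite -natrX ler_nat (leq_trans (leqnSn _))// leq_pmulr.
- exact: cvg_cst.
- rewrite -(mulr0 (expR (c ^+ 2 / (2 * a)))); apply: cvgM; first exact: cvg_cst.
  by apply: cvg_expr; rewrite ger0_norm ?expR_ge0.
Unshelve. all: by end_near. Qed.

Variable p : R[i].
Hypothesis p_gt0 : 0 < Re p.

Let E (a z : R[i]) : R[i] := cexp (- (p * (a - z) ^+ 2)).

Let EC a z : E a z = E z a.
Proof. by rewrite /E; congr (cexp (- (p * _))); ring. Qed.

Let cderiv_E a z : cderiv (E a) z (2 * p * (a - z) * E a z).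
Proof.
have h1 : cderiv (fun w => - (p * (a - w) ^+ 2)) z (2 * p * (a - z)).
  have h0 : cderiv (fun w => a - w) z (-1).
    have := cderivD (cderiv_cst a z) (cderivZ (-1) (cderiv_id z)); rewrite add0r mulr1.
    by congr cderiv; apply/funext => w; rewrite mulN1r.
  have := cderivZ (- p) (cderivM h0 h0).
  rewrite (_ : - p * _ = 2 * p * (a - z)); last by ring.
  by congr cderiv; apply/funext => w; ring.
have := cderiv_comp (cderiv_cexp _) h1.
by rewrite mulrC.
Qed.

Let cabs_E_le (x t : R) (s : R[i]) : `|t| <= 1 ->
  cabs (E x%:C (t%:C * s)) <=
  expR (cabs (p * s ^+ 2)) * expR (2 * cabs (p * s) * `|x| - Re p * x ^+ 2).
Proof.
move=> t1; rewrite cabs_cexp -expRD ler_expR.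
rewrite (_ : - (p * _) = (2 * (t * x))%:C * (p * s) - (t ^+ 2)%:C * (p * s ^+ 2) - (x ^+ 2)%:C * p); last first.
  by rewrite !rmorphXn !rmorphM rmorph_nat; ring.
rewrite !cReD !cReN.
have h1 : Re ((2 * (t * x))%:C * (p * s)) <= 2 * cabs (p * s) * `|x|.
  rewrite (le_trans (Re_le_cabs _))// cabsM cabsC !normrM ger0_norm//.
  by rewrite -!mulrA ler_wpM2l// [leRHS]mulrC ler_piMl// mulr_ge0.
have h2 : - Re ((t ^+ 2)%:C * (p * s ^+ 2)) <= cabs (p * s ^+ 2).
  rewrite -cReN (le_trans (Re_le_cabs _))// cabsN cabsM cabsC normrX.
  by rewrite -[leRHS]mul1r ler_wpM2r// exprn_ile1.
have h3 : - Re ((x ^+ 2)%:C * p) = - (Re p * x ^+ 2).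
  by rewrite cReM /= mul0r subr0 mulrC.
by move: h1 h2 h3; lra.
Qed.

Let cmeas_E a : cmeas setT (fun x : R => E x%:C a).
Proof.
rewrite /E; apply: cmeas_cexp; apply: cmeasN; apply: cmeasM; first exact: cmeas_cst.
by apply: cmeasX; apply: cmeasB; [exact: cmeasC|exact: cmeas_cst].
Qed.

Lemma cintegrable_cgauss (s : R[i]) :
  cintegrable leb setT (fun x : R => cexp (- (p * (x%:C - s) ^+ 2))).
Proof.
refine (@le_cintegrable R _ _ leb setT measurableT _ (fun x => expR (cabs (p * s ^+ 2)) *
   expR (2 * cabs (p * s) * `|x| - Re p * x ^+ 2)) (cmeas_E s) _ _).
  by move=> x _; have := @cabs_E_le x 1 s; rewrite normr1 lexx mul1r; exact.
by apply: integrableRZ => //; exact: integrable_gauss_exp.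
Qed.

(** A contour shift done by real calculus. The difference E(x, s) - E(x, 0) is the integral over t
    in [0, 1] of the derivative of E(x, t s). Exchanging the two integrals and integrating in x
    first leaves the boundary term s E(t s, 0) at x = 0. This boundary term is the origin of the
    error function in [A_fun]. *)
Lemma cintegral_cgauss_half (s : R[i]) :
  cintegral leb `[0, +oo[ (fun x : R => cexp (- (p * (x%:C - s) ^+ 2))) =
  cintegral leb `[0, +oo[ (fun x : R => cexp (- (p * x%:C ^+ 2))) +
  s * cintegral leb `[0, 1] (fun t : R => cexp (- (p * (t%:C * s) ^+ 2))).
Proof.
have mI : measurable (`[0, +oo[%classic : set (measurableTypeR R)) by [].
have mT := @measurableT _ (measurableTypeR R).
have iE a : cintegrable leb `[0, +oo[ (fun x : R => E x%:C a).
  by apply: (@cintegrableS R _ (measurableTypeR R) leb _ setT _ _ _ _ (cintegrable_cgauss a)).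
have m01' : measurable (`[0, 1]%classic : set (measurableTypeR R)) by [].
have iE01 : cintegrable leb `[0, 1] (fun t : R => E (t%:C * s) 0).
  have -> : (fun t : R => E (t%:C * s) 0) = (fun t : R => E 0 (0 + t%:C * s)).
    by apply/funext => t; rewrite EC add0r.
  have ch := cderiv_ccont 0 s (cderiv_E 0).
  split; apply: continuous_compact_integrable; try exact: segment_compact.
    by apply: continuous_subspaceT; exact: ch.1.
  by apply: continuous_subspaceT; exact: ch.2.
(* Since E depends only on the difference of its arguments, [g] is both the t-derivative of E(x, t
   s) and the x-derivative of -s E(x, t s). *)
pose g (x t : R) := 2 * p * (x%:C - t%:C * s) * E x%:C (t%:C * s) * s.
(* [K] and [c] bound [g] uniformly in t in [0, 1]. The linear factor is at most (1 + |s|) exp |x|,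
   which explains the 1 added in [c]. *)
pose K := 2 * cabs p * cabs s * (1 + cabs s) * expR (cabs (p * s ^+ 2)).
pose c := 2 * cabs (p * s) + 1.
have gK x t : `|t| <= 1 -> cabs (g x t) <= K * expR (c * `|x| - Re p * x ^+ 2).
  move=> t1; rewrite /g !cabsM.
  have -> : cabs (2 : R[i]) = 2 by rewrite natrC cabsC ger0_norm.
  have h1 : cabs (x%:C - t%:C * s) <= (1 + cabs s) * expR `|x|.
    rewrite (le_trans (cabsD _ _))// cabsN cabsM !cabsC.
    have hx : `|x| <= expR `|x| by have := expR_ge1Dx `|x|; lra.
    have h1 : 1 <= expR `|x| by rewrite -expR0 ler_expR.
    by have := cabs_ge0 s; have := normr_ge0 t; nra.
  have h2 := cabs_E_le x s t1.
  rewrite /K (_ : c * `|x| - Re p * x ^+ 2 =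
    `|x| + (2 * cabs (p * s) * `|x| - Re p * x ^+ 2)); last by rewrite /c; ring.
  rewrite expRD; have := ler_pM (cabs_ge0 _) (cabs_ge0 _) h1 h2.
  set X := expR `|x|; set Y := expR (_ - _); set Z := expR (cabs _).
  have ps : 0 <= 2 * cabs p * cabs s by rewrite !mulr_ge0.
  by move=> /(ler_wpM2l ps); lra.
have hg x t : cis_derive (fun t : R => E x%:C (t%:C * s)) t (g x t).
  have := @cderiv_path _ (E x%:C) _ 0 s t; rewrite add0r => /(_ _ (cderiv_E _ _)).
  by congr cis_derive; apply/funext => u; rewrite add0r.
have cont_g x : ccont (g x).
  have ht t : cderiv (fun w => x%:C - w) t (-1).
    have := cderivD (cderiv_cst x%:C t) (cderivZ (-1) (cderiv_id t)); rewrite add0r mulr1.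
    by congr cderiv; apply/funext => w; rewrite mulN1r.
  have := @cderiv_ccont _ (fun w => 2 * p * (x%:C - w) * E x%:C w * s) _ 0 s.
  have hd w := cderivZ s (cderivM (cderivZ (2 * p) (ht w)) (cderiv_E x%:C w)).
  have -> : (fun w => 2 * p * (x%:C - w) * E x%:C w * s) =
     (fun w => s * (2 * p * (x%:C - w) * E x%:C w)) by apply/funext => w; ring.
  move=> /(_ _ hd); congr ccont; apply/funext => u; rewrite add0r /g; ring.
have step1 x : E x%:C s - E x%:C 0 = cintegral leb `[0, 1] (g x).
  have [_ ->] := cFTC ler01 (hg x) (cont_g x).
  by rewrite mul1r mul0r.
have int01 : leb.-integrable setT (EFin \o (\1_(`[0%R, 1%R]%classic) : R -> R)).
  exact: integrable_indic_itv.
have intK : leb.-integrable setT (EFin \o (fun x => K * expR (c * `|x| - Re p * x ^+ 2))).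
  by apply: integrableRZ => //; exact: integrable_gauss_exp.
have K0 : 0 <= K by rewrite !mulr_ge0 ?expR_ge0 ?addr_ge0.
have step2 t : t \in `[0, 1] -> cintegral leb `[0, +oo[ (g ^~ t) = s * E (t%:C * s) 0.
  move=> t01; have t1 : `|t| <= 1.
    by move: t01; rewrite in_itv/= => /andP[t0 t1]; rewrite ger0_norm.
  have hF x : cis_derive (fun x : R => - s * E (t%:C * s) x%:C) x (g x t).
    have := @cderiv_path _ (fun w => - s * E (t%:C * s) w) _ 0 1 x.
    rewrite add0r mulr1 => /(_ _ (cderivZ (- s) (cderiv_E _ _))).
    rewrite mulr1 (_ : - s * _ = g x t).
      by congr cis_derive; apply/funext => u; rewrite add0r mulr1.
    by rewrite /g EC; ring.
  have cg : ccont (g ^~ t).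
    have ht z : cderiv (fun w => t%:C * s - w) z (-1).
      have := cderivD (cderiv_cst (t%:C * s) z) (cderivZ (-1) (cderiv_id z)); rewrite add0r mulr1.
      by congr cderiv; apply/funext => w; rewrite mulN1r.
    have := @cderiv_ccont _ (fun w => - s * (2 * p * (t%:C * s - w) * E (t%:C * s) w)) _ 0 1.
    have hd w := cderivZ (- s) (cderivM (cderivZ (2 * p) (ht w)) (cderiv_E (t%:C * s) w)).
    move=> /(_ _ hd); congr ccont; apply/funext => u.
    by rewrite add0r mulr1 /g (EC u%:C); ring.
  rewrite (@cFTCy _ _ _ 0 hF cg).
  - by rewrite sub0r mulNr opprK.
  - refine (@le_cintegrable R _ _ leb _ mI _
        (fun x => K * expR (c * `|x| - Re p * x ^+ 2)) _ _ _).
    + by apply: cmeasT; exact: ccont_cmeas.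
    + by move=> x _; exact: gK.
    + exact: (@integrableS _ (measurableTypeR R) R leb setT _ _ mT mI (@subsetT _ _) intK).
  - apply: (@ccvg_le _ _ _ (fun n => (cabs s * expR (cabs (p * s ^+ 2))) *
      expR (2 * cabs (p * s) * `|n.+1%:R| - Re p * n.+1%:R ^+ 2))).
      move=> n; rewrite subr0; cbv beta; rewrite [leLHS]cabsM cabsN -mulrA ler_wpM2l// EC.
      exact: cabs_E_le.
    exact: cvg_gauss_tail.
have := @cfubini_bound R _ _ _ _ leb leb
  (fun xt => (\1_`[0, +oo[ xt.1)%:C * ((\1_`[0, 1] xt.2)%:C * g xt.1 xt.2))
  (fun x => K * expR (c * `|x| - Re p * x ^+ 2)) (\1_`[0, 1]) _ _ _ intK int01 _.
case.
- have m1 : cmeas setT (fun xt : measurableTypeR R * measurableTypeR R => xt.1%:C).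
    by apply: cmeasC; exact: measurable_fst.
  have m2 : cmeas setT (fun xt : measurableTypeR R * measurableTypeR R => xt.2%:C).
    by apply: cmeasC; exact: measurable_snd.
  apply: cmeasM.
    by refine (@cmeas_comp R _ _ _ (measurableTypeR R) fst (fun x => (\1_`[0, +oo[ x)%:C) _ _); [exact: measurable_fst|exact: cmeas_indic].
  apply: cmeasM.
    by refine (@cmeas_comp R _ _ _ (measurableTypeR R) snd (fun x => (\1_`[0, 1] x)%:C) _ _); [exact: measurable_snd|exact: cmeas_indic].
  by rewrite /g /E; cmeas_tac.
- by move=> x; rewrite mulr_ge0// expR_ge0.
- by move=> x; rewrite indicE ler0n.
- move=> x t; cbn [fst snd]; move: (g x t) (gK x t) => G gb.
  rewrite !cabsM !cabsC !(ger0_norm (ler0n _ _)) !indicE.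
  rewrite [leRHS]mulrC mulrCA; case: (boolP (t \in _)) => [|_]; last by rewrite !mul0r.
  rewrite inE/= in_itv/= => /andP[t0 t1]; rewrite !mul1r (@le_trans _ _ (cabs G))//.
    by case: (x \in _); rewrite ?mul1r ?mul0r.
  by apply: gb; rewrite ger0_norm.
move=> _ iF2 iF1 _ /= FE.
have half x : cintegral leb setT (fun t => (\1_`[0, +oo[ x)%:C * ((\1_`[0, 1] t)%:C * g x t)) =
    (\1_`[0, +oo[ x)%:C * (E x%:C s - E x%:C 0).
  have ig := (cFTC ler01 (hg x) (cont_g x)).1.
  have m01 : measurable (`[0, 1]%classic : set (measurableTypeR R)) by [].
  have iig := (cintegrable_indic leb (g x) m01).1 ig.
  rewrite (step1 x).
  rewrite (cintegral_indic leb `[0, 1] (g x)).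
  exact: (cintegralZ measurableT _ iig).
have e0 : (fun x : R => cexp (- (p * x%:C ^+ 2))) = (fun x : R => E x%:C 0).
  by apply/funext => x; rewrite /E subr0.
have iE0 : cintegrable leb `[0, 1] (fun t : R => E (t%:C * s) 0) by exact: iE01.
have m01 : measurable (`[0, 1]%classic : set (measurableTypeR R)) by exact: m01'.
have L : cintegral leb `[0, +oo[ (fun x : R => E x%:C s) -
    cintegral leb `[0, +oo[ (fun x : R => E x%:C 0) =
    s * cintegral leb `[0, 1] (fun t : R => E (t%:C * s) 0).
  rewrite -(cintegralB mI (iE s) (iE 0)) (cintegral_indic leb `[0, +oo[ _).
  etransitivity; first by apply: eq_cintegral => x _; exact/esym/half.
  etransitivity; first exact: FE.
  rewrite -(cintegralZ m01 s iE0) [in RHS](cintegral_indic leb `[0, 1] _).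
  apply: eq_cintegral => t _.
  transitivity (cintegral leb setT (fun x => (\1_`[0, 1] t)%:C * ((\1_`[0, +oo[ x)%:C * g x t))).
    by apply: eq_cintegral => x _; rewrite mulrCA.
  have [t01|t01] := boolP (t \in `[0, 1]); last first.
    have -> : \1_`[0, 1] t = 0 :> R by rewrite indicE mem_setE (negbTE t01).
    rewrite mul0r -[RHS](cintegral0 leb setT).
    by apply: eq_cintegral => x _; rewrite mul0r.
  have -> : \1_`[0, 1] t = 1 :> R by rewrite indicE mem_setE t01.
  rewrite mul1r -(step2 t t01) (cintegral_indic leb `[0, +oo[ (g ^~ t)).
  by apply: eq_cintegral => x _; rewrite mul1r.
rewrite e0 -[LHS](subrK (cintegral leb `[0, +oo[ (fun x : R => E x%:C 0))).
rewrite [X in X + _]L addrC; congr (_ + s * _).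
by apply: eq_cintegral => t _; rewrite /E subr0.
Qed.

End gaussian.

Section heaviside_function.
Context {R : realType}.
Local Notation T2 := (measurableTypeR R).

Lemma cmeas_heaviside : cmeas setT (heaviside : T2 -> R[i]).
Proof.
have -> : (heaviside : T2 -> R[i]) = (fun x => (\1_`[0, +oo[ x)%:C).
  by apply/funext => x; rewrite /heaviside indicE mem_setE in_itv/= andbT; case: ifP.
by apply: cmeas_indic; exact: measurable_itv.
Qed.

Lemma cmeas_heavisideN : cmeas setT ((fun x => heaviside (- x)) : T2 -> R[i]).
Proof. exact: (@cmeas_comp R _ _ T2 T2 (fun x => - x) heaviside (@mpres_opp R).1 cmeas_heaviside). Qed.

Lemma cabs_heaviside (x : R) : cabs (heaviside x : R[i]) <= 1.
Proof. by rewrite /heaviside; case: ifP => _; rewrite ?cabs1 ?cabs0. Qed.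

End heaviside_function.

Section gaussian_line.
Context {R : realType}.
Local Notation leb := (@lebesgue_measure R).

Let mI : measurable (`[0, +oo[%classic : set (measurableTypeR R)).
Proof. by []. Qed.

Let mJ : measurable (`]0, +oo[%classic : set (measurableTypeR R)).
Proof. by []. Qed.

Lemma cintegral_itv_oy (f : R -> R[i]) : cintegrable leb setT f ->
  cintegral leb `[0, +oo[ f = cintegral leb `]0, +oo[ f.
Proof.
move=> fi; have [h1 h2] := cintegrableS mJ measurableT (@subsetT _ _) fi.
by apply: complexP; apply/esym; apply: Rintegral_itv_obnd_cbnd.
Qed.

Lemma cintegral_split (f : R -> R[i]) : cintegrable leb setT f ->
  cintegral leb setT f =
  cintegral leb `[0, +oo[ f + cintegral leb `[0, +oo[ (fun x => f (- x)).
Proof.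
move=> fi.
have fpi : cintegrable leb setT (fun x => (\1_`[0, +oo[ x)%:C * f x).
  exact: (cintegrable_indic _ _ mI).1 (cintegrableS mI measurableT (@subsetT _ _) fi).
have fNi : cintegrable leb setT (fun x => f (- x)).
  exact: (mpres_cintegrable mpres_opp fi).
rewrite [X in _ + X](cintegral_itv_oy fNi).
have e : cintegral leb setT (fun x => f x - (\1_`[0, +oo[ x)%:C * f x) =
    cintegral leb `]0, +oo[ (fun x => f (- x)).
  have mh : cmeas setT (fun x => f x - (\1_`[0, +oo[ x)%:C * f x).
    exact: (cintegrable_cmeas (cintegrableB measurableT fi fpi)).
  rewrite -(mpres_cintegral mpres_opp mh) [RHS]cintegral_indic; apply: eq_cintegral => x _.
  rewrite !indicE !mem_setE !in_itv/= !andbT oppr_ge0 ltNge.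
  by case: (x <= 0); rewrite /= ?mul0r ?mul1r ?subr0 ?subrr.
by rewrite -e (cintegral_indic leb `[0, +oo[ f) (cintegralB measurableT fi fpi); ring.
Qed.

Variable p : R[i].
Hypothesis p_gt0 : 0 < Re p.

Let H0 := cintegral leb `[0, +oo[ (fun x : R => cexp (- (p * x%:C ^+ 2))).

Let I01 (s : R[i]) := cintegral leb `[0, 1] (fun t : R => cexp (- (p * (t%:C * s) ^+ 2))).

Let cgauss_half (s : R[i]) :
  cintegral leb `[0, +oo[ (fun x : R => cexp (- (p * (x%:C - s) ^+ 2))) = H0 + s * I01 s.
Proof. exact: cintegral_cgauss_half. Qed.

Let cgauss_half_opp (s : R[i]) :
  cintegral leb `[0, +oo[ (fun x : R => cexp (- (p * ((- x)%:C - s) ^+ 2))) =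
  H0 - s * I01 s.
Proof.
transitivity (cintegral leb `[0, +oo[ (fun x : R => cexp (- (p * (x%:C - - s) ^+ 2)))).
  by apply: eq_cintegral => x _; congr (cexp (- (p * _))); rewrite rmorphN; ring.
rewrite cgauss_half mulNr; congr (_ - _ * _).
by apply: eq_cintegral => t _; congr (cexp (- (p * _))); ring.
Qed.

(** The boundary term s I(s) is odd in s, so the contributions of the two half-lines cancel. *)
Lemma cintegral_cgauss_shift (s : R[i]) :
  cintegral leb setT (fun x : R => cexp (- (p * (x%:C - s) ^+ 2))) =
  cintegral leb setT (fun x : R => cexp (- (p * x%:C ^+ 2))).
Proof.
have e t : cintegral leb setT (fun x : R => cexp (- (p * (x%:C - t) ^+ 2))) = H0 + H0.
  rewrite cintegral_split; last exact: cintegrable_cgauss.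
  by rewrite (cgauss_half_opp t) (cgauss_half t); ring.
rewrite (e s) -(e 0); apply: eq_cintegral => x _.
by rewrite subr0.
Qed.

(** The boundary terms of the two half-lines have opposite signs. With weights a and b they no
    longer cancel, and the multiple a - b of the error integral survives. *)
Lemma cintegral_cgauss_heaviside (a b s : R[i]) :
  cintegral leb setT (fun x : R => (a * heaviside x + b * heaviside (- x)) *
    cexp (- (p * (x%:C - s) ^+ 2))) =
  (a + b) / 2 * cintegral leb setT (fun x : R => cexp (- (p * x%:C ^+ 2))) +
  (a - b) * (s * cintegral leb `[0, 1] (fun t : R => cexp (- (p * (t%:C * s) ^+ 2)))).
Proof.
have gi := cintegrable_cgauss p_gt0 s.
have mheav := @cmeas_heaviside R; have mheavN := @cmeas_heavisideN R; have hb := @cabs_heaviside R.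
have mw : cmeas setT (fun x : measurableTypeR R => a * heaviside x + b * heaviside (- x)).
  by apply: cmeasD; apply: cmeasM; first [exact: cmeas_cst|exact: mheav|exact: mheavN].
have wb (x : R) : cabs (a * heaviside x + b * heaviside (- x)) <= cabs a + cabs b.
  by rewrite (le_trans (cabsD _ _))// !cabsM lerD// ler_piMr.
have wgi : cintegrable leb setT (fun x : R => (a * heaviside x + b * heaviside (- x)) *
    cexp (- (p * (x%:C - s) ^+ 2))).
  exact: (@cintegrableMb R _ (measurableTypeR R) leb setT measurableT (cabs a + cabs b) _ _ mw
    (fun x _ => wb x) gi).
have e0 : cintegral leb setT (fun x : R => cexp (- (p * x%:C ^+ 2))) = H0 + H0.
  rewrite -(cintegral_cgauss_shift 0) cintegral_split; last exact: cintegrable_cgauss.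
  by rewrite (cgauss_half_opp 0) (cgauss_half 0); ring.
have gNi := mpres_cintegrable mpres_opp gi.
have wgNi := mpres_cintegrable mpres_opp wgi.
rewrite cintegral_split//.
(* At 0 both Heaviside values are 1, so the weight equals [a] only on the open half-line; the
   integral is moved there. *)
have -> : cintegral leb `[0, +oo[ (fun x : R => (a * heaviside x + b * heaviside (- x)) *
    cexp (- (p * (x%:C - s) ^+ 2))) =
    a * cintegral leb `[0, +oo[ (fun x : R => cexp (- (p * (x%:C - s) ^+ 2))).
  rewrite (cintegral_itv_oy wgi) (cintegral_itv_oy gi) -cintegralZ//; last first.
    exact: (cintegrableS mJ measurableT (@subsetT _ _) gi).
  apply: eq_cintegral => x; rewrite inE/= in_itv/= andbT => x0; congr (_ * _).
  by rewrite /heaviside ltW// oppr_ge0 leNgt x0 mulr1 mulr0 addr0.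
have -> : cintegral leb `[0, +oo[ (fun x : R => (a * heaviside (- x) + b * heaviside (- - x)) *
    cexp (- (p * ((- x)%:C - s) ^+ 2))) =
    b * cintegral leb `[0, +oo[ (fun x : R => cexp (- (p * ((- x)%:C - s) ^+ 2))).
  rewrite (cintegral_itv_oy wgNi) (cintegral_itv_oy gNi) -cintegralZ//; last first.
    exact: (cintegrableS mJ measurableT (@subsetT _ _) gNi).
  apply: eq_cintegral => x; rewrite inE/= in_itv/= andbT => x0; congr (_ * _).
  by rewrite /heaviside opprK (ltW x0) oppr_ge0 leNgt x0 mulr1 mulr0 add0r.
by rewrite e0 (cgauss_half_opp s) (cgauss_half s) -/(I01 s); field.
Qed.

(** Completing the square turns the linear term into a shift by the complex point q / p. The
    remaining Gaussian integral is left as it is, so that no branch of the square root of p is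
    chosen. *)
Lemma cintegral_cgauss_lin (q : R[i]) :
  cintegrable leb setT (fun x : R => cexp (2 * q * x%:C - p * x%:C ^+ 2)) /\
  cintegral leb setT (fun x : R => cexp (2 * q * x%:C - p * x%:C ^+ 2)) =
  cexp (q ^+ 2 / p) * cintegral leb setT (fun x : R => cexp (- (p * x%:C ^+ 2))).
Proof.
have p0 : p != 0 by apply/eqP => p0; move: p_gt0; rewrite p0 ltxx.
have e : (fun x : R => cexp (2 * q * x%:C - p * x%:C ^+ 2)) =
         (fun x : R => cexp (q ^+ 2 / p) * cexp (- (p * (x%:C - q / p) ^+ 2))).
  by apply/funext => x; rewrite -cexpD; congr cexp; field.
rewrite e; split; first exact: (cintegrableZ measurableT _ (cintegrable_cgauss p_gt0 (q / p))).
by rewrite (cintegralZ measurableT _ (cintegrable_cgauss p_gt0 (q / p))) (cintegral_cgauss_shift (q / p)).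
Qed.

End gaussian_line.

Section real_gaussian.
Context {R : realType}.
Local Notation leb := (@lebesgue_measure R).

Lemma cintegral_rgauss (c : R) : 0 < c ->
  cintegral leb setT (fun x : R => cexp (- (c%:C * x%:C ^+ 2))) = (Num.sqrt (pi / c))%:C.
Proof.
move=> c0; transitivity (cintegral leb setT (fun x => (expR (- (c * x ^+ 2)))%:C)).
  by apply: eq_cintegral => x _; rewrite -cexpC rmorphN rmorphM rmorphXn.
by rewrite cintegralC (Rintegral_gauss_scale c0).2.
Qed.

Lemma cintegral_rgauss_lin (c : R) (q : R[i]) : 0 < c ->
  cintegrable leb setT (fun x : R => cexp (2 * q * x%:C - c%:C * x%:C ^+ 2)) /\
  cintegral leb setT (fun x : R => cexp (2 * q * x%:C - c%:C * x%:C ^+ 2)) =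
  cexp (q ^+ 2 / c%:C) * (Num.sqrt (pi / c))%:C.
Proof.
move=> c0; rewrite -(cintegral_rgauss c0).
have h : 0 < Re c%:C by [].
exact: (cintegral_cgauss_lin h q).
Qed.

End real_gaussian.

(** * The Bargmann transform *)

Section square_norm.
Context {R : realType}.
Local Notation leb := (@lebesgue_measure R).
Implicit Types (f g h : R -> R[i]) (u : nat -> \bar R).

Lemma ecvg0P u : (forall n, 0 <= u n)%E ->
  u n @[n --> \oo] --> 0%E <->
  (forall e : R, 0 < e -> \forall n \near \oo, (u n <= e%:E)%E).
Proof.
move=> u0; split=> [/fine_cvgP[ufin /cvgrPdist_le uc] e e0|H].
  near=> n.
  have un : u n \is a fin_num by near: n.
  have : `|0 - (fine \o u) n| <= e by near: n; exact: uc.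
  rewrite sub0r normrN /= ger0_norm ?fine_ge0// => une.
  by rewrite -(fineK un) lee_fin.
apply/fine_cvgP; split.
  near=> n; rewrite ge0_fin_numE// (@le_lt_trans _ _ 1%:E) ?ltry//.
  by near: n; exact: H.
apply/cvgrPdist_le => e e0; near=> n.
have h : (u n <= e%:E)%E by near: n; exact: H.
have un : u n \is a fin_num by rewrite ge0_fin_numE// (le_lt_trans h) ?ltry.
by rewrite sub0r normrN /= ger0_norm ?fine_ge0// -lee_fin fineK.
Unshelve. all: by end_near. Qed.

(** The square of the norm is what the Gaussian computations produce, and as an extended real it
    keeps its meaning outside L^2. *)
Definition sqn h : \bar R := (\int[leb]_x (cabs (h x) ^+ 2)%:E)%E.

Lemma sqn_ge0 h : (0 <= sqn h)%E.
Proof. by apply: integral_ge0 => x _; rewrite lee_fin sqr_ge0. Qed.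

Lemma L2normE h : L2norm h = sqrte (sqn h).
Proof.
rewrite /L2norm unlock -poweR12_sqrt ?sqn_ge0//; congr poweR.
apply: eq_integral => x _ /=; rewrite ger0_norm ?cabs_ge0//.
by rewrite (@powR_mulrn _ _ 2) ?cabs_ge0.
Qed.

Lemma L2P h : L2 h <-> cmeas setT h /\ (sqn h < +oo)%E.
Proof.
rewrite /L2 L2normE; split => -[mh hh]; split => //; move: hh; have := sqn_ge0 h;
  by case: (sqn h) => //= r _ _; rewrite ltry.
Qed.

Lemma L2norm_cvg0 (h : nat -> R -> R[i]) :
  L2norm (h n) @[n --> \oo] --> 0%E <-> sqn (h n) @[n --> \oo] --> 0%E.
Proof.
have sq n (e : R) : 0 < e -> (sqrte (sqn (h n)) <= e%:E)%E = (sqn (h n) <= (e ^+ 2)%:E)%E.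
  move=> e0; have := sqn_ge0 (h n); case: (sqn (h n)) => //= r; rewrite !lee_fin => r0.
  by rewrite -{1}(ger0_norm (ltW e0)) -sqrtr_sqr ler_sqrt// sqr_ge0.
split.
  move=> /(ecvg0P (fun n => Lnorm_ge0 _ _ _)) H; apply/ecvg0P => [n|e e0]; first exact: sqn_ge0.
  have se : 0 < Num.sqrt e by rewrite sqrtr_gt0.
  near=> n; have : (L2norm (h n) <= (Num.sqrt e)%:E)%E by near: n; exact: H.
  by rewrite L2normE sq// sqr_sqrtr// ltW.
move=> /(ecvg0P (fun n => sqn_ge0 _)) H; apply/ecvg0P => [n|e e0]; first exact: Lnorm_ge0.
near=> n; rewrite L2normE sq//; near: n; apply: H; exact: exprn_gt0.
Unshelve. all: by end_near. Qed.

Lemma sqn_integrable h : L2 h -> leb.-integrable setT (EFin \o (fun x => cabs (h x) ^+ 2)).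
Proof.
move=> /L2P[mh hfin]; apply/integrableP; split; first exact/measurable_EFinP/measurable_sqr_cabs.
by under eq_integral do rewrite /= ger0_norm ?sqr_ge0//.
Qed.

Lemma sqnE h : L2 h -> sqn h = (\int[leb]_x cabs (h x) ^+ 2)%:E.
Proof. by move=> /sqn_integrable ih; rewrite fineK//; exact: integrable_fin_num. Qed.

Lemma sqnZ (c : R[i]) h : cmeas setT h -> sqn (fun x => c * h x) = ((cabs c ^+ 2)%:E * sqn h)%E.
Proof.
move=> mh; rewrite /sqn -ge0_integralZl//; last 3 first.
- exact/measurable_EFinP/measurable_sqr_cabs.
- by move=> x _; rewrite lee_fin sqr_ge0.
- by rewrite lee_fin sqr_ge0.
by apply: eq_integral => x _; rewrite cabsM exprMn EFinM.
Qed.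

Lemma sqnD_le h g : cmeas setT h -> cmeas setT g ->
  (sqn (fun x => (h x + g x)%R) <= 2%:E * (sqn h + sqn g))%E.
Proof.
move=> mh mg; rewrite /sqn -ge0_integralD//; last 4 first.
- by move=> x _; rewrite lee_fin sqr_ge0.
- exact/measurable_EFinP/measurable_sqr_cabs.
- by move=> x _; rewrite lee_fin sqr_ge0.
- exact/measurable_EFinP/measurable_sqr_cabs.
rewrite -ge0_integralZl//; last 2 first.
- by apply: emeasurable_funD; exact/measurable_EFinP/measurable_sqr_cabs.
- by move=> x _; rewrite adde_ge0// lee_fin sqr_ge0.
apply: ge0_le_integral => //.
- by move=> x _; rewrite lee_fin sqr_ge0.
- by apply/measurable_EFinP/measurable_sqr_cabs; exact: cmeasD.
- by apply: emeasurable_funM => //; apply: emeasurable_funD; exact/measurable_EFinP/measurable_sqr_cabs.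
by move=> x _; rewrite -EFinD -EFinM lee_fin cabsD_sqr_le.
Qed.

Lemma L2D h g : L2 h -> L2 g -> L2 (fun x => h x + g x).
Proof.
move=> /L2P[mh hh] /L2P[mg hg]; apply/L2P; split; first exact: cmeasD.
apply: (le_lt_trans (sqnD_le mh mg)).
by rewrite lte_mul_pinfty// lte_add_pinfty.
Qed.

Lemma L2Z c h : L2 h -> L2 (fun x => c * h x).
Proof.
move=> /L2P[mh hh]; apply/L2P; split; first by apply: cmeasM => //; exact: cmeas_cst.
rewrite sqnZ// lte_mul_pinfty ?lee_fin ?sqr_ge0//.
Qed.

Lemma L2B h g : L2 h -> L2 g -> L2 (fun x => h x - g x).
Proof.
move=> hh /(L2Z (-1)) hg; have := L2D hh hg.
by congr L2; apply/funext => x; rewrite mulN1r.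
Qed.

Lemma L2_bound (h g : R -> R[i]) (M : R) : cmeas setT h ->
  (forall x, cabs (h x) <= M * cabs (g x)) -> L2 g -> L2 h.
Proof.
move=> mh hM /L2P[mg hg]; apply/L2P; split => //.
have M0 x : 0 <= M * cabs (g x) by apply: le_trans (hM x); exact: cabs_ge0.
apply: (@le_lt_trans _ _ ((M ^+ 2)%:E * sqn g)%E); last first.
  by rewrite lte_mul_pinfty ?lee_fin ?sqr_ge0//.
rewrite /sqn -ge0_integralZl//; last 3 first.
- exact/measurable_EFinP/measurable_sqr_cabs.
- by move=> x _; rewrite lee_fin sqr_ge0.
- by rewrite lee_fin sqr_ge0.
apply: ge0_le_integral => //.
- by move=> x _; rewrite lee_fin sqr_ge0.
- exact/measurable_EFinP/measurable_sqr_cabs.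
- by apply: emeasurable_funM => //; exact/measurable_EFinP/measurable_sqr_cabs.
move=> x _; rewrite -EFinM lee_fin -exprMn.
by rewrite ler_pXn2r ?nnegrE ?cabs_ge0.
Qed.

(* The isometry of B extends to functions square integrable with respect to a Gaussian weight,
   which allows to apply it to bounded functions. *)
Definition wL2 h := cmeas setT h /\
  leb.-integrable setT (EFin \o (fun x => cabs (h x) ^+ 2 * expR (- x ^+ 2))).

Let mgauss : measurable_fun setT (fun x : R => expR (- x ^+ 2)).
Proof. by cmeas_tac. Qed.

Lemma L2_wL2 h : L2 h -> wL2 h.
Proof.
move=> hL; have [mh _] := (L2P h).1 hL; split => //.
refine (@le_integrableR R _ (measurableTypeR R) leb setT measurableT _
  (fun x => cabs (h x) ^+ 2) _ _ _).
- by apply: measurable_funM => //; exact: measurable_sqr_cabs.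
- move=> x _; rewrite ger0_norm ?mulr_ge0 ?sqr_ge0 ?expR_ge0// ler_piMr ?sqr_ge0//.
  by rewrite -expR0 ler_expR oppr_le0 sqr_ge0.
- exact: sqn_integrable.
Qed.

Lemma bounded_wL2 h (M : R) : cmeas setT h -> (forall x, cabs (h x) <= M) -> wL2 h.
Proof.
move=> mh hM; split => //.
refine (@le_integrableR R _ (measurableTypeR R) leb setT measurableT _
  (fun x => M ^+ 2 * expR (- x ^+ 2)) _ _ _).
- by apply: measurable_funM => //; exact: measurable_sqr_cabs.
- move=> x _; rewrite ger0_norm ?mulr_ge0 ?sqr_ge0 ?expR_ge0// ler_wpM2r ?expR_ge0//.
  by rewrite ler_pXn2r ?nnegrE ?cabs_ge0// (le_trans _ (hM x)).
- by apply: integrableRZ => //; exact: integrable_gauss.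
Qed.

Lemma wL2Z c h : wL2 h -> wL2 (fun x => c * h x).
Proof.
move=> [mh hi]; split; first by apply: cmeasM => //; exact: cmeas_cst.
have := integrableRZ measurableT (cabs c ^+ 2) hi; apply: eq_integrable => // x _ /=.
by rewrite cabsM exprMn mulrA.
Qed.

Lemma wL2D h g : wL2 h -> wL2 g -> wL2 (fun x => h x + g x).
Proof.
move=> [mh hi] [mg gi]; split; first exact: cmeasD.
refine (@le_integrableR R _ (measurableTypeR R) leb setT measurableT _
  (fun x => 2 * (cabs (h x) ^+ 2 * expR (- x ^+ 2) + cabs (g x) ^+ 2 * expR (- x ^+ 2))) _ _ _).
- apply: measurable_funM => //; apply: measurable_sqr_cabs; exact: cmeasD.
- move=> x _; rewrite ger0_norm ?mulr_ge0 ?sqr_ge0 ?expR_ge0//.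
  by rewrite -mulrDl mulrA ler_wpM2r ?expR_ge0// cabsD_sqr_le.
- by apply: integrableRZ => //; exact: integrableRD.
Qed.

Lemma wL2B h g : wL2 h -> wL2 g -> wL2 (fun x => h x - g x).
Proof.
move=> hh /(wL2Z (-1)) hg; have := wL2D hh hg.
by congr wL2; apply/funext => x; rewrite mulN1r.
Qed.

(** The Gaussian is split evenly and 2ab <= a^2 + b^2 is applied. Since the kernel of the Bargmann
    transform grows no faster than such an exponential, [bargmann] converges absolutely on [wL2]. *)
Lemma wL2_exp h (K : R) : wL2 h ->
  leb.-integrable setT (EFin \o (fun x => cabs (h x) * expR (K * `|x| - x ^+ 2))).
Proof.
move=> [mh hi].
refine (@le_integrableR R _ (measurableTypeR R) leb setT measurableT _
  (fun x => 2^-1 * (cabs (h x) ^+ 2 * expR (- x ^+ 2) + expR (2 * K * `|x| - 1 * x ^+ 2))) _ _ _).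
- apply: measurable_funM; first exact: measurable_cabs.
  by cmeas_tac.
- move=> x _; rewrite ger0_norm ?mulr_ge0 ?expR_ge0// mul1r.
  set a := cabs (h x).
  have -> : expR (- x ^+ 2) = expR (- x ^+ 2 / 2) ^+ 2.
    by rewrite -expRM_natl; congr expR; field.
  have -> : expR (2 * K * `|x| - x ^+ 2) = expR (K * `|x| - x ^+ 2 / 2) ^+ 2.
    by rewrite -expRM_natl; congr expR; field.
  have -> : expR (K * `|x| - x ^+ 2) = expR (- x ^+ 2 / 2) * expR (K * `|x| - x ^+ 2 / 2).
    by rewrite -expRD; congr expR; field.
  set b := expR (- _ / _); set c := expR _.
  by have := sqr_ge0 (a * b - c); lra.
- apply: integrableRZ => //; apply: integrableRD => //; exact: integrable_gauss_exp.
Qed.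

End square_norm.

(** * Holomorphy and linearity of the Bargmann transform *)

Section bargmann_entire.
Context {R : realType}.
Local Notation leb := (@lebesgue_measure R).
Implicit Types (h g : R -> R[i]) (z w : R[i]).

Definition bker z (x : R) : R[i] := cexp (2 * x%:C * z - x%:C ^+ 2 - z ^+ 2 / 2).

Definition bcst : R := powR (2 / pi) (1 / 4).

Lemma bcst_gt0 : 0 < bcst.
Proof. by rewrite powR_gt0// divr_gt0// pi_gt0. Qed.

Lemma bargmannE h z : bargmann h z = bcst%:C * cintegral leb setT (fun x => h x * bker z x).
Proof. by []. Qed.

Let kerE z (x : R) := cexp (2 * x%:C * z - x%:C ^+ 2).

Let bkerE z x : bker z x = cexp (- (z ^+ 2 / 2)) * kerE z x.
Proof. by rewrite -cexpD; congr cexp; ring. Qed.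

Let cabs_kerE_le z x : cabs (kerE z x) <= expR (2 * cabs z * `|x| - x ^+ 2).
Proof.
rewrite cabs_cexp ler_expR.
have -> : 2 * x%:C * z - x%:C ^+ 2 = (2 * x)%:C * z - (x ^+ 2)%:C.
  by rewrite rmorphXn rmorphM rmorph_nat.
rewrite !reimE /= mul0r subr0 lerB// -mulrA -mulrA ler_wpM2l//.
by rewrite (le_trans (ler_norm _))// normrM mulrC ler_wpM2r// abs_Re.
Qed.

Lemma cmeas_bker z : cmeas setT (bker z).
Proof. by rewrite /bker; cmeas_tac. Qed.

Lemma cabs_bker_le z x : cabs (bker z x) <=
  expR (cabs z ^+ 2 / 2) * expR (2 * cabs z * `|x| - x ^+ 2).
Proof.
rewrite bkerE cabsM; apply: ler_pM; [exact: cabs_ge0|exact: cabs_ge0| |exact: cabs_kerE_le].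
rewrite cabs_cexp ler_expR (le_trans (Re_le_cabs _))// cabsN cabsM cabsX cabsV.
by rewrite natrC cabsC ger0_norm.
Qed.

Let cmeas_kerE z : cmeas setT (kerE z).
Proof. by rewrite /kerE; cmeas_tac. Qed.

Let integrable_kerE h z : wL2 h -> cintegrable leb setT (fun x => h x * kerE z x).
Proof.
move=> hw; refine (@le_cintegrable R _ (measurableTypeR R) leb setT measurableT _
  (fun x => cabs (h x) * expR (2 * cabs z * `|x| - x ^+ 2)) _ _ _).
- apply: cmeasM; [exact: hw.1|exact: cmeas_kerE].
- by move=> x _; rewrite cabsM ler_wpM2l// cabs_kerE_le.
- exact: wL2_exp.
Qed.

Lemma integrable_bker h z : wL2 h -> cintegrable leb setT (fun x => h x * bker z x).
Proof.
move=> hw; have := cintegrableZ measurableT (cexp (- (z ^+ 2 / 2))) (integrable_kerE z hw).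
by apply: (eq_cintegrable measurableT) => x _; rewrite bkerE mulrCA.
Qed.

Let Phi h z := cintegral leb setT (fun x => h x * kerE z x).

Let bargmann_Phi h z : wL2 h -> bargmann h z = bcst%:C * (cexp (- (z ^+ 2 / 2)) * Phi h z).
Proof.
move=> hw; rewrite bargmannE; congr (_ * _).
rewrite -(cintegralZ measurableT _ (integrable_kerE z hw)).
by apply: eq_cintegral => x _; rewrite bkerE mulrCA.
Qed.

(** This is [cabs_cexpB_le] at 2xw: 12 is 3 times 2^2, and of the additional 4|x| in the exponent
    one half pays for the factor x^2, the other for exp |2xw|. *)
Let kerE_taylor z w x : cabs w <= 1 ->
  cabs (kerE (z + w) x - kerE z x - w * (2 * x%:C * kerE z x)) <=
  12 * cabs w ^+ 2 * expR ((2 * cabs z + 4) * `|x| - x ^+ 2).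
Proof.
move=> w1.
have -> : kerE (z + w) x - kerE z x - w * (2 * x%:C * kerE z x) =
    kerE z x * (cexp (2 * x%:C * w) - 1 - 2 * x%:C * w).
  rewrite /kerE (_ : 2 * x%:C * (z + w) - x%:C ^+ 2 = (2 * x%:C * z - x%:C ^+ 2) + 2 * x%:C * w); last by ring.
  by rewrite cexpD; ring.
rewrite cabsM.
have -> : (2 * cabs z + 4) * `|x| - x ^+ 2 = (2 * cabs z * `|x| - x ^+ 2) + (`|x| + `|x|) + 2 * `|x|.
  by ring.
rewrite (expRD _ (2 * `|x|)) (expRD _ (`|x| + `|x|)) (expRD `|x| `|x|).
have h1 := cabs_kerE_le z x; have h2 := cabs_cexpB_le (2 * x%:C * w).
have e2 : cabs (2 * x%:C * w) = 2 * `|x| * cabs w.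
  by rewrite !cabsM cabsC natrC cabsC ger0_norm.
rewrite e2 in h2.
have hx : `|x| <= expR `|x| by have := expR_ge1Dx `|x|; lra.
have hw : expR (2 * `|x| * cabs w) <= expR (2 * `|x|).
  by rewrite ler_expR ler_piMr// mulr_ge0.
have E0 := expR_ge0 (2 * `|x|).
have hxx : `|x| ^+ 2 <= expR `|x| * expR `|x| by rewrite expr2 ler_pM.
set A := expR (2 * cabs z * `|x| - x ^+ 2) in h1 *; set B := expR `|x| in hx hxx *.
set C := expR (2 * `|x|) in hw E0 *; set X := `|x| in h2 hw hx hxx *.
set W := cabs w in w1 h2 hw *.
rewrite (_ : 12 * W ^+ 2 * _ = A * (12 * W ^+ 2 * (B * B) * C)); last by ring.
apply: ler_pM; [exact: cabs_ge0|exact: cabs_ge0|exact: h1|].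
apply: (le_trans h2).
rewrite (_ : 3 * _ = 12 * W ^+ 2 * X ^+ 2 * expR (2 * X * W)); last by ring.
apply: ler_pM; last exact: hw.
- by apply: mulr_ge0; [apply: mulr_ge0; [by []|exact: sqr_ge0]|exact: sqr_ge0].
- exact: expR_ge0.
- by apply: ler_wpM2l => //; rewrite mulr_ge0 ?sqr_ge0.
Qed.

(** Differentiation under the integral sign: the Taylor bound, integrated against |h|, leaves an
    error of order |w|^2. *)
Let cderiv_Phi h z : wL2 h ->
  cderiv (Phi h) z (cintegral leb setT (fun x => h x * (2 * x%:C * kerE z x))).
Proof.
move=> hw.
pose v (x : R) := cabs (h x) * expR ((2 * cabs z + 4) * `|x| - x ^+ 2).
have iv : leb.-integrable setT (EFin \o v) by exact: wL2_exp.
have i1 : cintegrable leb setT (fun x => h x * (2 * x%:C * kerE z x)).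
  refine (@le_cintegrable R _ (measurableTypeR R) leb setT measurableT _
    (fun x => 2 * v x) _ _ _).
  - apply: cmeasM; first exact: hw.1.
    by apply: cmeasM; [cmeas_tac|exact: cmeas_kerE].
  - move=> x _; rewrite /v [leRHS]mulrCA cabsM; apply: ler_wpM2l; first exact: cabs_ge0.
    rewrite 2!cabsM cabsC natrC cabsC ger0_norm// -mulrA; apply: ler_wpM2l => //.
    have -> : (2 * cabs z + 4) * `|x| - x ^+ 2 = `|x| + 3 * `|x| + (2 * cabs z * `|x| - x ^+ 2).
      by ring.
    rewrite expRD; apply: ler_pM; [by []|exact: cabs_ge0| |exact: cabs_kerE_le].
    rewrite expRD; have h1 := expR_ge1Dx `|x|.
    have h2 : 1 <= expR (3 * `|x|) by rewrite -expR0 ler_expR mulr_ge0.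
    by have := normr_ge0 x; nra.
  - exact: integrableRZ.
pose M := \int[leb]_x v x.
have M0 : 0 <= M by apply: Rintegral_ge0 => x _; rewrite mulr_ge0 ?expR_ge0.
have taylor w : cabs w <= 1 -> cabs (Phi h (z + w) - Phi h z -
    cintegral leb setT (fun x => h x * (2 * x%:C * kerE z x)) * w) <= 12 * cabs w ^+ 2 * M.
  move=> w1.
  have ia := integrable_kerE (z + w) hw; have ib := integrable_kerE z hw.
  have ic := cintegrableZ measurableT w i1.
  have -> : Phi h (z + w) - Phi h z - cintegral leb setT (fun x => h x * (2 * x%:C * kerE z x)) * w =
    cintegral leb setT (fun x => h x * kerE (z + w) x - h x * kerE z x - w * (h x * (2 * x%:C * kerE z x))).
    rewrite (cintegralB measurableT (cintegrableB measurableT ia ib) ic).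
    rewrite (cintegralB measurableT ia ib) (cintegralZ measurableT w i1).
    by rewrite (mulrC _ w).
  rewrite -(RintegralZl _ measurableT iv).
  apply: cabs_cintegral_le => //.
  - exact: (cintegrable_cmeas (cintegrableB measurableT (cintegrableB measurableT ia ib) ic)).
  - move=> x _; rewrite mulrCA -!mulrBr cabsM /v [leRHS]mulrCA ler_wpM2l//.
    exact: kerE_taylor.
  - exact: integrableRZ.
apply: cderiv_eps => e e0.
have M1 : 0 < 12 * M + 1 by rewrite ltr_wpDl// mulr_ge0.
exists (Num.min 1 (e / (12 * M + 1))); first by rewrite lt_min ltr01 divr_gt0.
move=> w; rewrite lt_min => /andP[w1 w2].
apply: (le_trans (taylor w (ltW w1))).
move: w2; rewrite ltr_pdivlMr// => /ltW/(ler_wpM2l (cabs_ge0 w)).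
by have := sqr_ge0 (cabs w); lra.
Qed.

Lemma bargmann_entire h : wL2 h -> entire (bargmann h).
Proof.
move=> hw; have -> : bargmann h = (fun z => bcst%:C * (cexp (- 2^-1 * (z * z)) * Phi h z)).
  apply/funext => z; rewrite bargmann_Phi//; congr (_ * (cexp _ * _)).
  by rewrite expr2; ring.
apply/entireP => z; eexists; apply: cderivZ; apply: cderivM; last exact: cderiv_Phi.
apply: (cderiv_comp (f := cexp) (g := fun z => - 2^-1 * (z * z))); first exact: cderiv_cexp.
by apply: cderivZ; apply: cderivM; exact: cderiv_id.
Qed.

Lemma bargmannD h g z : wL2 h -> wL2 g ->
  bargmann (fun x => h x + g x) z = bargmann h z + bargmann g z.
Proof.
move=> hw gw; rewrite !bargmannE -mulrDr; congr (_ * _).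
rewrite -(cintegralD measurableT (integrable_bker z hw) (integrable_bker z gw)).
by apply: eq_cintegral => x _; rewrite mulrDl.
Qed.

Lemma bargmannZ c h z : wL2 h -> bargmann (fun x => c * h x) z = c * bargmann h z.
Proof.
move=> hw; rewrite !bargmannE mulrCA; congr (_ * _).
rewrite -(cintegralZ measurableT c (integrable_bker z hw)).
by apply: eq_cintegral => x _; rewrite mulrA.
Qed.

Lemma bargmannB h g z : wL2 h -> wL2 g ->
  bargmann (fun x => h x - g x) z = bargmann h z - bargmann g z.
Proof.
move=> hw gw; have -> : (fun x => h x - g x) = (fun x => h x + -1 * g x).
  by apply/funext => x; rewrite mulN1r.
rewrite (bargmannD _ hw (wL2Z (-1) gw)) (bargmannZ _ _ gw) mulN1r//.
Qed.

Lemma bargmann_ae h g z : cmeas setT h -> cmeas setT g ->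
  {ae leb, forall x, h x = g x} -> bargmann h z = bargmann g z.
Proof.
move=> mh mg hg; rewrite !bargmannE; congr (_ * _).
apply: ae_eq_cintegral => //.
- by apply: cmeasM => //; exact: cmeas_bker.
- by apply: cmeasM => //; exact: cmeas_bker.
- by apply: ae_imply hg => x ->.
Qed.

End bargmann_entire.

(** * Plancherel's formula *)

Section fatou_ae.
Context {R : realType} {d : measure_display} {T : measurableType d}.
Variable mu : {measure set T -> \bar R}.

Lemma fatou_ae (f_ : nat -> T -> R) (f : T -> R) (C : \bar R) :
  (forall n, measurable_fun setT (f_ n)) -> measurable_fun setT f ->
  (forall n x, 0 <= f_ n x) ->
  {ae mu, forall x, f_ n x @[n --> \oo] --> f x} ->
  (forall n, \int[mu]_x (f_ n x)%:E <= C)%E -> (\int[mu]_x (f x)%:E <= C)%E.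
Proof.
move=> mf_ mf f0 cf fC.
have mE n : measurable_fun setT (fun x => (f_ n x)%:E) by exact/measurable_EFinP.
rewrite (ae_eq_integral (fun x => limn_einf (fun n => (f_ n x)%:E))) //; last 3 first.
- exact/measurable_EFinP.
- under eq_fun do rewrite limn_einf_lim.
  apply: (emeasurable_fun_cvg (fun n x => einfs (fun m => (f_ m x)%:E) n)).
    by move=> n; exact: measurable_fun_einfs.
  by move=> x _; exact: is_cvg_einfs.
- move: cf; apply: filterS => x cx _.
  have h : (f_ n x)%:E @[n --> \oo] --> (f x)%:E.
    by apply: cvg_EFin; [exact: nearW|exact: cx].
  by have [-> _] := cvg_limn_einf_sup h.
have F0 n x : setT x -> (0 <= (f_ n x)%:E)%E by move=> _; rewrite lee_fin.
have F := @fatou _ _ _ mu setT measurableT (fun n x => (f_ n x)%:E) mE F0.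
apply: le_trans F _.
rewrite limn_einf_lim; apply: lime_le; first exact: is_cvg_einfs.
apply: nearW => n; apply: le_trans (fC n).
by apply: ereal_inf_lbound; exists n => //=.
Qed.

End fatou_ae.

(** * The Fourier transform under a Gaussian weight *)

Section fourier.
Context {R : realType}.
Local Notation leb := (@lebesgue_measure R).
Local Notation T2 := (measurableTypeR R).
Implicit Types (g h : R -> R[i]).

Definition cis (t : R) : R[i] := cexp ('i%C * t%:C).

Lemma cabs_cis t : cabs (cis t) = 1.
Proof. by rewrite cabs_cexp !reimE /= !mul0r mul1r subrr expR0. Qed.

Lemma cisD s t : cis (s + t) = cis s * cis t.
Proof. by rewrite /cis -cexpD rmorphD mulrDr. Qed.

Lemma cisJ t : (cis t)^* = cis (- t).
Proof. by rewrite /cis cexpJ rmorphN rmorphM /=; congr cexp; apply: complexP; rewrite !reimE /=; ring. Qed.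

(** The frequency 2v is the one carried by the Bargmann kernel at u + iv. With this scaling and no
    prefactor, Plancherel's formula has the constant pi. *)
Definition fou g (v : R) : R[i] := cintegral leb setT (fun x => g x * cis (2 * (v * x))).

Lemma multiplication_formula (k : T2 * T2 -> R[i]) g h :
  cmeas setT k -> (forall p, cabs (k p) <= 1) -> L1 g -> L1 h ->
  cintegral leb setT (fun v => cintegral leb setT (fun x => g x * k (x, v)) * h v) =
  cintegral leb setT (fun x => g x * cintegral leb setT (fun v => k (x, v) * h v)).
Proof.
move=> mk k1 g1 h1.
have mg := cintegrable_cmeas g1; have mh := cintegrable_cmeas h1.
have gkv v : cintegrable leb setT (fun x => k (x, v) * g x).
  exact: (@cintegrableMb R _ T2 leb setT measurableT 1 _ _ (cmeas_slice2 v mk) (fun x _ => k1 _) g1).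
have hkx x : cintegrable leb setT (fun v => k (x, v) * h v).
  exact: (@cintegrableMb R _ T2 leb setT measurableT 1 _ _ (cmeas_slice1 x mk) (fun v _ => k1 _) h1).
have := @cfubini_bound R _ _ T2 T2 leb leb (fun p => g p.1 * (k p * h p.2))
  (fun x => cabs (g x)) (fun v => cabs (h v)) _ _ _
  (integrable_cabs measurableT g1) (integrable_cabs measurableT h1) _.
case.
- apply: cmeasM; first exact: (cmeas_comp measurable_fst mg).
  by apply: cmeasM => //; exact: (cmeas_comp measurable_snd mh).
- by move=> x; exact: cabs_ge0.
- by move=> x; exact: cabs_ge0.
- move=> x v; rewrite !cabsM ler_wpM2l ?cabs_ge0//=.
  by rewrite ler_piMl ?cabs_ge0.
move=> _ _ _ _ /= E.
transitivity (cintegral leb setT (fun v => cintegral leb setT (fun x => g x * (k (x, v) * h v)))).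
  apply: eq_cintegral => v _; rewrite mulrC -(cintegralZ measurableT); last first.
    exact: (eq_cintegrable measurableT (fun x _ => mulrC _ _) (gkv v)).
  by apply: eq_cintegral => x _; ring.
rewrite -E; apply: eq_cintegral => x _.
by rewrite -(cintegralZ measurableT _ (hkx x)).
Qed.

Let mexp : cmeas setT (fun p : T2 * T2 => cis (2 * (p.2 * p.1))).
Proof. by rewrite /cis; cmeas_tac. Qed.

Lemma fou_integrable g v : L1 g -> cintegrable leb setT (fun x => g x * cis (2 * (v * x))).
Proof.
move=> g1; apply: (@eq_cintegrable R _ T2 leb setT measurableT (fun x => cis (2 * (v * x)) * g x)).
  by move=> x _; rewrite mulrC.
apply: (@cintegrableMb R _ T2 leb setT measurableT 1) => //; last by move=> x _; rewrite cabs_cis.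
by rewrite /cis; cmeas_tac.
Qed.

Lemma cabs_fou_le g v : L1 g -> cabs (fou g v) <= \int[leb]_x cabs (g x).
Proof.
move=> g1; apply: cabs_cintegral_le => //.
- exact: (cintegrable_cmeas (fou_integrable v g1)).
- by move=> x _; rewrite cabsM cabs_cis mulr1.
- exact: integrable_cabs.
Qed.

Let gaussL1 (e : R) : 0 < e -> L1 (fun v : R => (expR (- (e * v ^+ 2)))%:C).
Proof.
move=> e0; refine (@le_cintegrable R _ T2 leb setT measurableT _ _ _ _ (Rintegral_gauss_scale e0).1).
  by cmeas_tac.
by move=> x _; rewrite cabsC ger0_norm ?expR_ge0.
Qed.

(** Fubini yields measurability of an inner integral when the double integral converges. A Gaussian
    weight in v ensures this and is divided out afterwards. *)
Lemma cmeas_fou g : L1 g -> cmeas setT (fou g).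
Proof.
move=> g1; have mg := cintegrable_cmeas g1.
have e1 := gaussL1 ltr01.
have mF : cmeas setT (fun p : T2 * T2 => cis (2 * (p.1 * p.2)) * g p.2 * (expR (- (1 * p.1 ^+ 2)))%:C).
  apply: cmeasM; last by cmeas_tac.
  apply: cmeasM; first by rewrite /cis; cmeas_tac.
  exact: (cmeas_comp measurable_snd mg).
have := @cfubini_bound R _ _ T2 T2 leb leb _
  (fun v => expR (- (1 * v ^+ 2))) (fun x => cabs (g x)) mF _ _
  (Rintegral_gauss_scale ltr01).1 (integrable_cabs measurableT g1) _.
case.
- by move=> x; rewrite expR_ge0.
- by move=> x; exact: cabs_ge0.
- move=> v x /=; rewrite !cabsM cabs_cis mul1r cabsC ger0_norm ?expR_ge0// mulrC//.
move=> _ _ _ /cintegrable_cmeas mm _.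
have me : cmeas setT (fun v : T2 => (expR (v ^+ 2))%:C) by cmeas_tac.
apply: eq_cmeas (cmeasM me mm) => v /=.
rewrite /fou.
transitivity ((expR (v ^+ 2))%:C * ((expR (- (1 * v ^+ 2)))%:C * cintegral leb setT (fun x => g x * cis (2 * (v * x))))).
  congr (_ * _); rewrite -(cintegralZ measurableT _ (fou_integrable v g1)).
  by apply: eq_cintegral => x _; ring.
by rewrite mulrA -rmorphM -expRD mul1r subrr expR0 mul1r.
Qed.

Let L1_fou_gauss g e : 0 < e -> L1 g ->
  L1 (fun v => (fou g v)^* * (expR (- (e * v ^+ 2)))%:C).
Proof.
move=> e0 g1; apply: (@cintegrableMb R _ T2 leb setT measurableT (\int[leb]_x cabs (g x))).
- by apply: cmeasJ; exact: cmeas_fou.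
- by move=> v _; rewrite cabsJ; exact: cabs_fou_le.
- exact: gaussL1.
Qed.

Let L1J g : L1 g -> L1 (fun x => (g x)^*). Proof. exact: cintegrableJ. Qed.

(** The weight makes all integrals absolutely convergent. Two uses of [multiplication_formula] bring
    the integral in v innermost, where it is the Fourier transform of a Gaussian at x - y. *)
Lemma plancherel_gauss g (e : R) : 0 < e -> L1 g ->
  cintegral leb setT (fun v => (cabs (fou g v) ^+ 2 * expR (- (e * v ^+ 2)))%:C) =
  (Num.sqrt (pi / e))%:C * cintegral leb setT (fun x => g x *
     cintegral leb setT (fun y => (g y)^* * (expR (- ((x - y) ^+ 2 / e)))%:C)).
Proof.
move=> e0 g1.
transitivity (cintegral leb setT (fun v => fou g v * ((fou g v)^* * (expR (- (e * v ^+ 2)))%:C))).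
  by apply: eq_cintegral => v _; rewrite [RHS]mulrA mulJ -rmorphM.
rewrite (@multiplication_formula (fun p : T2 * T2 => cis (2 * (p.2 * p.1))))//; last 2 first.
- by move=> p; rewrite cabs_cis.
- exact: L1_fou_gauss.
have fouJ v : (fou g v)^* = cintegral leb setT (fun y => (g y)^* * cis (- (2 * (v * y)))).
  apply: (etrans (esym (cintegralJ measurableT (fou_integrable v g1)))).
  by apply: eq_cintegral => y _; rewrite rmorphM -cisJ.
have inner x : cintegral leb setT (fun v => cis (2 * (v * x)) * ((fou g v)^* * (expR (- (e * v ^+ 2)))%:C)) =
    (Num.sqrt (pi / e))%:C * cintegral leb setT (fun y => (g y)^* * (expR (- ((x - y) ^+ 2 / e)))%:C).
  have hL : L1 (fun v => cis (2 * (v * x)) * (expR (- (e * v ^+ 2)))%:C).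
    apply: (@cintegrableMb R _ T2 leb setT measurableT 1) => //; last 2 first.
    - by move=> v _; rewrite cabs_cis.
    - exact: gaussL1.
    by rewrite /cis; cmeas_tac.
  transitivity (cintegral leb setT (fun v => cintegral leb setT (fun y => (g y)^* * cis (- (2 * (v * y)))) *
      (cis (2 * (v * x)) * (expR (- (e * v ^+ 2)))%:C))).
    apply: eq_cintegral => v _; rewrite [in LHS]mulrCA; congr (_ * _).
    exact: fouJ.
  rewrite (@multiplication_formula (fun p : T2 * T2 => cis (- (2 * (p.2 * p.1)))) (fun y => (g y)^*))//; last 3 first.
  - by rewrite /cis; cmeas_tac.
  - by move=> p; rewrite cabs_cis.
  - exact: L1J.
  rewrite -(cintegralZ measurableT); last first.
    have := @cintegrableMb R _ T2 leb setT measurableT 1 _ (fun y => (expR (- ((x - y) ^+ 2 / e)))%:C) _ _ (L1J g1).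
    move=> H; apply: (@eq_cintegrable R _ T2 leb setT measurableT
      (fun y => (expR (- ((x - y) ^+ 2 / e)))%:C * (g y)^*)); first by move=> y _; rewrite mulrC.
    apply: H; first by cmeas_tac.
    move=> y _; rewrite cabsC ger0_norm ?expR_ge0// -expR0 ler_expR oppr_le0.
    by rewrite divr_ge0 ?sqr_ge0// ltW.
  apply: eq_cintegral => y _; rewrite mulrCA; congr (_ * _) => /=.
  transitivity (cintegral leb setT (fun v : R => cexp (2 * ('i%C * (x - y)%:C) * v%:C - e%:C * v%:C ^+ 2))).
    apply: eq_cintegral => v _; rewrite /cis -cexpC -!cexpD; congr cexp.
    by rewrite !castC; ring.
  rewrite (cintegral_rgauss_lin _ e0).2 mulrC; congr (_ * _).
  by rewrite -cexpC; congr cexp; rewrite !castC exprMn sqr_i; ring.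
pose H v := (fou g v)^* * (expR (- (e * v ^+ 2)))%:C.
have HL : L1 H by exact: L1_fou_gauss.
have c0 : (Num.sqrt (pi / e))%:C != 0 :> R[i].
  by rewrite -cabs_eq0 cabsC ger0_norm// sqrtr_eq0 -ltNge divr_gt0// pi_gt0.
have innerE x : cintegral leb setT (fun y => (g y)^* * (expR (- ((x - y) ^+ 2 / e)))%:C) =
    (Num.sqrt (pi / e))%:C^-1 * fou H x.
  apply: (mulfI c0); rewrite mulrA mulfV// mul1r -inner.
  by apply: eq_cintegral => v _; rewrite mulrC (mulrC v).
rewrite -(cintegralZ measurableT).
  by apply: eq_cintegral => x _; rewrite inner mulrCA.
apply: (@eq_cintegrable R _ T2 leb setT measurableT
   (fun x => ((Num.sqrt (pi / e))%:C^-1 * fou H x) * g x)).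
  by move=> x _; rewrite mulrC innerE.
apply: (@cintegrableMb R _ T2 leb setT measurableT
  (cabs (Num.sqrt (pi / e))%:C^-1 * \int[leb]_x cabs (H x))) => //.
- by apply: cmeasM; [exact: cmeas_cst|exact: cmeas_fou].
- by move=> x _; rewrite cabsM ler_wpM2l ?cabs_ge0//; exact: cabs_fou_le.
Qed.

End fourier.

Section plancherel.
Context {R : realType}.
Local Notation leb := (@lebesgue_measure R).
Local Notation T2 := (measurableTypeR R).
Implicit Types (g h k : R -> R[i]).

Definition gkern (e : R) (p : T2 * T2) : R := expR (- ((p.1 - p.2) ^+ 2 / e)).

Lemma measurable_gkern e : measurable_fun setT (gkern e).
Proof. by rewrite /gkern; cmeas_tac. Qed.

Lemma gkern_ge0 e p : 0 <= gkern e p. Proof. exact: expR_ge0. Qed.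

Local Hint Extern 0 (measurable_fun _ (gkern _)) => solve [exact: measurable_gkern] : core.
Local Hint Extern 0 (is_true (0 <= gkern _ _)) => solve [exact: gkern_ge0] : core.

Lemma integral_gkern1 e y : 0 < e -> (\int[leb]_x (gkern e (x, y))%:E = (Num.sqrt (pi * e))%:E)%E.
Proof.
move=> e0; have ei : 0 < e^-1 by rewrite invr_gt0.
have [i1 i2] := Rintegral_gauss_scale ei.
have := (mpres_shift (- y)).2 (fun x : T2 => (expR (- (e^-1 * x ^+ 2)))%:E).
move=> H; have -> : (\int[leb]_x (gkern e (x, y))%:E = \int[leb]_x (expR (- (e^-1 * x ^+ 2)))%:E)%E.
  rewrite -H.
  - by apply: eq_integral => x _; rewrite /gkern /= (mulrC e^-1).
  - by apply/measurable_EFinP; cmeas_tac.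
  - by move=> x; rewrite lee_fin expR_ge0.
rewrite -[LHS]fineK; last exact: integrable_fin_num i1.
by congr EFin; rewrite -[LHS]/(\int[leb]_x expR (- (e^-1 * x ^+ 2))) i2 invrK.
Qed.

Lemma integral_gkern2 e x : 0 < e -> (\int[leb]_y (gkern e (x, y))%:E = (Num.sqrt (pi * e))%:E)%E.
Proof.
move=> e0; rewrite -(integral_gkern1 x e0); apply: eq_integral => y _.
by rewrite /gkern /= -sqrrN opprB.
Qed.

Lemma mean_gkern1 g e : 0 < e -> cmeas setT g ->
  (\int[(leb \x leb)%E]_p (cabs (g p.1) ^+ 2 * gkern e p)%:E = (Num.sqrt (pi * e))%:E * sqn g)%E.
Proof.
move=> e0 mg.
have mg2 : measurable_fun setT (fun x : T2 => cabs (g x) ^+ 2) by exact: measurable_sqr_cabs.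
rewrite fubini_tonelli1/=; last 2 first.
- by apply/measurable_EFinP; apply: measurable_funM => //; exact: (measurableT_comp mg2 measurable_fst).
- by move=> p; rewrite lee_fin mulr_ge0 ?sqr_ge0.
rewrite /sqn -ge0_intZ ?sqrtr_ge0//; last by move=> x; rewrite sqr_ge0.
apply: eq_integral => x _; rewrite /fubini_F /=.
rewrite ge0_intZ ?sqr_ge0//; last by rewrite /gkern /=; cmeas_tac.
by rewrite integral_gkern2// muleC.
Qed.

Lemma mean_gkern2 g e : 0 < e -> cmeas setT g ->
  (\int[(leb \x leb)%E]_p (cabs (g p.2) ^+ 2 * gkern e p)%:E = (Num.sqrt (pi * e))%:E * sqn g)%E.
Proof.
move=> e0 mg.
have mg2 : measurable_fun setT (fun x : T2 => cabs (g x) ^+ 2) by exact: measurable_sqr_cabs.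
rewrite fubini_tonelli2/=; last 2 first.
- by apply/measurable_EFinP; apply: measurable_funM => //; exact: (measurableT_comp mg2 measurable_snd).
- by move=> p; rewrite lee_fin mulr_ge0 ?sqr_ge0.
rewrite /sqn -ge0_intZ ?sqrtr_ge0//; last by move=> x; rewrite sqr_ge0.
apply: eq_integral => y _; rewrite /fubini_G /=.
rewrite ge0_intZ ?sqr_ge0//; last by rewrite /gkern /=; cmeas_tac.
by rewrite integral_gkern1// muleC.
Qed.

Lemma sqn_fou_gauss g (e : R) : 0 < e -> L1 g ->
  (\int[leb]_v (cabs (fou g v) ^+ 2 * expR (- (e * v ^+ 2)))%:E =
   (\int[leb]_v (cabs (fou g v) ^+ 2 * expR (- (e * v ^+ 2))))%:E)%E.
Proof.
move=> e0 g1; rewrite /Rintegral fineK//; apply: integrable_fin_num => //.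
refine (@le_integrableR R _ T2 leb setT measurableT _
  (fun v => (\int[leb]_x cabs (g x)) ^+ 2 * expR (- (e * v ^+ 2))) _ _ _).
- apply: measurable_funM; last by cmeas_tac.
  by apply: measurable_sqr_cabs; exact: cmeas_fou.
- move=> v _; rewrite ger0_norm ?mulr_ge0 ?sqr_ge0 ?expR_ge0// ler_wpM2r ?expR_ge0//.
  have h := cabs_fou_le v g1.
  by rewrite ler_pXn2r ?nnegrE ?cabs_ge0// (le_trans _ h)// cabs_ge0.
- by apply: integrableRZ => //; exact: (Rintegral_gauss_scale e0).1.
Qed.

(** Schur's test: 2 |g(x)| |g(y)| <= |g(x)|^2 + |g(y)|^2, and the kernel has mass sqrt (pi e) in
    each variable. Together with the prefactor sqrt (pi / e) this gives pi, whatever e is. *)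
Lemma fou_gauss_le g (e : R) : 0 < e -> L1 g ->
  (\int[leb]_v (cabs (fou g v) ^+ 2 * expR (- (e * v ^+ 2)))%:E <= pi%:E * sqn g)%E.
Proof.
move=> e0 g1; have mg := cintegrable_cmeas g1.
pose F (p : T2 * T2) : R[i] := g p.1 * ((g p.2)^* * (gkern e p)%:C).
have mF : cmeas setT F.
  apply: cmeasM; first exact: (cmeas_comp measurable_fst mg).
  by apply: cmeasM; [exact: (cmeas_comp measurable_snd (cmeasJ mg))|exact: cmeasC].
have FE p : cabs (F p) = cabs (g p.1) * (cabs (g p.2) * gkern e p).
  by rewrite !cabsM cabsJ cabsC ger0_norm.
have gk1 p : gkern e p <= 1.
  by rewrite -expR0 ler_expR oppr_le0 divr_ge0 ?sqr_ge0// ltW.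
have [iF iF2 _ _ _] := cfubini_bound mF (fun x => cabs_ge0 (g x)) (fun x => cabs_ge0 (g x))
  (integrable_cabs measurableT g1) (integrable_cabs measurableT g1)
  (fun x y => ltac:(rewrite FE /= ler_wpM2l ?cabs_ge0// ler_piMr ?cabs_ge0//)).
have [_ EF] := cfubini1 iF iF2.
have gJk x : cintegrable leb setT (fun y => (g y)^* * (gkern e (x, y))%:C).
  have mk : cmeas setT (fun y : T2 => (gkern e (x, y))%:C).
    by rewrite /gkern /=; cmeas_tac.
  apply: (@eq_cintegrable R _ T2 leb setT measurableT (fun y => (gkern e (x, y))%:C * (g y)^*)).
    by move=> y _; rewrite mulrC.
  apply: (@cintegrableMb R _ T2 leb setT measurableT 1 _ _ mk); last exact: cintegrableJ.
  by move=> y _; rewrite cabsC ger0_norm.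
have := plancherel_gauss e0 g1; rewrite cintegralC => PG.
rewrite (sqn_fou_gauss e0 g1).
have -> : \int[leb]_v (cabs (fou g v) ^+ 2 * expR (- (e * v ^+ 2))) =
    Num.sqrt (pi / e) * cabs (cintegral (leb \x leb)%E setT F).
  rewrite -[LHS]ger0_norm; last first.
    by apply: Rintegral_ge0 => v _; rewrite mulr_ge0 ?sqr_ge0 ?expR_ge0.
  rewrite -cabsC PG cabsM cabsC ger0_norm ?sqrtr_ge0//; congr (_ * cabs _).
  rewrite -EF; apply: eq_cintegral => x _.
  by rewrite -(cintegralZ measurableT (g x) (gJk x)).
have S0 : 0 <= Num.sqrt (pi / e) by exact: sqrtr_ge0.
have iFc := integrable_cabs measurableT iF.
have mF' : measurable_fun setT (fun p => cabs (F p)) by exact: measurable_cabs.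
have hF : ((cabs (cintegral (leb \x leb)%E setT F))%:E <= \int[(leb \x leb)%E]_p (cabs (F p))%:E)%E.
  apply: (@le_trans _ _ (\int[(leb \x leb)%E]_p cabs (F p))%:E).
    by rewrite lee_fin; exact: cabs_cintegral.
  by rewrite /Rintegral fineK//; exact: integrable_fin_num.
have m1 : measurable_fun setT (fun p : T2 * T2 => 2^-1 * (cabs (g p.1) ^+ 2 * gkern e p)).
  apply: measurable_funM => //; apply: measurable_funM => //.
  exact: (measurableT_comp (measurable_sqr_cabs mg) measurable_fst).
have m2 : measurable_fun setT (fun p : T2 * T2 => 2^-1 * (cabs (g p.2) ^+ 2 * gkern e p)).
  apply: measurable_funM => //; apply: measurable_funM => //.
  exact: (measurableT_comp (measurable_sqr_cabs mg) measurable_snd).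
have m1' : measurable_fun setT (fun p : T2 * T2 => cabs (g p.1) ^+ 2 * gkern e p).
  apply: measurable_funM => //.
  exact: (measurableT_comp (measurable_sqr_cabs mg) measurable_fst).
have m2' : measurable_fun setT (fun p : T2 * T2 => cabs (g p.2) ^+ 2 * gkern e p).
  apply: measurable_funM => //.
  exact: (measurableT_comp (measurable_sqr_cabs mg) measurable_snd).
have p0 a p : 0 <= cabs (g a) ^+ 2 * gkern e p by rewrite mulr_ge0 ?sqr_ge0.
have hS : (\int[(leb \x leb)%E]_p (cabs (F p))%:E <= (Num.sqrt (pi * e))%:E * sqn g)%E.
  apply: (@le_trans _ _ (\int[(leb \x leb)%E]_p
    (2^-1 * (cabs (g p.1) ^+ 2 * gkern e p) + 2^-1 * (cabs (g p.2) ^+ 2 * gkern e p))%:E)%E).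
    apply: ge0_int_le => //; first exact: measurable_funD.
    move=> p; rewrite FE; have := sqr_ge0 (cabs (g p.1) - cabs (g p.2)); have := gkern_ge0 e p.
    set a := cabs _; set b := cabs _; set G := gkern _ _ => G0 ab.
    by have := mulr_ge0 G0 ab; lra.
  rewrite ge0_intD//; last 2 first.
  - by move=> p; rewrite mulr_ge0.
  - by move=> p; rewrite mulr_ge0.
  rewrite !ge0_intZ// mean_gkern1// mean_gkern2// -ge0_muleDl ?lee_fin//.
  by rewrite -EFinD (_ : 2^-1 + 2^-1 = 1) ?mul1e//; field.
rewrite EFinM; apply: (le_trans (lee_wpmul2l _ (le_trans hF hS))); first by rewrite lee_fin.
rewrite muleA -EFinM -sqrtrM ?divr_ge0 ?pi_ge0 ?(ltW e0)//.
rewrite (_ : pi / e * (pi * e) = pi ^+ 2); last by field; rewrite gt_eqF.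
by rewrite sqrtr_sqr ger0_norm ?pi_ge0.
Qed.

(** The bound does not depend on the weight, which Fatou's lemma removes along e = 1 / (n + 1). *)
Lemma sqn_fou_le g : L1 g -> (sqn (fou g) <= pi%:E * sqn g)%E.
Proof.
move=> g1; have mf := measurable_sqr_cabs (cmeas_fou g1).
apply: (@fatou_ae R _ _ leb (fun n v => cabs (fou g v) ^+ 2 * expR (- (n.+1%:R^-1 * v ^+ 2)))).
- by move=> n; apply: measurable_funM => //; cmeas_tac.
- exact: mf.
- by move=> n v; rewrite mulr_ge0 ?sqr_ge0 ?expR_ge0.
- apply: aeW => v; rewrite -[X in _ --> X]mulr1; apply: cvgM; first exact: cvg_cst.
  rewrite -[X in _ --> X]expR0; apply: continuous_cvg; first exact: continuous_expR.
  rewrite -[X in _ --> X]oppr0; apply: cvgN.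
  have c1 : n.+1%:R^-1 @[n --> \oo] --> (0 : R) by exact: cvg_harmonic.
  have c2 : v ^+ 2 @[n --> \oo] --> v ^+ 2 by exact: cvg_cst.
  rewrite -[X in _ --> X](mul0r (v ^+ 2)); exact: (cvgM c1 c2).
- by move=> n; apply: fou_gauss_le.
Qed.

End plancherel.

Section plancherel_lower.
Context {R : realType}.
Local Notation leb := (@lebesgue_measure R).
Local Notation T2 := (measurableTypeR R).
Implicit Types (g h k : R -> R[i]).

Lemma lee_cvg_EFin (X : nat -> R) (l : R) (C : \bar R) :
  X n @[n --> \oo] --> l -> (forall n, ((X n)%:E <= C)%E) -> (l%:E <= C)%E.
Proof.
move=> Xl XC.
have h : (X n)%:E @[n --> \oo] --> l%:E by apply: cvg_EFin; [exact: nearW|exact: Xl].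
rewrite -(cvg_lim _ h)//; apply: lime_le; first by apply/cvg_ex; eexists; exact: h.
exact: nearW.
Qed.

Lemma cvg_mul_const (u : nat -> R) (c : R) : u n @[n --> \oo] --> (0 : R) ->
  u n * c @[n --> \oo] --> (0 : R).
Proof.
move=> uc; have cc : c @[n --> \oo] --> c by exact: cvg_cst.
by rewrite -[X in _ --> X](mul0r c); exact: (cvgM uc cc).
Qed.

Let cmeas_egauss : cmeas setT (fun s : T2 => (expR (- s ^+ 2))%:C).
Proof. by cmeas_tac. Qed.

(** With weight parameter e = d^2 and y = x + d s, the Gaussian kernel in [plancherel_gauss] becomes
    an approximate identity. Boundedness and continuity of k allow dominated convergence as d tends
    to 0, so the weighted integrals tend to pi times the square norm, while each of them is at most
    [sqn (fou k)]. *)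
Lemma sqn_fou_ge_cont k (M : R) : L1 k -> (forall x, cabs (k x) <= M) ->
  (forall x (d : nat -> R), d n @[n --> \oo] --> (0 : R) -> ccvg (fun n => k (d n + x)) (k x)) ->
  (pi%:E * sqn k <= sqn (fou k))%E.
Proof.
move=> k1 kM kc; have mk := cintegrable_cmeas k1.
have M0 : 0 <= M by apply: le_trans (kM 0); exact: cabs_ge0.
have k2 : L2 k.
  apply/L2P; split => //.
  apply: (@le_lt_trans _ _ (\int[leb]_x (M * cabs (k x))%:E)%E).
    apply: ge0_int_le => //.
    - exact: measurable_sqr_cabs.
    - by apply: measurable_funM => //; exact: measurable_cabs.
    - by move=> x; rewrite sqr_ge0.
    - by move=> x; rewrite expr2 ler_wpM2r ?cabs_ge0.
  rewrite ge0_intZ ?M0//; last exact: measurable_cabs.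
  by rewrite lte_mul_pinfty ?lee_fin//; exact: (cintegrableP leb measurableT mk).1.
pose d (n : nat) : R := n.+1%:R^-1.
have d0 n : 0 < d n by rewrite invr_gt0.
have dc : d n @[n --> \oo] --> (0 : R) by exact: cvg_harmonic.
pose W n x := cintegral leb setT (fun s => (k (d n * s + x))^* * (expR (- s ^+ 2))%:C).
have mshift n x : cmeas setT (fun s : T2 => (k (d n * s + x))^*).
  by apply: cmeasJ; apply: (cmeas_comp _ mk); exact: measurable_affine.
have gM : leb.-integrable setT (EFin \o (fun s : T2 => M * expR (- s ^+ 2))).
  by apply: integrableRZ => //; exact: integrable_gauss.
have Wb n x s : cabs ((k (d n * s + x))^* * (expR (- s ^+ 2))%:C) <= M * expR (- s ^+ 2).
  by rewrite cabsM cabsJ cabsC ger0_norm ?expR_ge0// ler_wpM2r ?expR_ge0.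
have kW n : cintegrable leb setT (fun x => k x * W n x).
  pose F (p : T2 * T2) := k p.1 * ((k (d n * p.2 + p.1))^* * (expR (- p.2 ^+ 2))%:C).
  have mF : cmeas setT F.
    apply: cmeasM; first exact: (cmeas_comp measurable_fst mk).
    apply: cmeasM; last by cmeas_tac.
    apply: cmeasJ; apply: (cmeas_comp _ mk).
    by apply: measurable_funD => //; apply: measurable_funM.
  have := cfubini_bound mF (fun x => cabs_ge0 (k x))
    (fun s => mulr_ge0 M0 (expR_ge0 (- s ^+ 2))) (integrable_cabs measurableT k1) gM
    (fun x s => ltac:(rewrite /F cabsM ler_wpM2l ?cabs_ge0//=; exact: Wb)).
  case=> _ F2 _ + _; apply: (eq_cintegrable measurableT) => x _ /=.
  rewrite -(cintegralZ measurableT)//.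
  apply: (le_cintegrable measurableT (cmeasM (mshift n x) cmeas_egauss) _ gM) => s _; exact: Wb.
have Wle n x : cabs (W n x) <= M * Num.sqrt pi.
  rewrite -Rintegral_gauss -(RintegralZl M measurableT (integrable_gauss)).
  exact: (cabs_cintegral_le measurableT (cmeasM (mshift n x) cmeas_egauss) (fun s _ => Wb n x s) gM).
have Wc x : ccvg (W ^~ x) ((k x)^* * (Num.sqrt pi)%:C).
  have [_] := @cdominated_cvg R _ T2 leb setT measurableT
    (fun n s => (k (d n * s + x))^* * (expR (- s ^+ 2))%:C)
    (fun s => (k x)^* * (expR (- s ^+ 2))%:C) _
    (fun n => cmeasM (mshift n x) cmeas_egauss)
    (fun s _ => ltac:(rewrite /ccvg; under eq_fun do rewrite -mulrBl -rmorphB cabsM cabsJ cabsC;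
      apply: cvg_mul_const; apply: kc; exact: cvg_mul_const)) gM
    (fun n s _ => Wb n x s).
  have -> // : cintegral leb setT (fun s : T2 => (k x)^* * (expR (- s ^+ 2))%:C) =
    (k x)^* * (Num.sqrt pi)%:C.
  rewrite -Rintegral_gauss -cintegralC -(cintegralZ measurableT)//.
  refine (@le_cintegrable R _ T2 leb setT measurableT _ _ _ _ integrable_gauss).
    exact: cmeas_egauss.
  by move=> s _; rewrite cabsC ger0_norm ?expR_ge0.
pose Z n := cintegral leb setT (fun x => k x * W n x).
have Zc : ccvg Z (((Num.sqrt pi) * \int[leb]_x cabs (k x) ^+ 2)%:C).
  have [_] := @cdominated_cvg R _ T2 leb setT measurableT (fun n x => k x * W n x)
    (fun x => k x * ((k x)^* * (Num.sqrt pi)%:C)) (fun x => (M * Num.sqrt pi) * cabs (k x))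
    (fun n => cintegrable_cmeas (kW n)) (fun x _ => ccvgZ (k x) (Wc x))
    (integrableRZ measurableT _ (integrable_cabs measurableT k1))
    (fun n x _ => ltac:(rewrite cabsM mulrC ler_wpM2r ?cabs_ge0//; exact: Wle)).
  have -> // : cintegral leb setT (fun x => k x * ((k x)^* * (Num.sqrt pi)%:C)) =
    (Num.sqrt pi * \int[leb]_x cabs (k x) ^+ 2)%:C.
  rewrite -(RintegralZl _ measurableT (sqn_integrable k2)) -cintegralC.
  by apply: eq_cintegral => x _; rewrite mulrA mulJ -complexM mulrC.
pose X n := \int[leb]_v (cabs (fou k v) ^+ 2 * expR (- (d n ^+ 2 * v ^+ 2))).
have XZ n : (X n)%:C = (Num.sqrt pi)%:C * Z n.
  have dn2 : 0 < d n ^+ 2 by rewrite exprn_gt0.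
  rewrite -cintegralC (plancherel_gauss dn2 k1).
  have inner x : cintegral leb setT (fun y => (k y)^* * (expR (- ((x - y) ^+ 2 / d n ^+ 2)))%:C) =
      (d n)%:C * W n x.
    pose f y := (k y)^* * (expR (- ((x - y) ^+ 2 / d n ^+ 2)))%:C.
    have mf : cmeas setT (f : T2 -> R[i]).
      by rewrite /f; apply: cmeasM; [exact: cmeasJ|cmeas_tac].
    have fi : cintegrable leb setT f.
      refine (@le_cintegrable R _ T2 leb setT measurableT _ (fun y => cabs (k y)) mf _ _).
        move=> y _; rewrite cabsM cabsJ cabsC ger0_norm ?expR_ge0// ler_piMr ?cabs_ge0//.
        by rewrite -expR0 ler_expR oppr_le0 divr_ge0 ?sqr_ge0.
      exact: integrable_cabs.
    have fsi : cintegrable leb setT (fun y => f (y + x)).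
      exact: (mpres_cintegrable (mpres_shift x) fi).
    rewrite -[LHS](mpres_cintegral (mpres_shift x) mf).
    have [_ es] := cintegral_scale (d0 n) fsi.
    have dn0 : (d n)%:C != 0 :> R[i] by rewrite -cabs_eq0 cabsC normr_eq0 gt_eqF.
    apply: (mulfI (invr_neq0 dn0)); rewrite mulKf// -complexV -es.
    apply: eq_cintegral => s _; rewrite /f; congr (_ * (expR (- _))%:C).
    by field; rewrite gt_eqF.
  transitivity ((Num.sqrt (pi / d n ^+ 2))%:C * ((d n)%:C * Z n)).
    congr (_ * _); rewrite /Z -(cintegralZ measurableT _ (kW n)); apply: eq_cintegral => x _.
    by rewrite inner mulrCA.
  rewrite mulrA -complexM; congr (_%:C * _).
  by rewrite sqrtrM ?pi_ge0// sqrtrV ?sqr_ge0// sqrtr_sqr ger0_norm ?(ltW (d0 n))// divfK// gt_eqF.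
have Xc : X n @[n --> \oo] --> pi * \int[leb]_x cabs (k x) ^+ 2.
  have -> : X = (fun n => Re ((Num.sqrt pi)%:C * Z n)) by apply/funext => n; rewrite -XZ.
  have [+ _] := (ccvgP _ _).1 (ccvgZ (Num.sqrt pi)%:C Zc).
  by rewrite -complexM mulrA -expr2 sqr_sqrtr ?pi_ge0.
rewrite (sqnE k2) -EFinM; apply: (lee_cvg_EFin Xc) => n.
rewrite -(sqn_fou_gauss _ k1); last by rewrite exprn_gt0.
apply: ge0_int_le => //.
- apply: measurable_funM; first by apply: measurable_sqr_cabs; exact: cmeas_fou.
  by cmeas_tac.
- by apply: measurable_sqr_cabs; exact: cmeas_fou.
- by move=> v; rewrite mulr_ge0 ?sqr_ge0 ?expR_ge0.
- move=> v; rewrite ler_piMr ?sqr_ge0// -expR0 ler_expR oppr_le0 mulr_ge0 ?sqr_ge0//.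
Qed.

End plancherel_lower.

(** * Box averages and Lebesgue differentiation *)

Section box_average.
Context {R : realType}.
Local Notation leb := (@lebesgue_measure R).
Local Notation T2 := (measurableTypeR R).
Implicit Types (g h k : R -> R[i]).

Lemma ae_neq (a : R) : {ae leb, forall t, t != a}.
Proof.
exists [set a]; split; [exact: measurable_set1|exact: lebesgue_measure_set1|].
by move=> t /= /negP; rewrite negbK => /eqP.
Qed.

Lemma ae_and (d : measure_display) (T : measurableType d) (mu : {measure set T -> \bar R})
    (P Q : T -> Prop) : {ae mu, forall x, P x} -> {ae mu, forall x, Q x} ->
  {ae mu, forall x, P x /\ Q x}.
Proof. by move=> p q; apply: filterS2 p q => x. Qed.

(** Lebesgue's differentiation theorem, read along the increments 1 / (n + 1) of an
    antiderivative. *)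
Lemma quotient_ae_cvg (u : R -> R) : leb.-integrable setT (EFin \o u) ->
  {ae leb, forall x, n.+1%:R * \int[leb]_(t in `[x, x + n.+1%:R^-1]) u t @[n --> \oo] --> u x}.
Proof.
move=> ui.
have uiS (D : set R) : measurable (D : set T2) -> leb.-integrable D (EFin \o u).
  by move=> mD; exact: (@integrableS _ T2 R leb setT D _ measurableT mD (@subsetT _ _) ui).
have := FTC1Ny (fun y => uiS `]-oo, y]%classic (measurable_itv _)) (open_integrable_locally openT ui).
apply: ae_imply => x [dF <-].
set F := fun x => _ in dF *.
have : (fun h : R => h^-1 *: ((F \o shift x) (h *: (1 : R)) - F x)) @ 0^' --> derive1 F x.
  by rewrite derive1E; exact: dF.
move=> /cvgr_dnbhsP /(_ (fun n => n.+1%:R^-1)) H.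
have {H} : n.+1%:R^-1^-1 *: ((F \o shift x) (n.+1%:R^-1 *: (1 : R)) - F x) @[n --> \oo] --> derive1 F x.
  by apply: H; split; [move=> n; rewrite invr_neq0|exact: cvg_harmonic].
suff -> : (fun n : nat => n.+1%:R * \int[leb]_(t in `[x, x + n.+1%:R^-1]) u t) =
  (fun n : nat => n.+1%:R^-1^-1 *: ((F \o shift x) (n.+1%:R^-1 *: (1 : R)) - F x)) by [].
apply/esym/funext => n.
have dn : 0 < n.+1%:R^-1 :> R by rewrite invr_gt0.
rewrite invrK /GRing.scale/= mulr1 (addrC _ x); congr (_ * _).
rewrite /F Rintegral_itvB; last 3 first.
- by apply: uiS; exact: measurable_itv.
- by [].
- by rewrite bnd_simp lerDl ltW.
by apply: Rintegral_itv_obnd_cbnd; apply: uiS; exact: measurable_itv.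
Qed.

(** The mean of [g] over [x, x + d]. For integrable [g] it meets the hypotheses of
    [sqn_fou_ge_cont], and it tends to [g] almost everywhere along d = 1 / (n + 1). *)
Definition box (d : R) g (x : R) : R[i] :=
  (d^-1)%:C * cintegral leb setT (fun s => (\1_`[0, d] s)%:C * g (x + s)).

Variable d : R.
Hypothesis d_gt0 : 0 < d.

Let mI : measurable (`[0, d]%classic : set T2). Proof. exact: measurable_itv. Qed.

Lemma boxE g x : cmeas setT g -> box d g x = (d^-1)%:C * cintegral leb `[x, x + d] g.
Proof.
move=> mg; congr (_ * _); rewrite [RHS]cintegral_indic.
have mf : cmeas setT (fun t : T2 => (\1_`[x, x + d] t)%:C * g t).
  by apply: cmeasM => //; apply: cmeas_indic; exact: measurable_itv.
rewrite -(mpres_cintegral (mpres_shift x) mf); apply: eq_cintegral => s _.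
rewrite addrC; congr (_%:C * _); rewrite !indicE !mem_setE !in_itv/=.
by rewrite lerDr (addrC s) lerD2l.
Qed.

Let sliceI g x : L1 g -> cintegrable leb setT (fun s => (\1_`[0, d] s)%:C * g (x + s)).
Proof.
move=> g1; have gx := mpres_cintegrable (mpres_shift x) g1.
apply: (@cintegrableMb R _ T2 leb setT measurableT 1) => //.
- exact: cmeas_indic.
- move=> s _; rewrite cabsC indicE; case: (_ \in _) => /=; rewrite ?normr1 ?normr0//.
- by apply: (eq_cintegrable measurableT) gx => s _; rewrite addrC.
Qed.

(** Integrating in x first, the translation by s disappears and only the length of [0, d] times the
    norm of g remains. *)
Let prodI g : L1 g ->
  cintegrable (leb \x leb)%E setT (fun p : T2 * T2 => (\1_`[0, d] p.2)%:C * g (p.1 + p.2)).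
Proof.
move=> g1; have mg := cintegrable_cmeas g1.
have mF : cmeas setT (fun p : T2 * T2 => (\1_`[0, d] p.2)%:C * g (p.1 + p.2)).
  apply: cmeasM; first exact: (cmeas_comp measurable_snd (cmeas_indic mI)).
  by apply: (cmeas_comp _ mg); apply: measurable_funD.
apply/(cintegrableP _ measurableT mF).
rewrite fubini_tonelli2/=; last 2 first.
- exact/measurable_EFinP/measurable_cabs.
- by move=> p; rewrite lee_fin cabs_ge0.
rewrite /fubini_G/=.
have e s : (\int[leb]_x (cabs ((\1_`[0, d] s)%:C * g (x + s)))%:E =
    (\1_`[0, d] s)%:E * \int[leb]_x (cabs (g x))%:E)%E.
  have m1 : measurable_fun setT (fun x : T2 => cabs (g (x + s))).
    by apply: measurable_cabs; apply: (cmeas_comp _ mg); exact: measurable_funD.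
  transitivity (\int[leb]_x (\1_`[0, d] s * cabs (g (x + s)))%:E)%E.
    by apply: eq_integral => x _; rewrite cabsM cabsC ger0_norm ?indic_ge0.
  rewrite ge0_intZ ?indic_ge0//.
  congr (_ * _)%E; apply: ((mpres_shift s).2 (fun x => (cabs (g x))%:E)).
    by apply/measurable_EFinP; exact: measurable_cabs.
  by move=> x; rewrite lee_fin cabs_ge0.
under eq_integral do rewrite e.
have gfin : (\int[leb]_x (cabs (g x))%:E < +oo)%E by exact: (cintegrableP leb measurableT mg).1.
have g0 : (0 <= \int[leb]_x (cabs (g x))%:E)%E by apply: integral_ge0 => x _; rewrite lee_fin cabs_ge0.
rewrite -(fineK (_ : \int[leb]_x (cabs (g x))%:E \is a fin_num)%E); last by rewrite ge0_fin_numE.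
under eq_integral do rewrite muleC -EFinM.
have m1 : measurable_fun setT (\1_`[0, d] : T2 -> R) by exact: measurable_indic.
rewrite (ge0_intZ leb measurableT (fine_ge0 g0) m1 (fun x => indic_ge0 _ x)).
rewrite lte_mul_pinfty ?lee_fin ?fine_ge0//.
exact: (integrable_lty measurableT (integrable_indic_itv 0 d true false)).
Qed.

Lemma L1_box g : L1 g -> L1 (box d g).
Proof.
move=> g1; apply: cintegrableZ => //.
exact: (cfubini1 (prodI g1) (fun x => sliceI x g1)).1.
Qed.

Lemma box_bounded g x : L1 g -> cabs (box d g x) <= d^-1 * \int[leb]_t cabs (g t).
Proof.
move=> g1; rewrite boxE; last exact: (cintegrable_cmeas g1).
rewrite cabsM cabsC ger0_norm ?invr_ge0 ?(ltW d_gt0)// ler_wpM2l ?invr_ge0 ?(ltW d_gt0)//.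
rewrite cintegral_indic; have mg := cintegrable_cmeas g1.
apply: cabs_cintegral_le => //.
- by apply: cmeasM => //; apply: cmeas_indic; exact: measurable_itv.
- move=> t _; rewrite cabsM cabsC ger0_norm ?indic_ge0//.
  by rewrite ler_piMl ?cabs_ge0 ?indic_le1.
- exact: integrable_cabs.
Qed.

Lemma box_cont g x (e : nat -> R) : L1 g -> e n @[n --> \oo] --> (0 : R) ->
  ccvg (fun n => box d g (e n + x)) (box d g x).
Proof.
move=> g1 ec; have mg := cintegrable_cmeas g1.
(* The indicators of the moving intervals converge except possibly at the two endpoints. [N]
   discards these, and elsewhere the indicator is constant once |e n| is below the distance [r] to
   the endpoints. *)
pose N (t : R) := (t != x) && (t != x + d).
have aeN : {ae leb, forall t, N t}.
  by apply: ae_imply (ae_and (ae_neq x) (ae_neq (x + d))) => t [h1 h2]; apply/andP.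
have mN : measurable_fun setT (fun t : T2 => (N t)%:R : R).
  have -> : (fun t : T2 => (N t)%:R : R) = (fun t => (1 - \1_[set x] t) * (1 - \1_[set x + d] t)).
    apply/funext => t; rewrite !indicE /N.
    have e' (a : R) : (t \in [set a]%classic) = (t == a) by apply/idP/eqP; rewrite inE.
    rewrite !e'.
    by case: (t == x); case: (t == x + d) => /=; rewrite ?subrr ?subr0 ?mulr1 ?mul0r ?mulr0.
  by apply: measurable_funM; apply: measurable_funB => //; exact: measurable_indic.
have E y : box d g y = (d^-1)%:C * cintegral leb setT (fun t => ((N t)%:R * \1_`[y, y + d] t)%:C * g t).
  rewrite boxE//; congr (_ * _); rewrite cintegral_indic; apply: ae_eq_cintegral => //.
  - by apply: cmeasM => //; apply: cmeas_indic; exact: measurable_itv.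
  - apply: cmeasM => //; apply: cmeasC; apply: measurable_funM => //.
  - by apply: ae_imply aeN => t ->; rewrite mul1r.
rewrite E (_ : (fun n => _) = (fun n => (d^-1)%:C * cintegral leb setT
   (fun t => ((N t)%:R * \1_`[e n + x, e n + x + d] t)%:C * g t))); last first.
  by apply/funext => n; exact: E.
apply: ccvgZ.
refine (@cdominated_cvg R _ T2 leb setT measurableT
  (fun n t => ((N t)%:R * \1_`[e n + x, e n + x + d] t)%:C * g t) _
  (fun t => cabs (g t)) _ _ (integrable_cabs measurableT g1) _).2.
- move=> n; apply: cmeasM => //; apply: cmeasC; apply: measurable_funM => //.
- move=> t _; apply: cvg_near_cst.
  have [/andP[t1 t2]|Nt] := boolP (N t); last first.
    by near=> n; rewrite !mul0r subrr cabs0.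
  pose r := Num.min `|t - x| `|t - (x + d)|.
  have r0 : 0 < r by rewrite lt_min !normr_gt0 !subr_eq0 t1 t2.
  near=> n.
  have : `|0 - e n| < r by near: n; move/cvgrPdist_lt : ec; exact.
  rewrite sub0r normrN lt_min => /andP[h1 h2].
  suff -> : \1_`[e n + x, e n + x + d] t = \1_`[x, x + d] t :> R by rewrite subrr cabs0.
  rewrite !indicE !mem_setE !in_itv/=; congr (nat_of_bool (_ && _))%:R.
    apply/idP/idP => h.
      by rewrite leNgt; apply/negP => tx; move: h1; rewrite (ltr0_norm (_ : t - x < 0)) ?subr_lt0//
        => /ltr_normlP[]; lra.
    by rewrite leNgt; apply/negP => tx; move: h1; rewrite (ger0_norm (_ : 0 <= t - x)) ?subr_ge0//
      => /ltr_normlP[]; lra.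
  apply/idP/idP => h.
    by rewrite leNgt; apply/negP => tx; move: h2; rewrite (gtr0_norm (_ : 0 < t - (x + d))) ?subr_gt0//
      => /ltr_normlP[]; lra.
  by rewrite leNgt; apply/negP => tx; move: h2; rewrite (ler0_norm (_ : t - (x + d) <= 0)) ?subr_le0//
    => /ltr_normlP[]; lra.
- move=> n t _; rewrite cabsM cabsC ler_piMl ?cabs_ge0// indicE.
  by case: (N t); case: (_ \in _); rewrite ?mul1r ?mul0r ?normr1 ?normr0.
Unshelve. all: by end_near. Qed.

(** Translation by s multiplies the Fourier transform by [cis (- (2 * (v * s)))]; averaging over s
    multiplies it by a mean of unimodular numbers. *)
Lemma cabs_fou_box g v : L1 g -> cabs (fou (box d g) v) <= cabs (fou g v).
Proof.
move=> g1; have mg := cintegrable_cmeas g1.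
pose F (p : T2 * T2) := cis (2 * (v * p.1)) * ((\1_`[0, d] p.2)%:C * g (p.1 + p.2)).
have iF : cintegrable (leb \x leb)%E setT F.
  apply: (cintegrableMb measurableT (c := 1) _ _ (prodI g1)).
    by rewrite /cis; cmeas_tac.
  by move=> p _; rewrite cabs_cis.
have F2 x : cintegrable leb setT (fun s => F (x, s)).
  exact: (cintegrableZ measurableT (cis (2 * (v * x))) (sliceI x g1)).
have mcis : cmeas setT (fun x : T2 => cis (2 * (v * x))) by rewrite /cis; cmeas_tac.
have gcis s : cintegrable leb setT (fun x : T2 => cis (2 * (v * x)) * g (x + s)).
  apply: (@cintegrableMb R _ T2 leb setT measurableT 1 _ _ mcis).
    by move=> x _; rewrite cabs_cis.
  exact: (mpres_cintegrable (mpres_shift s) g1).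
have F1 s : cintegrable leb setT (fun x => F (x, s)).
  have := cintegrableZ measurableT (\1_`[0, d] s)%:C (gcis s).
  by apply: (eq_cintegrable measurableT) => x _; rewrite /F/= mulrCA.
have inner s : cintegral leb setT (fun x => F (x, s)) = (\1_`[0, d] s)%:C * (cis (- (2 * (v * s))) * fou g v).
  transitivity ((\1_`[0, d] s)%:C * cintegral leb setT (fun x : T2 => cis (2 * (v * x)) * g (x + s))).
    rewrite -(cintegralZ measurableT _ (gcis s)); apply: eq_cintegral => x _.
    by rewrite /F/= mulrCA.
  congr (_ * _).
  have mh : cmeas setT (fun x : T2 => cis (2 * (v * (x - s))) * g x).
    by apply: cmeasM => //; rewrite /cis; cmeas_tac.
  transitivity (cintegral leb setT (fun x : T2 => cis (2 * (v * (x - s))) * g x)).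
    by rewrite -(mpres_cintegral (mpres_shift s) mh); apply: eq_cintegral => x _; rewrite addrK.
  rewrite -(cintegralZ measurableT _ (fou_integrable v g1)); apply: eq_cintegral => x _.
  by rewrite mulrBr mulrBr cisD; ring.
have E : fou (box d g) v = (d^-1)%:C * cintegral leb setT (fun s => cintegral leb setT (fun x => F (x, s))).
  have [ik ek] := cfubini1 iF F2.
  rewrite -(cfubini iF F2 F1) -(cintegralZ measurableT _ ik).
  apply: eq_cintegral => x _; rewrite /box /F/= (cintegralZ measurableT _ (sliceI x g1)).
  by ring.
have id : leb.-integrable setT (EFin \o (fun s : T2 => \1_`[0, d] s * cabs (fou g v))).
  have := integrableRZ measurableT (cabs (fou g v)) (integrable_indic_itv 0 d true false).
  by apply: eq_integrable => // s _ /=; rewrite mulrC.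
rewrite E cabsM cabsC ger0_norm ?invr_ge0 ?(ltW d_gt0)//.
have -> : cabs (fou g v) = d^-1 * (d * cabs (fou g v)) by rewrite mulKf// gt_eqF.
rewrite ler_wpM2l ?invr_ge0 ?(ltW d_gt0)//.
have -> : d * cabs (fou g v) = \int[leb]_s (\1_`[0, d] s * cabs (fou g v)).
  rewrite -Rintegral_indic Rintegral_cst//= lebesgue_measure_itv/= lte_fin d_gt0.
  by rewrite mulrC oppr0 adde0.
have iin : cintegrable leb setT (fun s => cintegral leb setT (fun x => F (x, s))).
  apply: (@le_cintegrable R _ T2 leb setT measurableT _ _ _ _ id).
    have mm : cmeas setT (fun s : T2 => (\1_`[0, d] s)%:C * (cis (- (2 * (v * s))) * fou g v)).
      apply: cmeasM; first exact: cmeas_indic.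
      by rewrite /cis; cmeas_tac.
    by apply: eq_cmeas mm => s; rewrite inner.
  move=> s _; rewrite inner !cabsM cabs_cis mul1r cabsC ger0_norm ?indic_ge0//.
apply: (cabs_cintegral_le measurableT (cintegrable_cmeas iin) _ id) => s _.
by rewrite inner !cabsM cabs_cis mul1r cabsC ger0_norm ?indic_ge0.
Qed.

End box_average.

Section plancherel_theorem.
Context {R : realType}.
Local Notation leb := (@lebesgue_measure R).
Implicit Types (g : R -> R[i]).

(** Averages satisfy the bound and do not increase |fou g|, so Fatou's lemma transfers it to g. The
    case of infinite [sqn g] is included. *)
Lemma sqn_fou_ge g : L1 g -> (pi%:E * sqn g <= sqn (fou g))%E.
Proof.
move=> g1; have mg := cintegrable_cmeas g1.
pose k n := box n.+1%:R^-1 g.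
have d0 n : 0 < n.+1%:R^-1 :> R by rewrite invr_gt0.
have k1 n : L1 (k n) by exact: L1_box.
have hk n : (pi%:E * sqn (k n) <= sqn (fou g))%E.
  apply: (@le_trans _ _ (sqn (fou (k n)))).
    apply: (@sqn_fou_ge_cont _ _ (n.+1%:R^-1^-1 * \int[leb]_t cabs (g t))) => //.
    - by move=> x; exact: box_bounded.
    - by move=> x e ec; exact: box_cont.
  apply: ge0_int_le => //.
  - by apply: measurable_sqr_cabs; exact: cmeas_fou.
  - by apply: measurable_sqr_cabs; exact: cmeas_fou.
  - by move=> v; rewrite sqr_ge0.
  - move=> v; rewrite ler_pXn2r ?nnegrE ?cabs_ge0//; exact: cabs_fou_box.
have aek : {ae leb, forall x, ccvg (k ^~ x) (g x)}.
  have kE n x : k n x = n.+1%:R%:C * cintegral leb `[x, x + n.+1%:R^-1] g.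
    by rewrite /k boxE// invrK.
  have [gr gi] := g1.
  apply: ae_imply (ae_and (quotient_ae_cvg gr) (quotient_ae_cvg gi)) => x [hr hi].
  apply/ccvgP; split.
    rewrite (_ : (fun n => _) = (fun n => n.+1%:R * \int[leb]_(t in `[x, x + n.+1%:R^-1]) Re (g t)))//.
    by apply/funext => n; rewrite kE cReM /= mul0r subr0.
  rewrite (_ : (fun n => _) = (fun n => n.+1%:R * \int[leb]_(t in `[x, x + n.+1%:R^-1]) Im (g t)))//.
  by apply/funext => n; rewrite kE cImM /= mul0r addr0.
rewrite -[X in (X * _)%E]/(pi%:E) -ge0_intZ ?pi_ge0//; last 2 first.
- exact: measurable_sqr_cabs.
- by move=> x; rewrite sqr_ge0.
apply: (@fatou_ae R _ _ leb (fun n x => pi * cabs (k n x) ^+ 2)).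
- move=> n; apply: measurable_funM => //; apply: measurable_sqr_cabs.
  exact: (cintegrable_cmeas (k1 n)).
- by apply: measurable_funM => //; exact: measurable_sqr_cabs.
- by move=> n x; rewrite mulr_ge0 ?pi_ge0 ?sqr_ge0.
- apply: ae_imply aek => x /ccvgP[hr hi].
  apply: cvgM; first exact: cvg_cst.
  rewrite sqr_cabs; under eq_fun do rewrite sqr_cabs.
  by apply: cvgD; rewrite expr2; under eq_fun do rewrite expr2; exact: cvgM.
- move=> n; rewrite ge0_intZ ?pi_ge0//; last 2 first.
  + by apply: measurable_sqr_cabs; exact: (cintegrable_cmeas (k1 n)).
  + by move=> x; rewrite sqr_ge0.
  exact: hk.
Qed.

Lemma plancherel g : L1 g -> sqn (fou g) = (pi%:E * sqn g)%E.
Proof.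
by move=> g1; apply/eqP; rewrite eq_le sqn_fou_le// sqn_fou_ge.
Qed.

End plancherel_theorem.

(** * The Bargmann transform is an isometry *)

Section caratheodory_functions.
Context {R : realType}.
Local Notation T2 := (measurableTypeR R).

(** Replacing x by floor ((n + 1) x) / (n + 1) gives a function that depends on y alone in each of
    countably many strips, hence is measurable. Continuity in x makes these converge to u. *)
Lemma measurable_continuous_slices (u : R -> R -> R) :
  (forall x, measurable_fun setT (u x : T2 -> R)) -> (forall y, continuous (u^~ y)) ->
  measurable_fun setT (fun p : T2 * T2 => u p.1 p.2).
Proof.
move=> mu cu.
pose g (n : nat) (x : R) : R := (Num.floor (n.+1%:R * x))%:~R / n.+1%:R.
apply: (@measurable_fun_cvg _ _ _ _ (fun n (p : T2 * T2) => u (g n p.1) p.2)).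
  move=> n _ B mB; rewrite setTI.
  have -> : (fun p : T2 * T2 => u (g n p.1) p.2) @^-1` B =
    \bigcup_(k in [set: int]) (`[k%:~R / n.+1%:R, (k + 1)%:~R / n.+1%:R[%classic `*`
       (u (k%:~R / n.+1%:R) @^-1` B)).
    apply/seteqP; split => [[x y] /= Bxy|[x y] /= [k _ [/= xk Bk]]].
      exists (Num.floor (n.+1%:R * x)) => //; split => //=.
      by rewrite in_itv/= ler_pdivrMr// ltr_pdivlMr// mulrC floor_itv.
    rewrite /g (_ : Num.floor (n.+1%:R * x) = k)//; apply: floor_def.
    by move: xk; rewrite in_itv/= ler_pdivrMr// ltr_pdivlMr// mulrC.
  apply: countable_bigcupT_measurable => [|k]; first exact: countableP.
  apply: measurableX; first exact: measurable_itv.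
  by rewrite -[X in measurable X]setTI; exact: mu.
move=> [x y] _ /=.
have gx : g n x @[n --> \oo] --> x.
  apply/cvgrPdist_le => e e0.
  have hc : \forall n \near \oo, n.+1%:R^-1 <= e.
    have hc : n.+1%:R^-1 @[n --> \oo] --> (0 : R) by exact: cvg_harmonic.
    move/cvgr0Pnorm_le : hc => /(_ e e0); apply: filterS => n.
    by rewrite ger0_norm.
  near=> n.
  have /andP[h1 h2] := floor_itv (n.+1%:R * x).
  have n0 : (0 : R) < n.+1%:R by [].
  have g1 : g n x <= x by rewrite /g ler_pdivrMr// [leRHS]mulrC.
  rewrite ger0_norm ?subr_ge0// lerBlDr -lerBlDl.
  apply: (@le_trans _ _ (x - n.+1%:R^-1)); first by rewrite lerB//; near: n; exact: hc.
  rewrite /g lerBlDr -[X in _ + X]mul1r -mulrDl ler_pdivlMr// [leLHS]mulrC.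
  by rewrite intrD in h2; exact: ltW.
exact: (cvg_comp _ _ gx (cu y x)).
Unshelve. all: by end_near. Qed.

Lemma entire_ccont (F : R[i] -> R[i]) z w : entire F -> ccont (fun t : R => F (z + t%:C * w)).
Proof.
move=> /entireP eF; split => x; have [l hl] := eF (z + x%:C * w);
  have [[h1 _] [h2 _]] := cderiv_line hl;
  apply: differentiable_continuous; exact/derivable1_diffP.
Qed.

Lemma cmeas_entire (F : R[i] -> R[i]) : entire F ->
  cmeas setT (fun p : T2 * T2 => F (to_C p)).
Proof.
move=> eF.
have line z w := entire_ccont z w eF.
have e (x y : R) : to_C (x, y) = 'i%C * y%:C + x%:C * 1.
  by apply: complexP; rewrite !reimE /=; ring.
have e' (x y : R) : to_C (x, y) = x%:C + y%:C * 'i%C.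
  by apply: complexP; rewrite !reimE /=; ring.
split.
  have h := @measurable_continuous_slices (fun x y => Re (F (to_C (x, y)))) _ _.
  rewrite (_ : (fun p => _) = (fun p : T2 * T2 => Re (F (to_C (p.1, p.2))))); last first.
    by apply/funext => -[].
  apply: h => [x|y].
    apply: continuous_measurable_fun; under eq_fun do rewrite e'.
    exact: (line _ _).1.
  under eq_fun do rewrite e; exact: (line _ _).1.
have h := @measurable_continuous_slices (fun x y => Im (F (to_C (x, y)))) _ _.
rewrite (_ : (fun p => _) = (fun p : T2 * T2 => Im (F (to_C (p.1, p.2))))); last first.
  by apply/funext => -[].
apply: h => [x|y].
  apply: continuous_measurable_fun; under eq_fun do rewrite e'.
  exact: (line _ _).2.
under eq_fun do rewrite e; exact: (line _ _).2.
Qed.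

End caratheodory_functions.

Section isometry.
Context {R : realType}.
Local Notation leb := (@lebesgue_measure R).
Local Notation T2 := (measurableTypeR R).
Implicit Types (h g : R -> R[i]) (F : R[i] -> R[i]).

Lemma bcst_sqr : bcst ^+ 2 = Num.sqrt (2 / pi) :> R.
Proof.
have p0 : 0 <= 2 / pi :> R by rewrite divr_ge0// pi_ge0.
rewrite /bcst -powR_mulrn ?powR_ge0// -powRrM -powR12_sqrt//; congr powR.
by field.
Qed.

Definition fnorm F : \bar R := (\int[area]_p (cabs (F (to_C p)) ^+ 2 * gauss (to_C p))%:E)%E.

Lemma fockE F : fock F <-> entire F /\ (fnorm F < +oo)%E.
Proof. by []. Qed.

Lemma gauss_gt0 z : 0 < gauss z :> R.
Proof. by rewrite mulr_gt0 ?invr_gt0 ?pi_gt0 ?expR_gt0. Qed.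

Lemma gauss_ge0 z : 0 <= gauss z :> R.
Proof. exact: ltW (gauss_gt0 z). Qed.

Lemma gauss_to_C (p : R * R) : gauss (to_C p) = pi^-1 * (expR (- p.1 ^+ 2) * expR (- p.2 ^+ 2)).
Proof. by rewrite /gauss sqr_cabs -expRD opprD. Qed.

Lemma measurable_gauss : measurable_fun setT (fun p : T2 * T2 => gauss (to_C p)).
Proof.
rewrite (_ : (fun p => _) = (fun p : T2 * T2 => pi^-1 * (expR (- p.1 ^+ 2) * expR (- p.2 ^+ 2)))).
  by cmeas_tac.
by apply/funext => p; rewrite gauss_to_C.
Qed.

Let win h (u x : R) := h x * (expR (- (x - u) ^+ 2))%:C.

Let L1_win h u : wL2 h -> L1 (win h u).
Proof.
move=> hw; refine (@le_cintegrable R _ T2 leb setT measurableT _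
  (fun x => cabs (h x) * expR (2 * `|u| * `|x| - x ^+ 2)) _ _ _).
- apply: cmeasM; [exact: hw.1|cmeas_tac].
- move=> x _; rewrite cabsM ler_wpM2l ?cabs_ge0// cabsC ger0_norm ?expR_ge0// ler_expR.
  have h1 : x * u <= `|u| * `|x| by rewrite (le_trans (ler_norm _))// normrM mulrC.
  by have := sqr_ge0 u; lra.
- exact: wL2_exp.
Qed.

(** At z = u + iv the exponent of the kernel is -(x - u)^2 + 2ivx + (u^2 + v^2) / 2 - iuv. The
    modulus of the factor free of x is undone by the Gaussian density. *)
Let bargmann_win h (u v : R) : wL2 h ->
  bargmann h (to_C (u, v)) = bcst%:C * (cexp (to_C ((u ^+ 2 + v ^+ 2) / 2, - (u * v))) * fou (win h u) v).
Proof.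
move=> hw; rewrite bargmannE; congr (_ * _).
rewrite /fou -(cintegralZ measurableT _ (fou_integrable v (L1_win u hw))); apply: eq_cintegral => x _.
rewrite /win -cexpC /cis mulrCA -!mulrA; congr (_ * _).
rewrite mulrC -!cexpD; congr cexp; apply: complexP; rewrite ?expr2 !reimE /= ?natrC ?complexn.
  by field.
by field.
Qed.

Lemma bargmann_isometry h : wL2 h -> fnorm (bargmann h) = sqn h.
Proof.
move=> hw; have mB := cmeas_entire (bargmann_entire hw).
have mh := hw.1.
rewrite /fnorm /area fubini_tonelli1/=; last 2 first.
- apply/measurable_EFinP; apply: measurable_funM; last exact: measurable_gauss.
  exact: (measurable_sqr_cabs mB).
- by move=> p; rewrite lee_fin mulr_ge0 ?sqr_ge0 ?gauss_ge0.
pose K : R := bcst ^+ 2 / pi.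
have K0 : 0 <= K by rewrite divr_ge0 ?sqr_ge0 ?pi_ge0.
have slice u : fubini_F leb (fun p => (cabs (bargmann h (to_C p)) ^+ 2 * gauss (to_C p))%:E) u =
    ((bcst ^+ 2)%:E * sqn (win h u))%E.
  rewrite /fubini_F.
  transitivity (\int[leb]_v (K * cabs (fou (win h u) v) ^+ 2)%:E)%E.
    apply: eq_integral => v _; congr EFin.
    rewrite bargmann_win// gauss_to_C !cabsM cabs_cexp cabsC (ger0_norm (ltW bcst_gt0)) /=.
    rewrite /K !exprMn -expRM_natl.
    have -> : expR (2%:R * ((u ^+ 2 + v ^+ 2) / 2)) = (expR (- u ^+ 2) * expR (- v ^+ 2))^-1.
      by rewrite -expRD -expRN; congr expR; field.
    move: (@pi R) (@pi_gt0 R) => P P0; field.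
    by rewrite !gt_eqF ?expR_gt0.
  rewrite (ge0_intZ leb measurableT K0 (measurable_sqr_cabs (cmeas_fou (L1_win u hw)))
    (fun v => sqr_ge0 _)).
  rewrite -[X in (_ * X)%E]/(sqn (fou (win h u))) (plancherel (L1_win u hw)) muleA -EFinM.
  by rewrite /K divfK// gt_eqF// pi_gt0.
transitivity (\int[leb]_u ((bcst ^+ 2)%:E * sqn (win h u)))%E.
  by apply: eq_integral => u _; exact: slice.
(* The squared window is [gkern] with parameter 1/2. Its mass sqrt (pi / 2) is the inverse of
   [bcst ^+ 2]. *)
have e0 : 0 < 2^-1 :> R by rewrite invr_gt0.
have mg2 : measurable_fun setT (fun p : T2 * T2 => cabs (h p.1) ^+ 2 * gkern 2^-1 p).
  apply: measurable_funM; last exact: measurable_gkern.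
  exact: (measurableT_comp (measurable_sqr_cabs mh) measurable_fst).
transitivity ((bcst ^+ 2)%:E * \int[leb]_u sqn (win h u))%E.
  have E u : sqn (win h u) = fubini_G leb (fun p : T2 * T2 => (cabs (h p.1) ^+ 2 * gkern 2^-1 p)%:E) u.
    apply: eq_integral => x _; rewrite /= cabsM exprMn cabsC ger0_norm ?expR_ge0// /gkern /=.
    by rewrite -expRM_natl; congr (_ * expR _)%:E; field.
  rewrite -ge0_integralZl//.
  - under eq_fun do rewrite E; apply: measurable_fun_fubini_tonelli_G.
    + exact/measurable_EFinP.
    + by move=> p; rewrite lee_fin mulr_ge0 ?sqr_ge0 ?gkern_ge0.
  - by move=> u _; exact: sqn_ge0.
  - by rewrite lee_fin sqr_ge0.
have -> : (\int[leb]_u sqn (win h u) = (Num.sqrt (pi * 2^-1))%:E * sqn h)%E.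
  rewrite -(mean_gkern1 e0 mh) fubini_tonelli2/=; last 2 first.
  - exact/measurable_EFinP.
  - by move=> p; rewrite lee_fin mulr_ge0 ?sqr_ge0 ?gkern_ge0.
  apply: eq_integral => u _; apply: eq_integral => x _.
  rewrite /= cabsM exprMn cabsC ger0_norm ?expR_ge0// /gkern /=.
  by rewrite -expRM_natl; congr (_ * expR _)%:E; field.
rewrite muleA -EFinM bcst_sqr -sqrtrM ?divr_ge0 ?pi_ge0//.
rewrite (_ : 2 / pi * (pi * 2^-1) = 1) ?sqrtr1 ?mul1e//.
by move: (@pi R) (@pi_gt0 R) => P P0; field; rewrite gt_eqF.
Qed.

End isometry.

(** * Polarization in weighted L^2 spaces *)

Section polarization.
Context {R : realType} {d : measure_display} {T : measurableType d}.
Variables (mu : {measure set T -> \bar R}) (w : T -> R).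
Hypotheses (mw : measurable_fun setT w) (w0 : forall x, 0 <= w x).
Implicit Types f g : T -> R[i].

Definition sqint f := mu.-integrable setT (EFin \o (fun x => cabs (f x) ^+ 2 * w x)).

Lemma sqintZ (c : R[i]) f : sqint f -> sqint (fun x => c * f x).
Proof.
move=> hf; have := integrableRZ measurableT (cabs c ^+ 2) hf.
by apply: eq_integrable => // x _ /=; rewrite cabsM exprMn mulrA.
Qed.

Lemma sqintD f g : cmeas setT f -> cmeas setT g -> sqint f -> sqint g ->
  sqint (fun x => f x + g x).
Proof.
move=> mf mg hf hg.
apply: (le_integrableR measurableT _ _ (integrableRZ measurableT 2 (integrableRD measurableT hf hg))).
  by apply: measurable_funM => //; apply: measurable_sqr_cabs; exact: cmeasD.
move=> x _; rewrite ger0_norm ?mulr_ge0 ?sqr_ge0// -mulrDl mulrA ler_wpM2r//.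
exact: cabsD_sqr_le.
Qed.

Lemma sqint_mulJ f g : cmeas setT f -> cmeas setT g -> sqint f -> sqint g ->
  cintegrable mu setT (fun x => f x * (g x)^*%C * (w x)%:C).
Proof.
move=> mf mg hf hg.
apply: (le_cintegrable measurableT _ _ (integrableRD measurableT hf hg)).
  by apply: cmeasM; [apply: cmeasM => //; exact: cmeasJ|exact: cmeasC].
move=> x _; rewrite !cabsM cabsJ cabsC (ger0_norm (w0 x)) -mulrDl ler_wpM2r//.
have := sqr_ge0 (cabs (f x) - cabs (g x)); have := sqr_ge0 (cabs (f x)); have := sqr_ge0 (cabs (g x)).
by lra.
Qed.

Let polar_Re f g : cmeas setT f -> cmeas setT g -> sqint f -> sqint g ->
  \int[mu]_x Re (f x * (g x)^*%C * (w x)%:C) =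
  4^-1 * (\int[mu]_x (cabs (f x + g x) ^+ 2 * w x) - \int[mu]_x (cabs (f x + -1 * g x) ^+ 2 * w x)).
Proof.
move=> mf mg hf hg.
have mNg : cmeas setT (fun x => -1 * g x) by apply: cmeasM => //; exact: cmeas_cst.
have i1 := sqintD mf mg hf hg.
have i2 := sqintD mf mNg hf (sqintZ (-1) hg).
rewrite -(RintegralB measurableT i1 i2) -RintegralZl//; last exact: (integrableB measurableT i1 i2).
apply: eq_Rintegral => x _; rewrite !sqr_cabs !reimE /= mulr0 subr0.
by field.
Qed.

(** The right-hand side contains only square integrals of combinations f + c g, so that a linear
    isometry carries it over term by term. *)
Lemma cintegral_polar f g : cmeas setT f -> cmeas setT g -> sqint f -> sqint g ->
  cintegral mu setT (fun x => f x * (g x)^*%C * (w x)%:C) =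
  (4^-1 * (\int[mu]_x (cabs (f x + g x) ^+ 2 * w x) - \int[mu]_x (cabs (f x + -1 * g x) ^+ 2 * w x))) +i*
  (4^-1 * (\int[mu]_x (cabs (f x + 'i%C * g x) ^+ 2 * w x) -
           \int[mu]_x (cabs (f x + -1 * ('i%C * g x)) ^+ 2 * w x))).
Proof.
move=> mf mg hf hg.
have mig : cmeas setT (fun x => 'i%C * g x) by apply: cmeasM => //; exact: cmeas_cst.
rewrite -(polar_Re mf mg hf hg) -(polar_Re mf mig hf (sqintZ 'i%C hg)).
congr (_ +i* _); apply: eq_Rintegral => x _.
by rewrite !reimE /=; ring.
Qed.

End polarization.

Section bargmann_unitary.
Context {R : realType}.
Local Notation leb := (@lebesgue_measure R).
Local Notation T2 := (measurableTypeR R).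
Implicit Types (h : R -> R[i]) (F : R[i] -> R[i]).

Lemma bargmann_fock h : L2 h -> fock (bargmann h).
Proof.
move=> hL; apply/fockE; split; first exact: (bargmann_entire (L2_wL2 hL)).
by rewrite (bargmann_isometry (L2_wL2 hL)); exact: ((L2P h).1 hL).2.
Qed.

Lemma sqn_eq0 h : cmeas setT h -> sqn h = 0%E -> {ae leb, forall x, h x = 0}.
Proof.
move=> mh hs.
have m1 : measurable_fun setT (fun x : T2 => (cabs (h x) ^+ 2)%:E).
  by apply/measurable_EFinP; exact: measurable_sqr_cabs.
have := (ae_eq_integral_abs leb measurableT m1).1 _.
have -> : (\int[leb]_x `|(cabs (h x) ^+ 2)%:E| = sqn h)%E.
  by apply: eq_integral => x _; rewrite gee0_abs// lee_fin sqr_ge0.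
move=> /(_ hs); apply: ae_imply => x /(_ I) /= [] /eqP.
by rewrite sqrf_eq0 cabs_eq0 => /eqP.
Qed.

Lemma fnorm0 : fnorm (fun=> 0 : R[i]) = 0%E :> \bar R.
Proof.
rewrite /fnorm; under eq_integral do rewrite cabs0 expr0n mul0r.
by rewrite integral0.
Qed.

Lemma bargmann_inj h (g : R -> R[i]) : wL2 h -> wL2 g -> bargmann h = bargmann g ->
  {ae leb, forall x, h x = g x}.
Proof.
move=> hw gw e.
have : {ae leb, forall x, h x - g x = 0}.
  apply: sqn_eq0; first by apply: cmeasB; [exact: hw.1|exact: gw.1].
  rewrite -(bargmann_isometry (wL2B hw gw)) -fnorm0; congr fnorm; apply/funext => z.
  by rewrite (bargmannB z hw gw) e subrr.
by apply: ae_imply => x /eqP; rewrite subr_eq0 => /eqP.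
Qed.

Lemma fock_sqint F : fock F -> sqint area (fun p => gauss (to_C p)) (fun p => F (to_C p)).
Proof.
move=> [eF fF]; apply/integrableP; split.
  apply/measurable_EFinP; apply: measurable_funM; last exact: measurable_gauss.
  exact: (measurable_sqr_cabs (cmeas_entire eF)).
rewrite (_ : (\int[area]_x _)%E = fnorm F)//; apply: eq_integral => p _ /=.
by rewrite ger0_norm// mulr_ge0 ?sqr_ge0 ?gauss_ge0.
Qed.

Lemma bargmann_polar (p q : R -> R[i]) : L2 p -> L2 q ->
  gauss_integrable (fun z => bargmann p z * (bargmann q z)^*%C) /\
  cintegral leb setT (fun x => p x * (q x)^*%C) =
  gauss_integral (fun z => bargmann p z * (bargmann q z)^*%C).
Proof.
move=> hp hq; have [mp _] := (L2P p).1 hp; have [mq _] := (L2P q).1 hq.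
have fp := bargmann_fock hp; have fq := bargmann_fock hq.
have mP := cmeas_entire fp.1; have mQ := cmeas_entire fq.1.
have sP := fock_sqint fp; have sQ := fock_sqint fq.
have g0 (x : T2 * T2) : 0 <= gauss (to_C x) :> R by exact: gauss_ge0.
split; first exact: (sqint_mulJ measurable_gauss g0 mP mQ sP sQ).
have sp h : L2 h -> sqint leb (fun=> 1) h.
  move=> hL; have := sqn_integrable hL.
  by apply: eq_integrable => // x _ /=; rewrite mulr1.
transitivity (cintegral leb setT (fun x => p x * (q x)^*%C * (1 : R)%:C)).
  by apply: eq_cintegral => x _; rewrite mulr1.
have iso c : \int[leb]_x (cabs (p x + c * q x) ^+ 2 * 1) =
    \int[area]_z (cabs (bargmann p (to_C z) + c * bargmann q (to_C z)) ^+ 2 * gauss (to_C z)).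
  have hw := wL2D (L2_wL2 hp) (wL2Z c (L2_wL2 hq)).
  have := bargmann_isometry hw; rewrite /fnorm /sqn /Rintegral => E.
  transitivity (fine (\int[leb]_x (cabs (p x + c * q x) ^+ 2)%:E)).
    by congr fine; apply: eq_integral => x _; rewrite mulr1.
  rewrite -E; congr fine; apply: eq_integral => z _.
  by rewrite (bargmannD _ (L2_wL2 hp) (wL2Z c (L2_wL2 hq))) (bargmannZ _ _ (L2_wL2 hq)).
have iso1 : \int[leb]_x (cabs (p x + q x) ^+ 2 * 1) =
    \int[area]_z (cabs (bargmann p (to_C z) + bargmann q (to_C z)) ^+ 2 * gauss (to_C z)).
  transitivity (\int[leb]_x (cabs (p x + 1 * q x) ^+ 2 * 1)).
    by apply: eq_Rintegral => x _; rewrite mul1r.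
  by rewrite iso; apply: eq_Rintegral => z _; rewrite mul1r.
have isoN : \int[leb]_x (cabs (p x + -1 * ('i%C * q x)) ^+ 2 * 1) =
    \int[area]_z (cabs (bargmann p (to_C z) + -1 * ('i%C * bargmann q (to_C z))) ^+ 2 * gauss (to_C z)).
  have e (c : R[i]) : -1 * ('i%C * c) = -1 * 'i%C * c by rewrite mulrA.
  transitivity (\int[leb]_x (cabs (p x + -1 * 'i%C * q x) ^+ 2 * 1)).
    by apply: eq_Rintegral => x _; rewrite e.
  by rewrite iso; apply: eq_Rintegral => z _; rewrite e.
rewrite (@cintegral_polar R _ T2 leb (fun=> 1) (measurable_cst _) (fun=> ler01) p q mp mq
  (sp _ hp) (sp _ hq)).
rewrite /gauss_integral (cintegral_polar measurable_gauss g0 mP mQ sP sQ).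
by rewrite iso1 isoN !iso.
Qed.

Lemma mpres_rot (c : R[i]) : cabs c = 1 ->
  mpres area ((fun p => (Re c * p.1 - Im c * p.2, Im c * p.1 + Re c * p.2)) : T2 * T2 -> T2 * T2).
Proof. by move=> c1; apply: mpres_rotation; rewrite -sqr_cabs c1 expr1n. Qed.

Lemma to_C_rot (c : R[i]) (p : R * R) :
  to_C (Re c * p.1 - Im c * p.2, Im c * p.1 + Re c * p.2) = c * to_C p.
Proof. by apply: complexP; rewrite !reimE /=; ring. Qed.

Lemma gauss_rot (c z : R[i]) : cabs c = 1 -> gauss (c * z) = gauss z.
Proof. by move=> c1; rewrite /gauss cabsM c1 mul1r. Qed.

Lemma entire_rot (c : R[i]) F : entire F -> entire (fun z => F (c * z)).
Proof.
move=> /entireP eF; apply/entireP => z; have [l hl] := eF (c * z).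
by eexists; apply: (cderiv_comp hl (cderivZ c (cderiv_id z))).
Qed.

Lemma entireZ (c : R[i]) F : entire F -> entire (fun z => c * F z).
Proof.
move=> /entireP eF; apply/entireP => z; have [l hl] := eF z.
by eexists; apply: (cderivZ c hl).
Qed.

Lemma fnorm_rot (c : R[i]) F : cabs c = 1 -> entire F -> fnorm (fun z => F (c * z)) = fnorm F.
Proof.
move=> c1 eF; rewrite /fnorm -((mpres_rot c1).2 (fun p => (cabs (F (to_C p)) ^+ 2 * gauss (to_C p))%:E)).
- by apply: eq_integral => p _; rewrite to_C_rot gauss_rot.
- apply/measurable_EFinP; apply: measurable_funM; last exact: measurable_gauss.
  exact: (measurable_sqr_cabs (cmeas_entire eF)).
- by move=> p; rewrite lee_fin mulr_ge0 ?sqr_ge0 ?gauss_ge0.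
Qed.

Lemma fnormZ (c : R[i]) F : entire F -> fnorm (fun z => c * F z) = ((cabs c ^+ 2)%:E * fnorm F)%E.
Proof.
move=> eF; have m : measurable_fun setT (fun p : T2 * T2 => cabs (F (to_C p)) ^+ 2 * gauss (to_C p)).
  apply: measurable_funM; last exact: measurable_gauss.
  exact: (measurable_sqr_cabs (cmeas_entire eF)).
have p0 (p : T2 * T2) : 0 <= cabs (F (to_C p)) ^+ 2 * gauss (to_C p).
  by apply: mulr_ge0; [exact: sqr_ge0|exact: gauss_ge0].
rewrite /fnorm -(ge0_intZ area measurableT (sqr_ge0 _) m p0).
by apply: eq_integral => p _; rewrite cabsM exprMn -mulrA.
Qed.

Lemma fock_rot (c k : R[i]) F : cabs c = 1 -> fock F -> fock (fun z => k * F (c * z)).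
Proof.
move=> c1 [eF fF]; have er := entire_rot (c := c) eF.
apply/fockE; split; first exact: entireZ.
by rewrite fnormZ// fnorm_rot// lte_mul_pinfty ?lee_fin ?sqr_ge0.
Qed.

Lemma gauss_integral_rot (c : R[i]) (G : R[i] -> R[i]) : cabs c = 1 ->
  gauss_integrable G ->
  gauss_integrable (fun z => G (c * z)) /\
  gauss_integral (fun z => G (c * z)) = gauss_integral G.
Proof.
move=> c1 Gi.
have e : (fun p => G (c * to_C p) * (gauss (to_C p))%:C) = (fun p : T2 * T2 =>
    G (to_C (Re c * p.1 - Im c * p.2, Im c * p.1 + Re c * p.2)) *
    (gauss (to_C (Re c * p.1 - Im c * p.2, Im c * p.1 + Re c * p.2)))%:C).
  by apply/funext => p; rewrite to_C_rot gauss_rot.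
rewrite /gauss_integrable /gauss_integral e; split.
  exact: (mpres_cintegrable (mpres_rot c1) Gi).
exact: (mpres_cintegral (mpres_rot c1) (cintegrable_cmeas Gi)).
Qed.

End bargmann_unitary.

(** * Goursat's theorem and mean values *)

Section goursat.
Context {R : realType}.
Local Notation leb := (@lebesgue_measure R).
Local Notation T2 := (measurableTypeR R).
Implicit Types (G : R[i] -> R[i]) (g : R -> R[i]) (z w h k : R[i]).

Let mI : measurable (`[0, 1]%classic : set T2).
Proof. exact: measurable_itv. Qed.

Lemma ccont_integrable g (a b : R) : ccont g -> cintegrable leb `[a, b] g.
Proof.
move=> [c1 c2]; split.
  apply: (@continuous_compact_integrable R (fun t => Re (g t))); first exact: segment_compact.
  exact: continuous_subspaceT.
apply: (@continuous_compact_integrable R (fun t => Im (g t))); first exact: segment_compact.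
exact: continuous_subspaceT.
Qed.

Lemma Rintegral_cst01 (M : R) : \int[leb]_(t in `[0, 1]) M = M.
Proof.
rewrite Rintegral_cst//= lebesgue_measure_itv/= lte_fin ltr01 sube0 mulr1//.
Qed.

Lemma integrable_cst01 (M : R) : leb.-integrable `[0, 1] (EFin \o (fun=> M)).
Proof.
apply: (@continuous_compact_integrable R (fun=> M)); first exact: segment_compact.
by apply: continuous_subspaceT => x; exact: cvg_cst.
Qed.

Lemma cintegral_cst01 z : cintegral leb `[0, 1] (fun=> z) = z.
Proof. by rewrite /cintegral !Rintegral_cst01; case: z. Qed.

Lemma cabs_cintegral01_le g (M : R) : ccont g ->
  (forall t : R, 0 <= t -> t <= 1 -> cabs (g t) <= M) -> cabs (cintegral leb `[0, 1] g) <= M.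
Proof.
move=> cg gM; rewrite -[leRHS]Rintegral_cst01.
apply: (@cabs_cintegral_le R _ T2 leb _ mI); last exact: integrable_cst01.
  exact: (cmeasT _ (ccont_cmeas cg)).
by move=> t /=; rewrite in_itv/= => /andP[]; exact: gM.
Qed.

Lemma cintegral_halves g : ccont g ->
  cintegral leb `[0, 1] (fun t => g (t / 2)) + cintegral leb `[0, 1] (fun t => g ((t + 1) / 2)) =
  2 * cintegral leb `[0, 1] g.
Proof.
move=> cg; have mg := ccont_cmeas cg.
have h0 : 0 < 2^-1 :> R by rewrite invr_gt0.
pose f (A : set T2) (t : T2) : R[i] := (\1_A t)%:C * g t.
have fi a b : cintegrable leb setT (f `[a, b]%classic).
  exact: ((@cintegrable_indic R _ T2 leb _ g (measurable_itv `[a, b])).1 (ccont_integrable a b cg)).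
have [i1 e1] := cintegral_scale h0 (fi 0 2^-1).
have [i2 e2] := cintegral_scale h0 (fi 2^-1 1).
have c2 : (2^-1)^-1%:C = 2 :> R[i] by rewrite invrK rmorph_nat.
have -> : cintegral leb `[0, 1] (fun t => g (t / 2)) = 2 * cintegral leb setT (f `[0, 2^-1]%classic).
  rewrite -[in RHS]c2 -e1 [LHS]cintegral_indic; apply: eq_cintegral => t _.
  rewrite /f (mulrC t); congr (_%:C * _); rewrite !indicE !mem_setE; congr ((nat_of_bool _)%:R).
  by rewrite !in_itv/= ; apply/idP/idP => /andP[a b]; apply/andP; split; lra.
have -> : cintegral leb `[0, 1] (fun t => g ((t + 1) / 2)) = 2 * cintegral leb setT (f `[2^-1, 1]%classic).
  rewrite -[in RHS]c2 -e2 -(mpres_cintegral (mpres_shift 1) (cintegrable_cmeas i2)).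
  rewrite [LHS]cintegral_indic; apply: eq_cintegral => t _.
  rewrite /f (mulrC (t + 1)); congr (_%:C * _); rewrite !indicE !mem_setE; congr ((nat_of_bool _)%:R).
  by rewrite !in_itv/= ; apply/idP/idP => /andP[a b]; apply/andP; split; lra.
have split01 (t : R) : t != 2^-1 ->
    \1_`[0, 2^-1]%classic t + \1_`[2^-1, 1]%classic t = \1_`[0, 1]%classic t :> R.
  move=> t2; rewrite !indicE !mem_setE -natrD; congr (_%:R); rewrite !in_itv/=.
  have [t0|t0] := leP 0 t; have [t1|t1] := leP t 1; have [t3|t3|t3] := ltgtP t 2^-1 => //=;
    exfalso; (try lra); by rewrite t3 eqxx in t2.
rewrite -mulrDr -(cintegralD measurableT (fi _ _) (fi _ _)); congr (_ * _).
rewrite [RHS]cintegral_indic.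
apply: (@ae_eq_cintegral R _ T2 leb setT measurableT).
- exact: (cintegrable_cmeas (cintegrableD measurableT (fi _ _) (fi _ _))).
- exact: (cintegrable_cmeas (fi 0 1)).
apply: ae_imply (ae_neq 2^-1) => t t2.
by rewrite /f -mulrDl -rmorphD /= split01.
Qed.

(** The contour integral of G along the segment from z to z + w. *)
Definition seg G z w : R[i] := cintegral leb `[0, 1] (fun t => G (z + t%:C * w)) * w.

Lemma seg_double G z w : entire G -> seg G z (2 * w) = seg G z w + seg G (z + w) w.
Proof.
move=> eG; rewrite /seg mulrA (mulrC _ 2) -(cintegral_halves (entire_ccont z (2 * w) eG)) mulrDl.
congr (_ * _ + _ * _); apply: eq_cintegral => t _; congr G.
  by rewrite !castC; field.
by rewrite !castC; field.
Qed.

(* integral along the boundary of the parallelogram spanned by h and k at z *)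
Definition par G z h k := seg G z h + seg G (z + h) k - seg G (z + k) h - seg G z k.

(** A side shared by two of the quarters is run through in opposite directions and cancels. *)
Lemma par_double G z h k : entire G ->
  par G z (2 * h) (2 * k) = par G z h k + par G (z + h) h k + par G (z + k) h k + par G (z + h + k) h k.
Proof.
move=> eG; rewrite /par !(seg_double _ _ eG).
rewrite (_ : z + 2 * h = z + h + h); last by ring.
rewrite (_ : z + 2 * k = z + k + k); last by ring.
rewrite (_ : z + h + k + h = z + h + h + k); last by ring.
rewrite (_ : z + k + h = z + h + k); last by ring.
rewrite (_ : z + k + k + h = z + h + k + k); last by ring.
by ring.
Qed.

Lemma cabs_seg_le G z w (M : R) : entire G ->
  (forall t : R, 0 <= t -> t <= 1 -> cabs (G (z + t%:C * w)) <= M) -> cabs (seg G z w) <= M * cabs w.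
Proof.
move=> eG GM; rewrite cabsM ler_wpM2r//.
exact: (cabs_cintegral01_le (entire_ccont z w eG) GM).
Qed.

Lemma entire_affine (a b : R[i]) : entire (fun z => a + b * z).
Proof.
apply/entireP => z; eexists; apply: cderivD; first exact: cderiv_cst.
by apply: cderivZ; exact: cderiv_id.
Qed.

Lemma entireB G (F : R[i] -> R[i]) : entire G -> entire F -> entire (fun z => G z - F z).
Proof.
move=> /entireP eG /entireP eF; apply/entireP => z.
have [l hl] := eG z; have [m hm] := eF z.
have -> : (fun z => G z - F z) = (fun z => G z + -1 * F z).
  by apply/funext => x; rewrite mulN1r.
by eexists; apply: cderivD; [exact: hl|exact: (cderivZ _ hm)].
Qed.

Lemma parB G (F : R[i] -> R[i]) z h k : entire G -> entire F ->
  par (fun z => G z - F z) z h k = par G z h k - par F z h k.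
Proof.
move=> eG eF.
have e x w : seg (fun z => G z - F z) x w = seg G x w - seg F x w.
  rewrite /seg (cintegralB mI); [by ring| |]; apply: ccont_integrable; exact: entire_ccont.
by rewrite /par !e; ring.
Qed.

Lemma par_affine (a b : R[i]) z h k : par (fun z => a + b * z) z h k = 0.
Proof.
pose t1 := cintegral leb `[0, 1] (fun t : R => t%:C).
have it : cintegrable leb `[0, 1] (fun t : R => t%:C).
  by apply: ccont_integrable; split => x /=; [exact: cvg_id|exact: cvg_cst].
have e x w : seg (fun z => a + b * z) x w = ((a + b * x) + b * w * t1) * w.
  rewrite /seg; congr (_ * _).
  have ic : cintegrable leb `[0, 1] (fun=> a + b * x).
    by apply: ccont_integrable; split => y /=; exact: cvg_cst.
  rewrite -(cintegralZ mI _ it) -[X in X + _]cintegral_cst01.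
  rewrite -(cintegralD mI ic (cintegrableZ mI _ it)).
  by apply: eq_cintegral => t _; ring.
by rewrite /par !e; ring.
Qed.

(** Subtracting the tangent affine map, whose integral vanishes, leaves r(s - z0) (s - z0), at most
    e D on the boundary. There are four sides, each of length at most D. *)
Lemma par_small G z0 l : entire G -> cderiv G z0 l -> forall e : R, 0 < e ->
  exists2 d : R, 0 < d & forall z h k, cabs (z - z0) + cabs h + cabs k < d ->
    cabs (par G z h k) <= 4 * e * (cabs (z - z0) + cabs h + cabs k) ^+ 2.
Proof.
move=> eG [r cr hr] e e0; have [d d0 hd] := cr e e0; exists d => // z h k.
set D := _ + _ => Dd.
have z0_ := cabs_ge0 (z - z0); have h0 := cabs_ge0 h; have k0 := cabs_ge0 k.
pose A z := (G z0 - l * z0) + l * z.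
have eA : entire A by exact: entire_affine.
have -> : par G z h k = par (fun z => G z - A z) z h k.
  by rewrite (parB _ _ _ eG eA) par_affine subr0.
have small s : cabs (s - z0) <= D -> cabs (G s - A s) <= e * D.
  move=> sD; rewrite (_ : G s - A s = r (s - z0) * (s - z0)); last first.
    by have := hr (s - z0); rewrite addrC subrK => ->; rewrite /A; ring.
  by rewrite cabsM ler_pM// hd// (le_lt_trans sD).
have S (x : R[i]) (t : R) : 0 <= t -> t <= 1 -> cabs (x * t%:C) <= cabs x.
  by move=> t0 t1; rewrite cabsM cabsC ger0_norm// ler_piMr.
have bnd x w : cabs (x - z0) + cabs w <= D -> cabs w <= D ->
    cabs (seg (fun z => G z - A z) x w) <= e * D * D.
  move=> xw wD; apply: le_trans (ler_wpM2l _ wD); last by rewrite mulr_ge0 ?(ltW e0)// /D !addr_ge0.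
  apply: (cabs_seg_le (entireB eG eA)) => t t0 t1; apply: small.
  apply: le_trans xw; rewrite (_ : x + _ - z0 = (x - z0) + w * t%:C); last by ring.
  by apply: le_trans (cabsD _ _) _; rewrite lerD2l; exact: S.
have t1 : cabs (z + h - z0) <= cabs (z - z0) + cabs h.
  by rewrite (_ : z + h - z0 = z - z0 + h) ?cabsD//; ring.
have t2 : cabs (z + k - z0) <= cabs (z - z0) + cabs k.
  by rewrite (_ : z + k - z0 = z - z0 + k) ?cabsD//; ring.
have b1 := bnd z h ltac:(rewrite /D; lra) ltac:(rewrite /D; lra).
have b2 := bnd (z + h) k ltac:(rewrite /D; lra) ltac:(rewrite /D; lra).
have b3 := bnd (z + k) h ltac:(rewrite /D; lra) ltac:(rewrite /D; lra).
have b4 := bnd z k ltac:(rewrite /D; lra) ltac:(rewrite /D; lra).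
rewrite /par; apply: le_trans (cabsD _ _) _; rewrite cabsN.
apply: le_trans (lerD (cabsD _ _) (lexx _)) _; rewrite cabsN.
apply: le_trans (lerD (lerD (cabsD _ _) (lexx _)) (lexx _)) _.
by rewrite expr2; lra.
Qed.

Lemma nested_limit (x : nat -> R) : (forall n, x n <= x n.+1 <= x n + 2^-1 ^+ n.+1) ->
  exists l, forall n, x n <= l <= x n + 2^-1 ^+ n.
Proof.
move=> hx.
have half n : 2^-1 ^+ n = 2^-1 ^+ n.+1 + 2^-1 ^+ n.+1 :> R by rewrite (exprS _ n); field.
have up m n : x (n + m)%N <= x n + 2^-1 ^+ n - 2^-1 ^+ (n + m).
  elim: m => [|m ih]; first by rewrite addn0 addrK.
  rewrite addnS; have /andP[_ h] := hx (n + m)%N; move: ih; rewrite (half (n + m)%N).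
  by move: h; move: (2^-1 ^+ (n + m).+1) (2^-1 ^+ n) => u v; lra.
have lo m n : x n <= x (n + m)%N.
  by elim: m => [|m ih]; rewrite ?addn0// addnS (le_trans ih)//; case/andP: (hx (n + m)%N).
have p0 n : 0 <= 2^-1 ^+ n :> R by rewrite exprn_ge0.
have ub n m : x m <= x n + 2^-1 ^+ n.
  have [nm|/ltnW mn] := leqP n m.
    by rewrite -(subnKC nm) (le_trans (up _ _))// gerBl p0.
  by rewrite -(subnKC mn) (le_trans (lo (n - m)%N m))// lerDl p0.
exists (sup (range x)) => n; apply/andP; split.
  apply: ub_le_sup; last by exists n.
  by exists (x 0 + 2^-1 ^+ 0) => _ [m _ <-]; exact: ub.
by apply: ge_sup; [exists (x 0), 0|move=> _ [m _ <-]; exact: ub].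
Qed.

Lemma goursat G z h k : entire G -> par G z h k = 0.
Proof.
move=> eG; apply/eqP; rewrite -cabs_eq0 eq_le cabs_ge0 andbT.
set c := cabs _.
pose s n : R[i] := (2^-1 ^+ n)%:C.
have sS n w : s n * w = 2 * (s n.+1 * w).
  by rewrite /s exprS !castC; field.
(* Corners are tracked by two real coordinates along h and k, so limits are taken in [R] and
   linearly dependent h and k cause no trouble. *)
pose pt (p : R * R) := z + p.1%:C * h + p.2%:C * k.
(* The parallelogram of depth n retains at least the fraction 4^-n of the original integral. *)
pose Q n p := 2^-1 ^+ n ^+ 2 * c <= cabs (par G (pt p) (s n * h) (s n * k)).
pose near n (p q : R * R) := p.1 <= q.1 <= p.1 + 2^-1 ^+ n.+1 /\ p.2 <= q.2 <= p.2 + 2^-1 ^+ n.+1.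
have p0 n : 0 < 2^-1 ^+ n :> R by rewrite exprn_gt0.
(* The four quarters are tried in turn. If all failed, their sum would be too small for
   [par_double]. *)
have step n p : exists q, Q n p -> Q n.+1 q /\ near n p q.
  have [Qp|nQ] := pselect (Q n p); last by exists p.
  pose e : R := 2^-1 ^+ n.+1.
  have e0 : 0 <= e by exact: ltW (p0 n.+1).
  suff [q Qq nq] : exists2 q, Q n.+1 q & near n p q by exists q.
  have [q1|] := boolP (2^-1 ^+ n.+1 ^+ 2 * c <= cabs (par G (pt p) (s n.+1 * h) (s n.+1 * k))).
    by exists p => //; split; rewrite lexx lerDl e0.
  rewrite -ltNge => q1.
  have [q2|] := boolP (2^-1 ^+ n.+1 ^+ 2 * c <= cabs (par G (pt (p.1 + e, p.2)) (s n.+1 * h) (s n.+1 * k))).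
    by exists (p.1 + e, p.2) => //; split; rewrite /= lexx lerDl e0.
  rewrite -ltNge => q2.
  have [q3|] := boolP (2^-1 ^+ n.+1 ^+ 2 * c <= cabs (par G (pt (p.1, p.2 + e)) (s n.+1 * h) (s n.+1 * k))).
    by exists (p.1, p.2 + e) => //; split; rewrite /= ?lexx lerDl e0.
  rewrite -ltNge => q3.
  exists (p.1 + e, p.2 + e); last by split; rewrite /= ?lexx ?lerDl e0.
  rewrite /Q leNgt; apply/negP => q4.
  move: Qp; rewrite /Q !(sS n) (par_double _ _ _ eG) leNgt => /negP; apply.
  have -> : pt p + s n.+1 * h = pt (p.1 + e, p.2) by rewrite /pt /= rmorphD /s /e; ring.
  have -> : pt p + s n.+1 * k = pt (p.1, p.2 + e) by rewrite /pt /= rmorphD /s /e; ring.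
  have -> : pt (p.1 + e, p.2) + s n.+1 * k = pt (p.1 + e, p.2 + e).
    by rewrite /pt /= rmorphD /s /e; ring.
  apply: le_lt_trans (cabsD _ _) _.
  apply: le_lt_trans (lerD (cabsD _ _) (lexx _)) _.
  apply: le_lt_trans (lerD (lerD (cabsD _ _) (lexx _)) (lexx _)) _.
  have -> : 2^-1 ^+ n ^+ 2 * c = 4 * (2^-1 ^+ n.+1 ^+ 2 * c) by rewrite (exprS _ n); field.
  by lra.
have [nx hnx] := choice (fun np : nat * (R * R) => step np.1 np.2).
pose fix st n := if n is m.+1 then nx (m, st m) else (0, 0) : R * R.
have Qst n : Q n (st n).
  elim: n => [|n ih]; last exact: (hnx (n, st n) ih).1.
  by rewrite /Q /pt /s /= !expr0 expr1n !mul1r !mul0r !addr0.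
have nst n : near n (st n) (st n.+1) by exact: (hnx (n, st n) (Qst n)).2.
have [x hx] := nested_limit (fun n => (nst n).1).
have [y hy] := nested_limit (fun n => (nst n).2).
pose z0 := pt (x, y).
have [l hl] := (entireP G).1 eG z0.
pose D := cabs h + cabs k.
have D0 : 0 <= D by rewrite addr_ge0.
have dist n : cabs (pt (st n) - z0) <= 2^-1 ^+ n * D.
  have -> : pt (st n) - z0 = ((st n).1 - x)%:C * h + ((st n).2 - y)%:C * k.
    by rewrite /z0 /pt /= !rmorphB; ring.
  apply: le_trans (cabsD _ _) _; rewrite !cabsM !cabsC mulrDr lerD// ler_wpM2r//.
    by have /andP[a b] := hx n; rewrite distrC ger0_norm ?subr_ge0// lerBlDl.
  by have /andP[a b] := hy n; rewrite distrC ger0_norm ?subr_ge0// lerBlDl.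
have [D_eq0|Dn0] := eqVneq D 0.
  have -> : c = 0.
    have h0 : h = 0 by apply/eqP; rewrite -cabs_eq0 eq_le cabs_ge0 andbT -D_eq0 lerDl.
    have k0 : k = 0 by apply/eqP; rewrite -cabs_eq0 eq_le cabs_ge0 andbT -D_eq0 lerDr.
    by rewrite /c /par /seg h0 k0 !mulr0 !addr0 !subr0 cabs0.
  by [].
have Dp : 0 < D by rewrite lt_neqAle eq_sym Dn0.
apply/ler_addgt0Pl => e e0; rewrite addr0.
(* The 16 compensates the factor 4 of [par_small] and the square of 2 D, twice the total side
   length, so that the bound becomes exactly 4^-n e. *)
have e1 : 0 < e / (16 * D ^+ 2) by rewrite divr_gt0// mulr_gt0// exprn_gt0.
have [d d0 hd] := par_small eG hl e1.
have [n hn] : exists n, 2^-1 ^+ n * (2 * D) < d.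
  have : (fun n => 2^-1 ^+ n * (2 * D)) @ \oo --> (0 : R).
    rewrite -[X in _ --> X](mul0r (2 * D)); apply: cvgM; last exact: cvg_cst.
    by apply: cvg_expr; rewrite ger0_norm// invf_lt1// ltr1n.
  move=> /cvgrPdist_lt /(_ d d0) [n _ /(_ n (leqnn n))]; rewrite /= sub0r normrN => hn.
  by exists n; exact: le_lt_trans (ler_norm _) hn.
have cs w : cabs (s n * w) = 2^-1 ^+ n * cabs w.
  by rewrite cabsM cabsC ger0_norm// ltW.
have Dn : cabs (pt (st n) - z0) + cabs (s n * h) + cabs (s n * k) <= 2^-1 ^+ n * (2 * D).
  by rewrite !cs; have := dist n; rewrite /D; lra.
have := hd _ _ _ (le_lt_trans Dn hn).
set W := _ + cabs (s n * k) in Dn *.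
have W0 : 0 <= W by rewrite !addr_ge0.
move=> bnd; have := le_trans (Qst n) bnd.
have W2 : W ^+ 2 <= (2^-1 ^+ n * (2 * D)) ^+ 2.
  by rewrite ler_pXn2r// nnegrE// mulr_ge0 ?(ltW (p0 _))// mulr_ge0.
move=> h1; have h2 : 2^-1 ^+ n ^+ 2 * c <= 2^-1 ^+ n ^+ 2 * e.
  apply: le_trans h1 _; apply: le_trans (ler_wpM2l _ W2) _.
    by rewrite mulr_ge0// ltW.
  rewrite le_eqVlt; apply/orP; left; apply/eqP; move: (2^-1 ^+ n) => u.
  by field.
by move: h2; rewrite ler_pM2l// exprn_gt0.
Qed.

End goursat.

(** * Circle means and the Gaussian mean value *)

Section mean_value.
Context {R : realType}.
Local Notation leb := (@lebesgue_measure R).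
Local Notation T2 := (measurableTypeR R).
Lemma area_sigma_finite : sigma_finite setT (@area R).
Proof.
have /sigma_finiteP[F [TF ndF Foo]] := sigma_finiteT leb.
exists (fun n => F n `*` F n).
 rewrite -setXTT TF predeqE => -[x y]; split.
    move=> [/= [n _ Fnx] [k _ Gky]]; exists (maxn n k) => //; split.
    - by move: x Fnx; exact/subsetPset/ndF/leq_maxl.
    - by move: y Gky; exact/subsetPset/ndF/leq_maxr.
  by move=> [n _ []/= ? ?]; split; exists n.
move=> k; have [? ?] := Foo k.
split; first exact: measurableX.
rewrite [ltLHS](@product_measure1E _ _ T2 T2 R leb leb (F k) (F k))//.
by rewrite lte_mul_pinfty// ge0_fin_numE.
Qed.

(* The library has no canonical structure of sigma-finite measure on products. *)
Definition sf_area : {sigma_finite_measure set (T2 * T2)%type -> \bar R} :=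
  HB.pack_for {sigma_finite_measure set (T2 * T2)%type -> \bar R} (Measure.sort (@area R))
    (Measure_isSigmaFinite.Build _ _ _ (@area R) area_sigma_finite).

Implicit Types (F G : R[i] -> R[i]) (z w : R[i]).

Let tau : R[i] := 'i%C * (2 * pi)%:C.

Let cexp_tau : cexp tau = 1.
Proof. by rewrite cexp_i mulr_natl cos2pi sin2pi. Qed.

Let entire_expline F z : entire F -> entire (fun s => F (cexp s * z)).
Proof.
move=> /entireP eF; apply/entireP => s; have [l hl] := eF (cexp s * z).
eexists; apply: (cderiv_comp (g := fun s => cexp s * z) hl); rewrite (_ : (fun x => cexp x * z) = (fun x => z * cexp x)).
  by apply: cderivZ; exact: cderiv_cexp.
by apply/funext => x; rewrite mulrC.
Qed.

Let exp_lt (e : R) : 0 < e -> exists n : nat, expR (- n%:R) < e.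
Proof.
move=> e0; pose n := Num.truncn e^-1; exists n.+1.
have h1 : e^-1 < n.+1%:R by exact: (truncnS_gt e^-1).
rewrite expRN -[ltRHS]invrK ltf_pV2 ?posrE ?expR_gt0 ?invr_gt0//.
by rewrite (lt_le_trans h1)// (le_trans _ (expR_ge1Dx _))// lerDr.
Qed.

(** The function F(e^s z) has period 2 pi i. In Goursat's theorem for the rectangle with sides n and
    2 pi i at -n, the horizontal sides cancel by periodicity, so the mean over the circle of radius
    |z| equals the mean over radius e^-n |z|. Continuity at 0 finishes. *)
Lemma circle_mean F z : entire F ->
  cintegral leb `[0, 1] (fun t => F (cexp (t%:C * tau) * z)) = F 0.
Proof.
move=> eF; pose G s := F (cexp s * z).
have eG : entire G by exact: entire_expline.
have per s : G (s + tau) = G s by rewrite /G cexpD cexp_tau mulr1.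
have tau0 : tau != 0.
  by rewrite -cabs_gt0 cabsM cabsi mul1r cabsC normr_gt0 mulf_neq0// gt_eqF// pi_gt0.
set I := cintegral _ _ _.
have shift (n : nat) : cintegral leb `[0, 1] (fun t => G (- n%:R + t%:C * tau)) = I.
  have := goursat (- n%:R) n%:R tau eG; rewrite /par addNr.
  have -> : seg G (- n%:R + tau) n%:R = seg G (- n%:R) n%:R.
    by rewrite /seg; congr (_ * _); apply: eq_cintegral => t _; rewrite addrAC per.
  rewrite (addrC (seg G _ _)) addrK => /eqP; rewrite subr_eq0 => /eqP /(mulIf tau0) <-.
  by apply: eq_cintegral => t _; rewrite /G add0r.
apply/eqP; rewrite -subr_eq0 -cabs_eq0 eq_le cabs_ge0 andbT.
apply/ler_addgt0Pl => e e0; rewrite addr0.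
have [l hl] := (entireP F).1 eF 0.
have [d d0 hd] := cderiv_cont hl e0.
have z1 : 0 < cabs z + 1 by rewrite ltr_wpDl.
have [n hn] := exp_lt (divr_gt0 d0 z1).
have line := entire_ccont (- n%:R) tau eG.
have lineB : ccont (fun t : R => G (- n%:R + t%:C * tau) - F 0).
  have := entire_ccont (- n%:R) tau (entireB eG (@entire_affine R (F 0) 0)).
  by congr ccont; apply/funext => t; rewrite mul0r addr0.
have cst : ccont (fun _ : R => F 0) by split => x; exact: cvg_cst.
rewrite -(shift n) -[X in _ - X]cintegral_cst01.
have mI : measurable (`[0, 1]%classic : set T2) by exact: measurable_itv.
rewrite -(cintegralB mI (ccont_integrable 0 1 line) (ccont_integrable 0 1 cst)).
apply: (cabs_cintegral01_le lineB) => t t0 t1.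
have := hd (cexp (- n%:R + t%:C * tau) * z); rewrite add0r; apply.
rewrite cabsM cabs_cexp.
have -> : Re (- n%:R + t%:C * tau) = - n%:R.
  by rewrite natrC !reimE /=; ring.
rewrite (@le_lt_trans _ _ (expR (- n%:R) * (cabs z + 1)))//.
  by rewrite ler_wpM2l ?expR_ge0// lerDl.
by rewrite -ltr_pdivlMr.
Qed.

Lemma gauss_integrable1 : gauss_integrable (fun=> 1 : R[i]).
Proof.
have g0 (x : R) := expR_ge0 (- x ^+ 2).
have ip := integrableRZ measurableT pi^-1
  (@integrable_prodM R _ _ T2 T2 leb leb _ _ g0 g0 (@integrable_gauss R) (@integrable_gauss R)).
apply: (le_cintegrable measurableT _ _ ip).
- by apply: cmeasM; [exact: cmeas_cst|apply: cmeasC; exact: measurable_gauss].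
- by move=> p _; rewrite mul1r cabsC ger0_norm ?gauss_ge0// gauss_to_C.
Qed.

Lemma gauss_integral1 : gauss_integral (fun=> 1 : R[i]) = 1.
Proof.
have g0 (x : R) := expR_ge0 (- x ^+ 2).
have iprod := @integrable_prodM R _ _ T2 T2 leb leb _ _ g0 g0 (@integrable_gauss R) (@integrable_gauss R).
have slice (x : R) : leb.-integrable setT (fun y : T2 => (expR (- x ^+ 2) * expR (- y ^+ 2))%:E).
  by have := integrableRZ (@measurableT _ T2) (expR (- x ^+ 2)) (@integrable_gauss R).
have [_ e] := Rfubini1 iprod slice.
rewrite /gauss_integral; transitivity (cintegral area setT (fun p : T2 * T2 =>
    (pi^-1 * (expR (- p.1 ^+ 2) * expR (- p.2 ^+ 2)))%:C)).
  by apply: eq_cintegral => p _; rewrite mul1r gauss_to_C.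
rewrite cintegralC (RintegralZl _ measurableT iprod) -e /=.
transitivity ((pi^-1 * \int[leb]_x (Num.sqrt pi * expR (- x ^+ 2)))%:C : R[i]).
  congr (_ * _)%:C; apply: eq_Rintegral => x _.
  by rewrite (RintegralZl _ (@measurableT _ T2) (@integrable_gauss R)) Rintegral_gauss mulrC.
rewrite (RintegralZl _ (@measurableT _ T2) (@integrable_gauss R)) Rintegral_gauss.
by rewrite -expr2 sqr_sqrtr ?pi_ge0// mulVf// gt_eqF// pi_gt0.
Qed.

Lemma gauss_integralZ (c : R[i]) F : gauss_integrable F ->
  gauss_integrable (fun z => c * F z) /\
  gauss_integral (fun z => c * F z) = c * gauss_integral F.
Proof.
move=> Fi; split.
  by apply: (eq_cintegrable measurableT _ (cintegrableZ measurableT c Fi)) => p _; rewrite mulrA.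
rewrite -(cintegralZ measurableT c Fi); apply: eq_cintegral => p _; exact/esym/mulrA.
Qed.

(** The Gaussian measure is invariant under rotations. Averaging over them and exchanging the
    integrals replaces F by its circle means, all equal to F 0. *)
Lemma gauss_mean F : entire F -> gauss_integrable F -> gauss_integral F = F 0.
Proof.
move=> eF Fi.
pose a (t : R) := cexp (t%:C * tau).
have a1 t : cabs (a t) = 1.
  by rewrite cabs_cexp (_ : Re _ = 0) ?expR0// !reimE /=; ring.
pose H (x : T2 * (T2 * T2)) : R[i] :=
  (\1_`[0, 1]%classic x.1)%:C * (F (a x.1 * to_C x.2) * (gauss (to_C x.2))%:C).
have ma : cmeas setT a by rewrite /a; cmeas_tac.
have mH : cmeas setT H.
  apply: cmeasM.
    exact: (cmeas_comp measurable_fst (cmeas_indic (measurable_itv `[0, 1]))).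
  apply: cmeasM; last exact: (cmeas_comp measurable_snd (cmeasC measurable_gauss)).
  have e : (fun x : T2 * (T2 * T2) => F (a x.1 * to_C x.2)) = (fun x => F (to_C
      ((fun x : T2 * (T2 * T2) => (Re (a x.1) * x.2.1 - Im (a x.1) * x.2.2,
        Im (a x.1) * x.2.1 + Re (a x.1) * x.2.2) : T2 * T2) x))).
    by apply/funext => x; rewrite to_C_rot.
  rewrite e; apply: (cmeas_comp _ (cmeas_entire eF)).
  have m1 := measurableT_comp ma.1 (@measurable_fst _ _ T2 (T2 * T2)%type).
  have m2 := measurableT_comp ma.2 (@measurable_fst _ _ T2 (T2 * T2)%type).
  have m3 := measurableT_comp (@measurable_fst _ _ T2 T2) (@measurable_snd _ _ T2 (T2 * T2)%type).
  have m4 := measurableT_comp (@measurable_snd _ _ T2 T2) (@measurable_snd _ _ T2 (T2 * T2)%type).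
  apply: measurable_fun_pair.
    exact: measurable_funB (measurable_funM m1 m3) (measurable_funM m2 m4).
  exact: measurable_funD (measurable_funM m2 m3) (measurable_funM m1 m4).
have rot t := gauss_integral_rot (a1 t) Fi.
have H2 t : cintegrable sf_area setT (fun p => H (t, p)).
  change (cintegrable area setT (fun p : T2 * T2 =>
    (\1_`[0, 1]%classic t)%:C * (F (a t * to_C p) * (gauss (to_C p))%:C))).
  exact: (cintegrableZ measurableT _ (rot t).1).
have K1 z : cintegrable leb setT (fun t => (\1_`[0, 1]%classic t)%:C * F (a t * z)).
  have cont : ccont (fun t => F (a t * z)).
    have := entire_ccont 0 tau (@entire_expline F z eF).
    by congr ccont; apply/funext => t; rewrite add0r.
  exact: ((@cintegrable_indic R _ T2 leb _ _ (measurable_itv `[0, 1])).1 (ccont_integrable 0 1 cont)).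
have H1 p : cintegrable leb setT (fun t => H (t, p)).
  have := cintegrableZ (@measurableT _ T2) (gauss (to_C p))%:C (K1 (to_C p)).
  by apply: (eq_cintegrable (@measurableT _ T2)) => t _; rewrite /H /=; ring.
(* Rotated copies of F admit no evident common bound, so integrability on the product comes from
   Tonelli: by rotation invariance every slice has the same norm [N], cut off by the indicator. *)
have iH : cintegrable (leb \x sf_area)%E setT H.
  apply: (@cintegrableP R _ (T2 * (T2 * T2))%type (leb \x sf_area)%E setT measurableT H mH).2.
  rewrite fubini_tonelli1/=; last 2 first.
  - by apply/measurable_EFinP; exact: measurable_cabs.
  - by move=> x; rewrite lee_fin; exact: cabs_ge0.
  pose N := (\int[area]_p (cabs (F (to_C p) * (gauss (to_C p))%:C))%:E)%E.
  have N0 : (0 <= N)%E by apply: integral_ge0 => p _; rewrite lee_fin.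
  have Nfin : (N < +oo)%E by exact: ((@cintegrableP R _ (T2 * T2)%type area setT measurableT _ (cintegrable_cmeas Fi)).1 Fi).
  have e t : fubini_F sf_area (fun x => (cabs (H x))%:E) t = (N * (\1_`[0, 1]%classic t)%:E)%E.
    rewrite /fubini_F muleC.
    rewrite /N -((mpres_rot (a1 t)).2 (fun p => (cabs (F (to_C p) * (gauss (to_C p))%:C))%:E)); last 2 first.
    - by apply/measurable_EFinP; exact: (measurable_cabs (cintegrable_cmeas Fi)).
    - by move=> p; rewrite lee_fin.
    rewrite -(ge0_intZ area measurableT (indic_ge0 _ _)); last 2 first.
    - apply: (eq_measurable_fun (fun p => cabs (F (a t * to_C p) * (gauss (to_C p))%:C))).
        by move=> p _; rewrite to_C_rot gauss_rot.
      exact: (measurable_cabs (cintegrable_cmeas (rot t).1)).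
    - by move=> p; exact: cabs_ge0.
    apply: eq_integral => p _; rewrite to_C_rot gauss_rot//.
    by rewrite /H /= cabsM cabsC ger0_norm ?indic_ge0.
  have mi : measurable_fun setT (fun t : T2 => (\1_`[0, 1]%classic t : R)).
    exact: (measurable_indic (measurable_itv `[0, 1])).
  rewrite (_ : (\int[leb]_t _)%E = (N * \int[leb]_t (\1_`[0, 1]%classic t)%:E)%E).
    by rewrite integral_indic// setIT/= lebesgue_measure_itv/= lte_fin ltr01 sube0 mule1.
  rewrite -(ge0_integralZl leb measurableT ((measurable_EFinP _ _).2 mi) _ N0).
    by apply: eq_integral => t _; exact: e.
  by move=> t _; rewrite lee_fin indic_ge0.
have := cfubini iH H2 H1.
have -> : cintegral leb setT (fun t => cintegral sf_area setT (fun p => H (t, p))) = gauss_integral F.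
  transitivity (cintegral leb setT (fun t => (\1_`[0, 1]%classic t)%:C * gauss_integral F)).
    apply: eq_cintegral => t _; rewrite /H /= (cintegralZ measurableT _ (rot t).1).
    by congr (_ * _); exact: (rot t).2.
  by rewrite -cintegral_indic cintegral_cst01.
move=> ->; transitivity (cintegral area setT (fun p => F 0 * (1 * (gauss (to_C p))%:C))).
  apply: eq_cintegral => p _; rewrite /H /= mul1r.
  transitivity (cintegral leb setT (fun t => (gauss (to_C p))%:C * ((\1_`[0, 1]%classic t)%:C *
     F (cexp (t%:C * tau) * to_C p)))).
    by apply: eq_cintegral => t _; rewrite /a; ring.
  rewrite (cintegralZ (@measurableT _ T2) _ (K1 (to_C p))).
  by rewrite -[X in _ * X]cintegral_indic (circle_mean _ eF) mulrC.
by rewrite (cintegralZ measurableT _ gauss_integrable1) -[X in _ * X]/(gauss_integral (fun=> 1)) gauss_integral1 mulr1.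
Qed.

End mean_value.

(** * The Bargmann transform is onto *)

Section coherent_states.
Context {R : realType}.
Local Notation leb := (@lebesgue_measure R).
Local Notation T2 := (measurableTypeR R).
Implicit Types (F : R[i] -> R[i]) (z w : R[i]).

Lemma bkerJ w (x : R) : (bker w x)^*%C = bker w^*%C x.
Proof.
rewrite /bker cexpJ; congr cexp.
by apply: complexP; rewrite ?expr2 !reimE /= ?natrC ?complexn; field.
Qed.

Lemma L2_gauss_exp (K : R) : L2 (fun x : R => (expR (K * `|x| - x ^+ 2))%:C).
Proof.
have i : leb.-integrable setT (EFin \o (fun x => cabs (expR (K * `|x| - x ^+ 2))%:C ^+ 2)).
  have := @integrable_gauss_exp R 2 (2 * K) (ltr0Sn R 1).
  apply: eq_integrable => // x _; congr EFin.
  by rewrite cabsC (ger0_norm (expR_ge0 _)) -expRM_natl; congr expR; ring.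
apply/L2P; split; first by cmeas_tac.
rewrite /sqn; have := integrable_lty measurableT i.
by apply: le_lt_trans; rewrite le_eqVlt eqxx.
Qed.

Lemma L2_bker w : L2 (bker w).
Proof.
apply: (@L2_bound R _ (fun x => (expR (2 * cabs w * `|x| - x ^+ 2))%:C) (expR (cabs w ^+ 2 / 2))).
- exact: cmeas_bker.
- by move=> x; rewrite cabsC ger0_norm ?expR_ge0//; exact: cabs_bker_le.
- exact: L2_gauss_exp.
Qed.

(** A Gaussian integral with p = 2, whose value sqrt (pi / 2) is cancelled by [bcst ^+ 2]. The
    kernels of the transform are thus sent to the reproducing kernels of the Fock space. *)
Lemma bargmann_bker w z : bargmann (fun x => bcst%:C * bker w x) z = cexp (z * w).
Proof.
rewrite bargmannE.
have [i e] := cintegral_rgauss_lin (z + w) (ltr0Sn R 1).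
transitivity (bcst%:C * cintegral leb setT (fun x : R => bcst%:C * cexp (- (z ^+ 2 / 2) - w ^+ 2 / 2) *
    cexp (2 * (z + w) * x%:C - 2%:R%:C * x%:C ^+ 2))).
  congr (_ * _); apply: eq_cintegral => x _; rewrite /bker -!mulrA -!cexpD complexn.
  by congr (_ * cexp _); field.
rewrite (cintegralZ measurableT _ i) e.
rewrite (_ : bcst%:C * _ = (bcst ^+ 2 * Num.sqrt (pi / 2))%:C *
  (cexp (- (z ^+ 2 / 2) - w ^+ 2 / 2) * cexp ((z + w) ^+ 2 / 2%:R%:C))); last by rewrite castC; ring.
rewrite bcst_sqr -sqrtrM ?divr_ge0 ?pi_ge0//.
rewrite (_ : 2 / pi * (pi / 2) = 1); last first.
  by move: (@pi R) (@pi_gt0 R) => P P0; field; rewrite gt_eqF.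
by rewrite sqrtr1 mul1r -cexpD complexn; congr cexp; field.
Qed.

Lemma fock_cexp w : fock (fun z => cexp (z * w)).
Proof.
have := bargmann_fock (L2Z bcst%:C (L2_bker w)).
by congr fock; apply/funext => z; exact: bargmann_bker.
Qed.

Lemma gauss_shift z w : cexp (- (z * w^*%C)) * (gauss z)%:C =
  cexp (w * (z + w)^*%C) * (gauss (z + w))%:C.
Proof.
rewrite /gauss !sqr_cabs !castC [RHS]mulrCA [LHS]mulrCA -!cexpC -!cexpD; congr (_ * cexp _).
by apply: complexP; rewrite ?castC ?expr2 !reimE /=; ring.
Qed.

(** Translating the integral by w, [gauss_shift] turns the integrand into the entire function F(z +
    w) exp (- z conj w), whose Gaussian mean is its value F w at 0. *)
Lemma reproducing F w : fock F ->
  gauss_integrable (fun z => F z * cexp (w * z^*%C)) /\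
  gauss_integral (fun z => F z * cexp (w * z^*%C)) = F w.
Proof.
move=> fF; have [eF _] := fF.
have fE := fock_cexp w^*%C.
have g0 (x : T2 * T2) : 0 <= gauss (to_C x) :> R by exact: gauss_ge0.
have Gi : gauss_integrable (fun z => F z * cexp (w * z^*%C)).
  have := sqint_mulJ measurable_gauss g0 (cmeas_entire eF) (cmeas_entire fE.1)
    (fock_sqint fF) (fock_sqint fE).
  apply: (eq_cintegrable measurableT) => p _; cbv beta.
  by rewrite cexpJ; congr (_ * cexp _ * _); apply: complexP; rewrite !reimE /=; ring.
split => //.
pose G z := F (z + w) * cexp (z * - w^*%C).
have eG : entire G.
  apply/entireP => z; have [l hl] := (entireP F).1 eF (z + w).
  eexists; apply: cderivM.
    apply: (cderiv_comp (g := fun z => z + w) hl).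
    by apply: cderivD; [exact: cderiv_id|exact: cderiv_cst].
  rewrite (_ : (fun x => cexp (x * _)) = (fun x => cexp (- w^*%C * x))).
    exact: cexp_entire_scale.
  by apply/funext => x; rewrite mulrC.
have tr (p : R * R) : to_C (p.1 + Re w, p.2 + Im w) = to_C p + w.
  by apply: complexP; rewrite !reimE.
have e : (fun p : T2 * T2 => G (to_C p) * (gauss (to_C p))%:C) =
    (fun p : T2 * T2 => (fun q : T2 * T2 => F (to_C q) * cexp (w * (to_C q)^*%C) * (gauss (to_C q))%:C)
      (p.1 + Re w, p.2 + Im w)).
  by apply/funext => p; rewrite tr /G mulrN -!mulrA gauss_shift.
have mp := mpres_translation (Re w) (Im w).
have Gi' : gauss_integrable G.
  by rewrite /gauss_integrable e; exact: (mpres_cintegrable mp Gi).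
have <- : G 0 = F w by rewrite /G add0r mul0r cexp0 mulr1.
rewrite -(gauss_mean eG Gi') /gauss_integral e; apply/esym; exact: (mpres_cintegral mp (cintegrable_cmeas Gi)).
Qed.

End coherent_states.

(** * The adjoint of the Bargmann transform on truncated functions *)

Section adjoint.
Context {R : realType}.
Local Notation leb := (@lebesgue_measure R).
Local Notation T2 := (measurableTypeR R).
Implicit Types (F G : R[i] -> R[i]) (h : R -> R[i]) (z w : R[i]).

(** Bounded with bounded support: on the support the kernels obey one Gaussian bound in x, which
    makes [adj] and all exchanges of integrals absolutely convergent. *)
Definition tame F := cmeas setT (fun p : T2 * T2 => F (to_C p)) /\
  exists M r : R, forall z, cabs (F z) <= M /\ (r < cabs z -> F z = 0).

Lemma tameB F G : tame F -> tame G -> tame (fun z => F z - G z).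
Proof.
move=> [mF [M [r hF]]] [mG [N [s hG]]]; split; first exact: cmeasB.
exists (M + N), (Num.max r s) => z; have [F1 F2] := hF z; have [G1 G2] := hG z; split.
  by rewrite (le_trans (cabsD _ _))// cabsN lerD.
by rewrite gt_max => /andP[/F2 -> /G2 ->]; rewrite subrr.
Qed.

(* the adjoint of the Bargmann transform *)
Definition adj F (x : R) : R[i] := gauss_integral (fun z => F z * (bcst%:C * bker z^*%C x)).

Let v (r x : R) : R := expR (r ^+ 2 / 2) * expR (2 * r * `|x| - x ^+ 2).

Let tame_bound F : tame F -> exists M r : R, [/\ 0 <= M, 0 <= r &
  forall z x, cabs (F z * (bcst%:C * bker z^*%C x)) <= M * v r x].
Proof.
move=> [_ [M [r hF]]].
have M0 : 0 <= M by apply: le_trans (hF 0).1; exact: cabs_ge0.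
exists (M * bcst), (Num.max r 0); rewrite mulr_ge0 ?(ltW bcst_gt0)// le_max lexx orbT; split => // z x.
have [F1 F2] := hF z.
have v0 s y : 0 <= v s y by rewrite mulr_ge0 ?expR_ge0.
have [rz|rz] := ltP r (cabs z); first by rewrite F2// mul0r cabs0 !mulr_ge0 ?(ltW bcst_gt0).
rewrite !cabsM cabsC (ger0_norm (ltW bcst_gt0)) mulrA.
have b0 := ltW (@bcst_gt0 R).
apply: ler_pM; [by rewrite mulr_ge0|exact: cabs_ge0|by rewrite ler_wpM2r|].
apply: le_trans (cabs_bker_le _ _) _; rewrite cabsJ.
have zr : cabs z <= Num.max r 0 by rewrite le_max rz.
apply: ler_pM; rewrite ?expR_ge0// ler_expR.
  by rewrite ler_wpM2r// ler_pXn2r// nnegrE// le_max lexx orbT.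
by rewrite lerB// ler_wpM2r// ler_wpM2l.
Qed.

Let integrable_v r h : wL2 h -> leb.-integrable setT (EFin \o (fun x => cabs (h x) * v r x)).
Proof.
move=> hw; have := integrableRZ measurableT (expR (r ^+ 2 / 2)) (wL2_exp (2 * r) hw).
by apply: (@eq_integrable _ T2 R leb setT measurableT) => x _ /=; rewrite /v mulrCA.
Qed.

Let integrable_gauss_area : (@area R).-integrable setT (EFin \o (fun p : T2 * T2 => gauss (to_C p))).
Proof.
have := (@gauss_integrable1 R).1; apply: eq_integrable => // p _.
by rewrite mul1r.
Qed.

Let cmeas_bkerJ (x : R) : cmeas setT (fun p : T2 * T2 => bker (to_C p)^*%C x).
Proof.
have mz : cmeas setT (fun p : T2 * T2 => (to_C p)^*%C).
  by apply: cmeasJ; apply: cmeas_pair; [exact: measurable_fst|exact: measurable_snd].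
apply: cmeas_cexp; apply: cmeasB; last by apply: cmeasM; [exact: cmeasX|exact: cmeas_cst].
by apply: cmeasB; [apply: cmeasM => //; exact: cmeas_cst|exact: cmeas_cst].
Qed.

(** Fubini. The pairing is bilinear, without conjugation, which explains why the transform of h is
    taken at the conjugate point. Admitting h in [wL2] allows a pairing with constants. *)
Lemma adj_pair F h : tame F -> wL2 h ->
  cintegrable leb setT (fun x => h x * adj F x) /\
  cintegral leb setT (fun x => h x * adj F x) = gauss_integral (fun z => F z * bargmann h z^*%C).
Proof.
move=> tF hw; have [M [r [M0 r0 FM]]] := tame_bound tF.
pose K (q : T2 * (T2 * T2)) : R[i] := h q.1 *
  (F (to_C q.2) * (bcst%:C * bker (to_C q.2)^*%C q.1) * (gauss (to_C q.2))%:C).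
have m2 := @measurable_snd _ _ T2 (T2 * T2)%type.
have m1 := @measurable_fst _ _ T2 (T2 * T2)%type.
have mz : cmeas setT (fun q : T2 * (T2 * T2) => (to_C q.2)^*%C).
  apply: cmeasJ; apply: cmeas_pair.
    exact: (measurableT_comp (@measurable_fst _ _ T2 T2) m2).
  exact: (measurableT_comp (@measurable_snd _ _ T2 T2) m2).
have mk : cmeas setT (fun q : T2 * (T2 * T2) => bker (to_C q.2)^*%C q.1).
  apply: cmeas_cexp; apply: cmeasB; last by apply: cmeasM; [exact: cmeasX|exact: cmeas_cst].
  apply: cmeasB; last exact: (cmeasX _ (cmeasC m1)).
  apply: cmeasM => //; apply: cmeasM; [exact: cmeas_cst|exact: (cmeasC m1)].
have mK : cmeas setT K.
  apply: cmeasM; first exact: (cmeas_comp m1 hw.1).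
  apply: cmeasM; last exact: (cmeas_comp m2 (cmeasC measurable_gauss)).
  apply: cmeasM; first exact: (cmeas_comp m2 tF.1).
  by apply: cmeasM; [exact: cmeas_cst|exact: mk].
have A0 x : 0 <= cabs (h x) * v r x by rewrite mulr_ge0// mulr_ge0 ?expR_ge0.
have B0 (p : T2 * T2) : 0 <= M * gauss (to_C p) by rewrite mulr_ge0 ?gauss_ge0.
have iB := integrableRZ measurableT M integrable_gauss_area.
have KAB x p : cabs (K (x, p)) <= (cabs (h x) * v r x) * (M * gauss (to_C p)).
  rewrite /K /= cabsM -[leRHS]mulrA; apply: ler_wpM2l; first exact: cabs_ge0.
  rewrite cabsM cabsC (ger0_norm (gauss_ge0 _)) [leRHS]mulrCA [leRHS]mulrA; apply: ler_wpM2r; first exact: gauss_ge0.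
  exact: FM.
have [iK s2 s1 iK1 e] := @cfubini_bound R _ _ T2 (T2 * T2)%type leb sf_area K _ _ mK A0 B0
  (integrable_v r hw) iB KAB.
have adjE x : cintegral sf_area setT (fun p => K (x, p)) = h x * adj F x.
  rewrite /adj /gauss_integral /K /=.
  apply: (@cintegralZ R _ (T2 * T2)%type area setT measurableT).
  apply: (@le_cintegrable R _ (T2 * T2)%type area setT measurableT _
    (fun p => v r x * (M * gauss (to_C p)))).
  - apply: cmeasM; last exact: cmeasC measurable_gauss.
    apply: cmeasM; first exact: tF.1.
    by apply: cmeasM; [exact: cmeas_cst|exact: cmeas_bkerJ].
  - move=> p _; rewrite cabsM cabsC (ger0_norm (gauss_ge0 _)) [leRHS]mulrA; apply: ler_wpM2r; first exact: gauss_ge0.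
    by rewrite [leRHS]mulrC; exact: FM.
  - exact: (integrableRZ measurableT (v r x) iB).
have adjf : (fun x => cintegral sf_area setT (fun p => K (x, p))) = (fun x => h x * adj F x).
  by apply/funext => x; exact: adjE.
move: iK1 e; rewrite adjf => iK1 ->; split => //.
apply: eq_cintegral => p _; rewrite bargmannE /K /=.
transitivity (cintegral leb setT (fun x => (F (to_C p) * (gauss (to_C p))%:C * bcst%:C) *
   (h x * bker (to_C p)^*%C x))).
  by apply: eq_cintegral => x _; ring.
by rewrite (cintegralZ (@measurableT _ T2) _ (integrable_bker _ hw)); ring.
Qed.

(** Pairing with the constant 1, which lies in [wL2], makes [adj F] an integrable inner integral and
    hence measurable. *)
Lemma cmeas_adj F : tame F -> cmeas setT (adj F).
Proof.
move=> tF; have h1 : wL2 (fun _ : R => 1 : R[i]).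
  by apply: (@bounded_wL2 _ _ 1) => [|x]; [exact: cmeas_cst|rewrite cabs1].
have := cintegrable_cmeas (adj_pair tF h1).1.
by apply: eq_cmeas => x; rewrite mul1r.
Qed.

Lemma L2_adj F : tame F -> L2 (adj F).
Proof.
move=> tF; have [M [r [M0 r0 FM]]] := tame_bound tF.
apply: (@L2_bound R _ (fun x => (expR (2 * r * `|x| - x ^+ 2))%:C) (M * expR (r ^+ 2 / 2))).
- exact: cmeas_adj.
- move=> x; rewrite cabsC ger0_norm ?expR_ge0// -[leRHS]mulrA -/(v r x).
  have ig := integrableRZ measurableT (M * v r x) integrable_gauss_area.
  have := @cabs_cintegral_le R _ (T2 * T2)%type area setT measurableT
    (fun p => F (to_C p) * (bcst%:C * bker (to_C p)^*%C x) * (gauss (to_C p))%:C)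
    (fun p => M * v r x * gauss (to_C p)) _ _ ig.
  rewrite (RintegralZl _ measurableT integrable_gauss_area).
  have -> : \int[area]_p gauss (to_C p) = 1 :> R.
    have := congr1 (fun z => Re z) (@gauss_integral1 R) => /= <-.
    by apply: eq_Rintegral => p _; rewrite mul1r mul0r subr0.
  rewrite mulr1; apply.
  + apply: cmeasM; last exact: cmeasC measurable_gauss.
    apply: cmeasM; first exact: tF.1.
    by apply: cmeasM; [exact: cmeas_cst|exact: cmeas_bkerJ].
  + move=> p _; rewrite cabsM cabsC (ger0_norm (gauss_ge0 _)); apply: ler_wpM2r; first exact: gauss_ge0.
    exact: FM.
- exact: L2_gauss_exp.
Qed.

Lemma bargmannJ h z : wL2 h -> bargmann (fun x => (h x)^*%C) z^*%C = (bargmann h z)^*%C.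
Proof.
move=> hw.
have JM (a b : R[i]) : (a * b)^*%C = a^*%C * b^*%C by apply: complexP; rewrite !reimE; ring.
rewrite !bargmannE JM; congr (_ * _); first by apply: complexP; rewrite ?reimE /= ?oppr0.
rewrite -(cintegralJ measurableT (integrable_bker z hw)); apply: eq_cintegral => x _.
by rewrite JM bkerJ.
Qed.

Lemma sqint_tame F : tame F -> sqint area (fun p => gauss (to_C p)) (fun p => F (to_C p)).
Proof.
move=> [mF [M [r hF]]].
refine (@le_integrableR R _ _ area setT measurableT _ (fun p => M ^+ 2 * gauss (to_C p)) _ _ _).
- by apply: measurable_funM; [exact: measurable_sqr_cabs|exact: measurable_gauss].
- move=> p _; rewrite ger0_norm; last by apply: mulr_ge0; [exact: sqr_ge0|exact: gauss_ge0].
  apply: ler_wpM2r; first exact: gauss_ge0.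
  rewrite ler_pXn2r ?nnegrE ?cabs_ge0//; first exact: (hF _).1.
  by apply: le_trans (hF 0).1; exact: cabs_ge0.
- exact: (integrableRZ measurableT (M ^+ 2) integrable_gauss_area).
Qed.

Lemma sqint_fnorm F : sqint area (fun p => gauss (to_C p)) (fun p => F (to_C p)) ->
  fnorm F = (\int[area]_p (cabs (F (to_C p)) ^+ 2 * gauss (to_C p)))%:E.
Proof. by move=> i; rewrite /Rintegral fineK//; exact: (integrable_fin_num measurableT i). Qed.

(* |adj F|^2 = <F, B (adj F)> <= |F| |adj F| *)
Lemma sqn_adj_le F : tame F -> (sqn (adj F) <= fnorm F)%E.
Proof.
move=> tF; have gL := L2_adj tF; have gw := L2_wL2 gL; have mg := cmeas_adj tF.
have fB := bargmann_fock gL; have sB := fock_sqint fB; have sF := sqint_tame tF.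
have eN := bargmann_isometry gw; rewrite (sqint_fnorm sF).
move: eN; rewrite (sqint_fnorm sB) (sqnE gL) => -[eN]; rewrite lee_fin.
set N := \int[leb]_x _ in eN *; set S := \int[area]_p _.
have Jw : wL2 (fun x => (adj F x)^*%C).
  split; first exact: cmeasJ.
  by apply: eq_integrable gw.2 => // x _; congr EFin; rewrite cabsJ.
have [_ e] := adj_pair tF Jw.
have eL : cintegral leb setT (fun x => (adj F x)^*%C * adj F x) = N%:C.
  by rewrite /N -cintegralC; apply: eq_cintegral => x _; rewrite mulrC mulJ.
have mB := cmeas_entire fB.1.
have iS := @integrableRZ R _ (T2 * T2)%type area setT measurableT 2^-1 _
  (@integrableRD R _ (T2 * T2)%type area setT measurableT _ _ sF sB).
have := @cabs_cintegral_le R _ (T2 * T2)%type area setT measurableT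
  (fun p => F (to_C p) * (bargmann (adj F) (to_C p))^*%C * (gauss (to_C p))%:C) _ _ _ iS.
rewrite (RintegralZl _ measurableT (@integrableRD R _ (T2 * T2)%type area setT measurableT _ _ sF sB)).
rewrite (RintegralD measurableT sF sB) eN -/S.
have -> : cintegral area setT (fun p => F (to_C p) * (bargmann (adj F) (to_C p))^*%C * (gauss (to_C p))%:C) = N%:C.
  rewrite -eL e /gauss_integral; apply: eq_cintegral => p _.
  by rewrite (bargmannJ _ gw).
(* The inequality ab <= (a^2 + b^2) / 2 takes the place of Cauchy-Schwarz. Both norms being finite,
   N <= (S + N) / 2 gives N <= S. *)
move=> H; have : N <= 2^-1 * (S + N).
  apply: le_trans (ler_norm N) _; rewrite -cabsC; apply: H.
    by apply: cmeasM; [apply: cmeasM; [exact: tF.1|exact: cmeasJ]|exact: cmeasC measurable_gauss].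
  move=> p _; rewrite 2!cabsM cabsJ cabsC (ger0_norm (gauss_ge0 _)) -mulrDl mulrA.
  apply: ler_wpM2r; first exact: gauss_ge0.
  have := sqr_ge0 (cabs (F (to_C p)) - cabs (bargmann (adj F) (to_C p))).
  by move: (cabs (F _)) (cabs (bargmann _ _)) => a b; lra.
lra.
Qed.

Lemma adjB F G x : tame F -> tame G -> adj (fun z => F z - G z) x = adj F x - adj G x.
Proof.
move=> tF tG.
have adj_int H : tame H -> gauss_integrable (fun z => H z * (bcst%:C * bker z^*%C x)).
  move=> tH; have [M [r [M0 r0 HM]]] := tame_bound tH.
  apply: (@le_cintegrable R _ (T2 * T2)%type area setT measurableT _
    (fun p => M * v r x * gauss (to_C p))).
  - apply: cmeasM; last exact: cmeasC measurable_gauss.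
    apply: cmeasM; first exact: tH.1.
    by apply: cmeasM; [exact: cmeas_cst|exact: cmeas_bkerJ].
  - move=> p _; rewrite cabsM cabsC (ger0_norm (gauss_ge0 _)); apply: ler_wpM2r; first exact: gauss_ge0.
    exact: HM.
  - exact: (integrableRZ measurableT (M * v r x) integrable_gauss_area).
rewrite /adj /gauss_integral -(cintegralB measurableT (adj_int _ tF) (adj_int _ tG)).
by apply: eq_cintegral => p _; rewrite -mulrBl -mulrBl.
Qed.

End adjoint.

(** * Completeness of L^2 for rapidly converging sequences *)

Section completeness.
Context {R : realType}.
Local Notation leb := (@lebesgue_measure R).
Local Notation T2 := (measurableTypeR R).

(** After subtracting K 2^-n and dividing by 2K, the sequence grows by an amount between 0 and 2^-(n
    + 1) at each step, as [nested_limit] requires. *)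
Lemma geometric_limit (u : nat -> R) (K : R) : 0 <= K ->
  (forall n, `|u n.+1 - u n| <= K * 2^-1 ^+ n.+1) ->
  exists l, forall n, `|u n - l| <= K * 2^-1 ^+ n.
Proof.
rewrite le_eqVlt => /predU1P[<-|K0] hu.
  have u0 n : u n = u 0%N.
    elim: n => // n <-; apply/eqP; rewrite -subr_eq0 -normr_le0.
    by rewrite (le_trans (hu n))// mul0r.
  by exists (u 0%N) => n; rewrite u0 subrr normr0 mul0r.
have half n : 2^-1 ^+ n = 2 * 2^-1 ^+ n.+1 :> R by rewrite (exprS _ n); field.
have K2 : K * 2 != 0 by rewrite mulf_neq0// gt_eqF.
have [n|l hl] := @nested_limit R (fun n => (u n - K * 2^-1 ^+ n) / (K * 2)).
  have K2p : 0 < K * 2 by rewrite mulr_gt0.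
  have := hu n; rewrite ler_norml => /andP[h1 h2].
  rewrite ler_pM2r ?invr_gt0// ler_pdivrMr// mulrDl divfK// (half n).
  by move: h1 h2; move: (2^-1 ^+ n.+1) => t h1 h2; apply/andP; split; lra.
exists (l * (K * 2)) => n; have /andP[] := hl n.
have K2p : 0 < K * 2 by rewrite mulr_gt0.
rewrite ler_pdivrMr// => h1.
rewrite -(ler_pM2r K2p) mulrDl divfK// => h2.
rewrite ler_norml; move: h1 h2; move: (2^-1 ^+ n) => t h1 h2.
by apply/andP; split; lra.
Qed.

Lemma cgeometric_limit (u : nat -> R[i]) (K : R) : 0 <= K ->
  (forall n, cabs (u n.+1 - u n) <= K * 2^-1 ^+ n.+1) ->
  exists l, forall n, cabs (u n - l) ^+ 2 <= 2 * (K * 2^-1 ^+ n) ^+ 2.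
Proof.
move=> K0 hu.
have [n|a ha] := geometric_limit (u := fun n => Re (u n)) K0.
  by apply: le_trans (hu n); apply: le_trans (abs_Re _); rewrite cReD cReN.
have [n|b hb] := geometric_limit (u := fun n => Im (u n)) K0.
  by apply: le_trans (hu n); apply: le_trans (abs_Im _); rewrite cImD cImN.
exists (a +i* b) => n; rewrite sqr_cabs !reimE /= mulr_natl mulr2n.
have Kn : 0 <= K * 2^-1 ^+ n by rewrite mulr_ge0 ?exprn_ge0.
by apply: lerD; rewrite -[leLHS]real_normK ?num_real// ler_pXn2r ?nnegrE.
Qed.

(** The Riesz-Fischer argument. The series H of 4^k |g (k + 1) - g k|^2 has integral at most the sum
    of the 2^-k, that is 2. Where H is finite the increments are at most sqrt H 2^-k, so g k
    converges with squared error at most 8 4^-k H; integrating gives the 16. *)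
Lemma L2_fast_limit (g : nat -> R -> R[i]) : (forall k, L2 (g k)) ->
  (forall k, sqn (fun x => (g k.+1 x - g k x)%R) <= (8^-1 ^+ k)%:E)%E ->
  exists G, L2 G /\ forall k, (sqn (fun x => (g k x - G x)%R) <= (16 * 4^-1 ^+ k)%:E)%E.
Proof.
move=> gL gfast.
have mg k : cmeas setT (g k : T2 -> R[i]) by exact: ((L2P _).1 (gL k)).1.
pose h k (x : T2) := 4 ^+ k * cabs (g k.+1 x - g k x) ^+ 2.
have h0 k x : 0 <= h k x by rewrite mulr_ge0 ?sqr_ge0 ?exprn_ge0.
have mh k : measurable_fun setT (h k).
  apply: measurable_funM; first exact: measurable_cst.
  by apply: measurable_sqr_cabs; exact: cmeasB.
pose H (x : T2) := (\sum_(k <oo) (h k x)%:E)%E.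
have H0 x : (0 <= H x)%E by apply: nneseries_ge0 => k _ _; rewrite lee_fin; exact: h0.
have mH : measurable_fun setT H.
  apply: ge0_emeasurable_sum => [k x _ _|k _]; first by rewrite lee_fin; exact: h0.
  exact/measurable_EFinP.
have hH k x : ((h k x)%:E <= H x)%E.
  have := @nneseries_lim_ge R (fun k => (h k x)%:E) xpredT 0 k.+1 (fun k _ _ => h0 k x).
  apply: le_trans; rewrite big_nat_recr//= leeDr// sume_ge0// => i _.
  by rewrite lee_fin; exact: h0.
have intH : (\int[leb]_x H x <= 2%:E)%E.
  rewrite integral_nneseries//; last 2 first.
  - by move=> k; exact/measurable_EFinP.
  - by move=> k x _; rewrite lee_fin; exact: h0.
  have i0 k : (0 <= \int[leb]_x (h k x)%:E)%E by apply: integral_ge0 => x _; rewrite lee_fin; exact: h0.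
  apply: lime_le; first by apply: is_cvg_nneseries => k _ _; exact: i0.
  apply: nearW => n.
  apply: (@le_trans _ _ (\sum_(0 <= k < n) (2^-1 ^+ k : R)%:E)%E).
    apply: lee_sum => k _; rewrite /h.
    rewrite (ge0_intZ leb measurableT (exprn_ge0 k _) (measurable_sqr_cabs (cmeasB (mg _) (mg _))));
      [|by []|by move=> x; exact: sqr_ge0].
    have -> : 2^-1 ^+ k = 4 ^+ k * 8^-1 ^+ k :> R.
      by rewrite -exprMn; congr (_ ^+ k); field.
    by rewrite EFinM lee_wpmul2l ?lee_fin ?exprn_ge0//; exact: gfast.
  rewrite sumEFin lee_fin.
  have -> : \sum_(0 <= k < n) 2^-1 ^+ k = 2 * (1 - 2^-1 ^+ n) :> R.
    elim: n => [|n ih]; first by rewrite big_nil expr0 subrr mulr0.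
    by rewrite big_nat_recr//= ih (exprS _ n); field.
  by have : 0 <= 2^-1 ^+ n :> R; [rewrite exprn_ge0|lra].
pose A : set T2 := [set x | H x \is a fin_num].
have mA : measurable A by rewrite -[A]setTI; exact: emeasurable_fin_num.
(* The value 0 where H is infinite makes the limit the pointwise limit everywhere of the measurable
   functions [\1_A] times [g k]. *)
have lim x : exists l : R[i], (H x \is a fin_num ->
    forall k, cabs (g k x - l) ^+ 2 <= 8 * 4^-1 ^+ k * fine (H x)) /\ (~ H x \is a fin_num -> l = 0).
  have [fH|nH] := pselect (H x \is a fin_num); last by exists 0.
  have f0 : 0 <= fine (H x) by rewrite fine_ge0.
  have [n|l hl] := cgeometric_limit (u := fun n => g n x) (mulr_ge0 (ler0n R 2) (sqrtr_ge0 (fine (H x)))).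
    rewrite -(@ler_pXn2r _ 2)// ?nnegrE ?mulr_ge0 ?sqrtr_ge0 ?exprn_ge0//.
    rewrite (exprS _ n) !exprMn sqr_sqrtr//.
    have := hH n x; rewrite -(fineK fH) lee_fin /h => hn.
    rewrite -(ler_pM2l (exprn_gt0 n (ltr0Sn R 3))); apply: le_trans hn _.
    rewrite (_ : _ * _ = (4 ^+ n * 2^-1 ^+ n ^+ 2) * fine (H x)); last by field.
    by rewrite -exprM mulnC exprM -exprMn (_ : 4 * 2^-1 ^+ 2 = 1) ?expr1n ?mul1r//; field.
  exists l; split => // _ k; apply: le_trans (hl k) _.
  rewrite !exprMn sqr_sqrtr// -(exprM _ k) mulnC (exprM _ _ k) (_ : 2^-1 ^+ 2 = 4^-1); last by field.
  by rewrite le_eqVlt; apply/orP; left; apply/eqP; ring.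
have [G hG] := choice lim.
have mG : cmeas setT (G : T2 -> R[i]).
  have c x : ccvg (fun k => (\1_A x)%:C * g k x) (G x).
    rewrite indicE; have [xA|xA] := boolP (x \in A); last first.
      rewrite (hG x).2; last by move=> fx; rewrite notin_setE in xA; exact: xA.
      by rewrite /ccvg; under eq_fun do rewrite mul0r subr0 cabs0; exact: cvg_cst.
    rewrite inE in xA; have := (hG x).1 xA => hk.
    apply: (@ccvg_le _ _ _ (fun k => Num.sqrt (8 * fine (H x)) * 2^-1 ^+ k)) => [k|].
      rewrite mul1r -(@ler_pXn2r _ 2)// ?nnegrE ?mulr_ge0 ?sqrtr_ge0 ?exprn_ge0//.
      apply: le_trans (hk k) _; rewrite exprMn sqr_sqrtr ?mulr_ge0 ?fine_ge0//.
      rewrite -exprM mulnC exprM (_ : 2^-1 ^+ 2 = 4^-1); last by field.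
      by rewrite le_eqVlt; apply/orP; left; apply/eqP; ring.
    rewrite -[X in _ --> X](mulr0 (Num.sqrt (8 * fine (H x)))); apply: cvgM; first exact: cvg_cst.
    by apply: cvg_expr; rewrite ger0_norm// invf_lt1// ltr1n.
  have mgA k : cmeas setT (fun x : T2 => (\1_A x)%:C * g k x).
    by apply: cmeasM; [exact: cmeas_indic|exact: mg].
  split.
    by apply: (measurable_fun_cvg (fun k => (mgA k).1)) => x _; exact: ((ccvgP _ _).1 (c x)).1.
  by apply: (measurable_fun_cvg (fun k => (mgA k).2)) => x _; exact: ((ccvgP _ _).1 (c x)).2.
have bnd k : (sqn (fun x => (g k x - G x)%R) <= (16 * 4^-1 ^+ k)%:E)%E.
  apply: (@le_trans _ _ ((8 * 4^-1 ^+ k)%:E * \int[leb]_x H x)%E); last first.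
    rewrite (_ : 16 * 4^-1 ^+ k = 8 * 4^-1 ^+ k * 2); last by ring.
    by rewrite [leRHS]EFinM lee_wpmul2l// lee_fin mulr_ge0 ?exprn_ge0.
  have c0 : 0 < 8 * 4^-1 ^+ k :> R by rewrite mulr_gt0 ?exprn_gt0.
  rewrite /sqn -(ge0_integralZl leb measurableT mH (fun x _ => H0 x)); last by rewrite lee_fin ltW.
  apply: ge0_le_integral => //.
  - by move=> x _; rewrite lee_fin sqr_ge0.
  - by apply/measurable_EFinP; apply: measurable_sqr_cabs; exact: cmeasB.
  - by apply: emeasurable_funM => //.
  (* Where H is infinite the bound holds because its right-hand side is infinite too. *)
  move=> x _; have [fH|nH] := boolP (H x \is a fin_num).
    by rewrite -(fineK fH) -EFinM lee_fin; exact: (hG x).1.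
  have -> : H x = +oo%E by move: nH (H0 x); case: (H x).
  by rewrite gt0_muley ?lte_fin ?leey.
exists G; split => //; apply/L2P; split => //.
have -> : G = fun x => g 0%N x + -1 * (g 0%N x - G x) by apply/funext => x; ring.
have mgG := cmeasB (mg 0%N) mG.
have m1 : cmeas setT (fun x => -1 * (g 0%N x - G x)) by apply: cmeasM; [exact: cmeas_cst|exact: mgG].
apply: (le_lt_trans (sqnD_le (mg 0%N) m1)).
rewrite lte_mul_pinfty// lte_add_pinfty//; first exact: ((L2P _).1 (gL 0%N)).2.
rewrite (sqnZ _ mgG) lte_mul_pinfty ?lee_fin ?sqr_ge0//.
by rewrite (le_lt_trans (bnd 0%N)) ?ltry.
Qed.

End completeness.

(** * Surjectivity by approximation *)

Section surjectivity.
Context {R : realType}.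
Local Notation leb := (@lebesgue_measure R).
Local Notation T2 := (measurableTypeR R).
Implicit Types (F G : R[i] -> R[i]) (h : R -> R[i]) (z w : R[i]).

Let mgw := @measurable_gauss R.

(** The inequality 2ab <= l b^2 + a^2 / l with a free weight l replaces Cauchy-Schwarz: a small l
    balanced against a smaller norm of h makes the value at w small. *)
Lemma cabs_bargmann_le h w (l : R) : L2 h -> 0 < l ->
  cabs (bargmann h w) <= bcst * (2^-1 * (l * \int[leb]_x cabs (bker w x) ^+ 2 +
    l^-1 * \int[leb]_x cabs (h x) ^+ 2)).
Proof.
move=> hL l0; have ih := sqn_integrable hL; have ib := sqn_integrable (L2_bker w).
have ih' := integrableRZ (@measurableT _ T2) l^-1 ih.
have ib' := integrableRZ (@measurableT _ T2) l ib.
have isum := integrableRZ (@measurableT _ T2) 2^-1 (integrableRD (@measurableT _ T2) ib' ih').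
rewrite bargmannE cabsM cabsC (ger0_norm (ltW bcst_gt0)) ler_wpM2l ?(ltW bcst_gt0)//.
rewrite -(RintegralZl _ (@measurableT _ T2) ib) -(RintegralZl _ (@measurableT _ T2) ih).
rewrite -(RintegralD (@measurableT _ T2) ib' ih').
rewrite -(RintegralZl _ (@measurableT _ T2) (integrableRD (@measurableT _ T2) ib' ih')).
apply: (@cabs_cintegral_le R _ T2 leb setT measurableT _ _ _ _ isum).
  by apply: cmeasM; [exact: (L2_wL2 hL).1|exact: cmeas_bker].
move=> x _; rewrite cabsM; have := cabs_ge0 (h x).
move: (cabs (h x)) (cabs (bker w x)) => a b a0.
have := mulr_ge0 (ltW l0) (sqr_ge0 (b - l^-1 * a)).
have -> : l * (b - l^-1 * a) ^+ 2 = l * b ^+ 2 - 2 * (a * b) + l^-1 * a ^+ 2 by field; rewrite gt_eqF.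
by move: (l * b ^+ 2) (l^-1 * a ^+ 2) (a * b) => x1 x2 x3; lra.
Qed.

Lemma bargmann_adj F w : tame F ->
  bargmann (adj F) w = gauss_integral (fun z => F z * cexp (w * z^*%C)).
Proof.
move=> tF; have bL := L2Z bcst%:C (L2_bker w).
have [_ e] := adj_pair tF (L2_wL2 bL).
rewrite bargmannE -(cintegralZ (@measurableT _ T2) _ (integrable_bker w (L2_wL2 (L2_adj tF)))).
transitivity (cintegral leb setT (fun x => bcst%:C * bker w x * adj F x)).
  by apply: eq_cintegral => x _; ring.
by rewrite e; apply: eq_cintegral => p _; rewrite bargmann_bker mulrC (mulrC w) mulrC.
Qed.

(** Cutting off the value as well as the argument gives boundedness at once, with no compactness
    argument. *)
Definition trunc F (n : nat) z : R[i] :=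
  if (cabs z <= n%:R) && (cabs (F z) <= n%:R) then F z else 0.

Lemma tame_trunc F n : entire F -> tame (trunc F n).
Proof.
move=> eF; have mF := cmeas_entire eF.
have mc : cmeas setT (fun p : T2 * T2 => to_C p).
  by apply: cmeas_pair; [exact: measurable_fst|exact: measurable_snd].
split.
  have mb : measurable_fun setT (fun p : T2 * T2 => (cabs (to_C p) <= n%:R) && (cabs (F (to_C p)) <= n%:R)).
    apply: measurable_and; apply: measurable_fun_ler; try exact: measurable_cst.
      exact: (measurable_cabs mc).
    exact: (measurable_cabs mF).
  split.
    rewrite (_ : (fun p => _) = (fun p : T2 * T2 => if (cabs (to_C p) <= n%:R) && (cabs (F (to_C p)) <= n%:R)
        then Re (F (to_C p)) else 0)).
      by apply: (measurable_fun_ifT mb); [exact: mF.1|exact: measurable_cst].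
    by apply/funext => p; rewrite /trunc; case: ifP.
  rewrite (_ : (fun p => _) = (fun p : T2 * T2 => if (cabs (to_C p) <= n%:R) && (cabs (F (to_C p)) <= n%:R)
      then Im (F (to_C p)) else 0)).
    by apply: (measurable_fun_ifT mb); [exact: mF.2|exact: measurable_cst].
  by apply/funext => p; rewrite /trunc; case: ifP.
exists n%:R, n%:R => z; rewrite /trunc; split.
  by case: ifP => [/andP[]//|_]; rewrite cabs0.
by rewrite ltNge => /negbTE ->.
Qed.

Lemma trunc_eventually F z : exists N, forall n, (N <= n)%N -> trunc F n z = F z.
Proof.
pose r := Num.max (cabs z) (cabs (F z)).
exists (Num.truncn r).+1 => n Nn.
have rn : r <= n%:R.
  by apply: le_trans (ltW (truncnS_gt r)) _; rewrite ler_nat.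
have := rn; rewrite ge_max => /andP[h1 h2].
by rewrite /trunc h1 h2.
Qed.

Lemma cabs_trunc F n z : cabs (trunc F n z) <= cabs (F z).
Proof. by rewrite /trunc; case: ifP => // _; rewrite cabs0. Qed.

Lemma fnorm_trunc F (e : R) : fock F -> 0 < e ->
  exists N, forall n, (N <= n)%N -> (fnorm (fun z => (trunc F n z - F z)%R) <= e%:E)%E.
Proof.
move=> fF e0; have [eF _] := fF; have mF := cmeas_entire eF; have sF := fock_sqint fF.
have mT n : cmeas setT (fun p : T2 * T2 => trunc F n (to_C p) - F (to_C p)).
  exact: (cmeasB (tame_trunc n eF).1 mF).
have le n z : cabs (trunc F n z - F z) ^+ 2 <= cabs (F z) ^+ 2.
  rewrite /trunc; case: ifP => _; first by rewrite subrr cabs0 expr0n sqr_ge0.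
  by rewrite sub0r cabsN.
pose f_ n (p : T2 * T2) : R[i] := (cabs (trunc F n (to_C p) - F (to_C p)) ^+ 2 * gauss (to_C p))%:C.
have mf_ n : cmeas setT (f_ n).
  apply: cmeasC; apply: measurable_funM; last exact: mgw.
  exact: (measurable_sqr_cabs (mT n)).
have lim p : setT p -> ccvg (f_^~ p) 0.
  move=> _; have [N hN] := trunc_eventually F (to_C p).
  rewrite /ccvg; apply: cvg_near_cst; exists N => // n Nn.
  by rewrite /f_ (hN n Nn) subrr cabs0 expr0n mul0r subr0 cabs0.
have bnd n p : setT p -> cabs (f_ n p) <= cabs (F (to_C p)) ^+ 2 * gauss (to_C p).
  move=> _; rewrite cabsC ger0_norm; last by apply: mulr_ge0; [exact: sqr_ge0|exact: gauss_ge0].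
  by apply: ler_wpM2r; [exact: gauss_ge0|exact: le].
have [_] := @cdominated_cvg R _ (T2 * T2)%type area setT measurableT f_ (fun=> 0) _ mf_ lim sF bnd.
rewrite cintegral0 /ccvg => /cvgrPdist_le /(_ _ e0) [N _ hN].
exists N => n /hN; rewrite sub0r normrN subr0 (ger0_norm (cabs_ge0 _)).
have sT : sqint area (fun p => gauss (to_C p)) (fun p => trunc F n (to_C p) - F (to_C p)).
  apply: (@le_integrableR R _ (T2 * T2)%type area setT measurableT _ _ _ _ sF).
    by apply: measurable_funM; [exact: (measurable_sqr_cabs (mT n))|exact: mgw].
  move=> p _; rewrite ger0_norm; last by apply: mulr_ge0; [exact: sqr_ge0|exact: gauss_ge0].
  by apply: ler_wpM2r; [exact: gauss_ge0|exact: le].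
rewrite (sqint_fnorm (F := fun z => trunc F n z - F z) sT) lee_fin.
rewrite /f_ cintegralC cabsC; exact: le_trans (ler_norm _).
Qed.

Lemma fnormB_le F G (K : R[i] -> R[i]) :
  cmeas setT (fun p : T2 * T2 => F (to_C p)) -> cmeas setT (fun p : T2 * T2 => G (to_C p)) ->
  cmeas setT (fun p : T2 * T2 => K (to_C p)) ->
  (fnorm (fun z => (F z - G z)%R) <= 2%:E * (fnorm (fun z => (F z - K z)%R) + fnorm (fun z => (G z - K z)%R)))%E.
Proof.
move=> mF mG mK.
have m (A B : R[i] -> R[i]) : cmeas setT (fun p : T2 * T2 => A (to_C p)) ->
    cmeas setT (fun p : T2 * T2 => B (to_C p)) ->
    measurable_fun setT (fun p : T2 * T2 => cabs (A (to_C p) - B (to_C p)) ^+ 2 * gauss (to_C p)).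
  move=> mA mB; apply: measurable_funM; last exact: mgw.
  exact: (measurable_sqr_cabs (cmeasB mA mB)).
have p0 (A : R[i] -> R[i]) (p : T2 * T2) : 0 <= cabs (A (to_C p)) ^+ 2 * gauss (to_C p).
  by apply: mulr_ge0; [exact: sqr_ge0|exact: gauss_ge0].
rewrite /fnorm -(ge0_intD area measurableT (m _ _ mF mK) (m _ _ mG mK)
  (p0 (fun z => F z - K z)) (p0 (fun z => G z - K z))).
rewrite -(ge0_intZ area measurableT (ler0n R 2)).
- apply: (ge0_int_le area measurableT (m _ _ mF mG)).
  + by apply: measurable_funM; [exact: measurable_cst|apply: measurable_funD; exact: m].
  + exact: (p0 (fun z => F z - G z)).
  + move=> p; rewrite -mulrDl mulrA; apply: ler_wpM2r; first exact: gauss_ge0.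
    rewrite (_ : F (to_C p) - G (to_C p) = (F (to_C p) - K (to_C p)) + - (G (to_C p) - K (to_C p))); last by ring.
    by apply: le_trans (cabsD_sqr_le _ _) _; rewrite cabsN.
- by apply: measurable_funD; exact: m.
- by move=> p; apply: addr_ge0; [exact: (p0 (fun z => F z - K z))|exact: (p0 (fun z => G z - K z))].
Qed.

Lemma bargmann_surj F : fock F -> exists g, L2 g /\ bargmann g = F.
Proof.
move=> fF; have [eF _] := fF; have mF := cmeas_entire eF.
(* The exponent k + 1 ensures 2 (8^-(k + 2) + 8^-(k + 1)) <= 8^-k, the rate asked by
   [L2_fast_limit]; k <= n makes the chosen truncations converge pointwise. *)
have ex k : exists n, (k <= n)%N /\ (fnorm (fun z => (trunc F n z - F z)%R) <= (8^-1 ^+ k.+1)%:E)%E.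
  have [|N hN] := @fnorm_trunc F (8^-1 ^+ k.+1) fF; first by rewrite exprn_gt0.
  by exists (maxn k N); split; [exact: leq_maxl|apply: hN; exact: leq_maxr].
have [nk hnk] := choice ex.
pose Fk k := trunc F (nk k).
have tFk k : tame (Fk k) by exact: tame_trunc.
pose g k := adj (Fk k).
have gL k : L2 (g k) by exact: L2_adj.
have fast k : (sqn (fun x => (g k.+1 x - g k x)%R) <= (8^-1 ^+ k)%:E)%E.
  have -> : (fun x => g k.+1 x - g k x) = adj (fun z => Fk k.+1 z - Fk k z).
    by apply/funext => x; rewrite adjB.
  apply: le_trans (sqn_adj_le (tameB (tFk _) (tFk _))) _.
  apply: le_trans (fnormB_le (tFk _).1 (tFk _).1 mF) _.
  have h1 := (hnk k.+1).2; have h2 := (hnk k).2.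
  apply: (@le_trans _ _ (2%:E * ((8^-1 ^+ k.+2)%:E + (8^-1 ^+ k.+1)%:E))%E).
    by rewrite lee_wpmul2l// leeD.
  rewrite -EFinD -EFinM lee_fin !(exprS _ k.+1) !(exprS _ k).
  by have : 0 <= 8^-1 ^+ k :> R; [rewrite exprn_ge0|lra].
have [G [GL hG]] := L2_fast_limit gL fast.
exists G; split => //; apply/funext => w.
have gw k := L2_wL2 (gL k); have Gw := L2_wL2 GL.
(* The values at w have two limits: [bargmann G w], by convergence in L^2, and the reproducing
   integral of F, by dominated convergence of the truncations. *)
apply: (@ccvg_unique R (fun k => bargmann (g k) w)).
  pose C := \int[leb]_x cabs (bker w x) ^+ 2.
  (* The weight l = 2^-k balances l C against the term 16 4^-k / l, so that both are of order
     2^-k. *)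
  apply: (@ccvg_le _ _ _ (fun k => (bcst * (2^-1 * (C + 16))) * 2^-1 ^+ k)) => [k|]; last first.
    rewrite -[X in _ --> X](mulr0 (bcst * (2^-1 * (C + 16)))); apply: cvgM; first exact: cvg_cst.
    by apply: cvg_expr; rewrite ger0_norm// invf_lt1// ltr1n.
  rewrite -(bargmannB w (gw k) Gw).
  have dL := L2B (gL k) GL.
  have l0 : 0 < 2^-1 ^+ k :> R by rewrite exprn_gt0.
  apply: le_trans (cabs_bargmann_le w dL l0) _.
  have := hG k; rewrite (sqnE dL) lee_fin => hk.
  rewrite -[leRHS]mulrA; apply: ler_wpM2l; first exact: ltW bcst_gt0.
  rewrite -[leRHS]mulrA; apply: ler_wpM2l => //.
  rewrite mulrDl mulrC -/C lerD2l -(ler_pM2l l0) mulrA divff ?gt_eqF// mul1r.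
  apply: le_trans hk _; rewrite mulrCA -exprMn (_ : 2^-1 * 2^-1 = 4^-1)//.
  by field.
have [Gi <-] := reproducing w fF.
have mE : cmeas setT (fun p : T2 * T2 => cexp (w * (to_C p)^*%C)).
  apply: cmeas_cexp; apply: cmeasM; first exact: cmeas_cst.
  by apply: cmeasJ; apply: cmeas_pair; [exact: measurable_fst|exact: measurable_snd].
pose f_ k (p : T2 * T2) := Fk k (to_C p) * cexp (w * (to_C p)^*%C) * (gauss (to_C p))%:C.
have mf_ k : cmeas setT (f_ k).
  by apply: cmeasM; [apply: cmeasM; [exact: (tFk k).1|exact: mE]|exact: cmeasC mgw].
have lim p : setT p -> ccvg (f_^~ p) (F (to_C p) * cexp (w * (to_C p)^*%C) * (gauss (to_C p))%:C).
  move=> _; have [N hN] := trunc_eventually F (to_C p).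
  rewrite /ccvg; apply: cvg_near_cst; exists N => // n Nn.
  by rewrite /f_ /Fk (hN _ (leq_trans Nn (hnk n).1)) subrr cabs0.
have bnd k p : setT p -> cabs (f_ k p) <= cabs (F (to_C p) * cexp (w * (to_C p)^*%C) * (gauss (to_C p))%:C).
  move=> _; rewrite /f_ !(cabsM _ (gauss _)%:C) !(cabsM _ (cexp _)).
  by apply: ler_wpM2r; [exact: cabs_ge0|apply: ler_wpM2r; [exact: cabs_ge0|exact: cabs_trunc]].
have [_] := @cdominated_cvg R _ (T2 * T2)%type area setT measurableT f_ _ _ mf_ lim
  (integrable_cabs measurableT Gi) bnd.
by congr ccvg; apply/funext => k; rewrite (bargmann_adj w (tFk k)).
Qed.

End surjectivity.

(** * The fractional Fourier transform *)

Section fractional_fourier.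
Context {R : realType}.
Local Notation leb := (@lebesgue_measure R).
Local Notation T2 := (measurableTypeR R).
Implicit Types (a x t : R) (g u : R -> R[i]) (z w : R[i]).

Let fp a : R[i] := 1 - 'i%C * (cot a)%:C.

Let fp_gt0 a : 0 < Re (fp a).
Proof. have -> : Re (fp a) = 1 by rewrite !reimE /=; ring.
exact: ltr01. Qed.

Let fp_neq0 a : fp a != 0.
Proof. by apply/eqP => e; have := fp_gt0 a; rewrite e ltxx. Qed.

Definition frft_cst a : R[i] := sqrtc (fp a) / (Num.sqrt pi)%:C *
  cintegral leb setT (fun x : R => cexp (- (fp a * x%:C ^+ 2))).

Let cabs_phase (r : R) : cabs (cexp ('i%C * r%:C)) = 1.
Proof. by rewrite cabs_cexp (_ : Re _ = 0) ?expR0// !reimE /=; ring. Qed.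

Let cmeas_phase (f : R -> R) : measurable_fun setT (f : T2 -> R) ->
  cmeas setT (fun x : T2 => cexp ('i%C * (f x)%:C)).
Proof. by move=> mf; apply: cmeas_cexp; apply: cmeasM; [exact: cmeas_cst|exact: cmeasC]. Qed.

(** Were the Gaussian integral zero, [cintegral_cgauss_lin] would annihilate the Bargmann transform
    of the chirp exp (i cot(a) x^2). The chirp has modulus one, so the isometry on [wL2] gives its
    transform an infinite norm instead. *)
Lemma frft_cst_neq0 a : frft_cst a != 0.
Proof.
rewrite !mulf_neq0 //.
- by apply/eqP => e; have := sqr_sqrtc (fp a); rewrite e expr0n /= => /eqP; rewrite eq_sym (negbTE (fp_neq0 a)).
- by rewrite invr_eq0 -cabs_eq0 cabsC normr_eq0 gt_eqF// sqrtr_gt0 pi_gt0.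
apply/eqP => J0.
pose e x := cexp ('i%C * (cot a * x ^+ 2)%:C).
have e1 x : cabs (e x) = 1 by exact: cabs_phase.
have me : cmeas setT e by apply: cmeas_phase; cmeas_tac.
have ew : wL2 e by apply: (@bounded_wL2 _ _ 1 me) => x; rewrite e1.
have B0 : bargmann e = fun=> 0.
  apply/funext => z; rewrite bargmannE.
  have [i h] := cintegral_cgauss_lin (fp_gt0 a) z; rewrite J0 mulr0 in h.
  transitivity (bcst%:C * cintegral leb setT (fun x : R => cexp (- (z ^+ 2 / 2)) *
    cexp (2 * z * x%:C - fp a * x%:C ^+ 2))).
    congr (_ * _); apply: eq_cintegral => x _; rewrite /e /bker /fp -!cexpD; congr cexp.
    by rewrite !castC; ring.
  by rewrite (cintegralZ measurableT _ i) h !mulr0.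
have := bargmann_isometry ew; rewrite B0 fnorm0.
have -> : sqn e = leb setT.
  rewrite -[RHS]mul1e -(integral_cst leb (@measurableT _ T2) 1).
  by apply: eq_integral => x _; rewrite e1 expr1n.
rewrite -set_itvNyy lebesgue_measure_itv /=; discriminate.
Qed.

Section regular.
Variables (a : R) (u : R -> R[i]).
Hypotheses (sa : sin a != 0) (u1 : L1 u) (u2 : L2 u).

Let ph x t : R[i] := cexp (- 2 * 'i%C * (x * t * csc a - cot a / 2 * t ^+ 2)%:C).

Let cabs_ph x t : cabs (ph x t) = 1.
Proof.
by rewrite cabs_cexp (_ : Re _ = 0) ?expR0// !reimE /=; ring.
Qed.

Let cmeas_ph : cmeas setT (fun p : T2 * T2 => ph p.1 p.2).
Proof. by rewrite /ph; cmeas_tac. Qed.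

Let M : R := cabs (sqrtc (fp a) / (Num.sqrt pi)%:C) * \int[leb]_t cabs (u t).

(** The integral is bounded by a multiple of the L^1 norm. Measurability is obtained, as for [fou],
    from a Gaussian weight that is divided out afterwards. *)
Lemma wL2_frft_integral : wL2 (frft_integral a u).
Proof.
have mu := cintegrable_cmeas u1.
apply: (@bounded_wL2 _ _ M).
  rewrite /frft_integral; apply: cmeasM.
    by apply: cmeasM; [exact: cmeas_cst|apply: cmeas_phase; cmeas_tac].
  pose K (p : T2 * T2) : R[i] := (expR (- p.1 ^+ 2))%:C * (ph p.1 p.2 * u p.2).
  have mK : cmeas setT K.
    apply: cmeasM; first by cmeas_tac.
    by apply: cmeasM; [exact: cmeas_ph|exact: (cmeas_comp measurable_snd mu)].
  have KAB x t : cabs (K (x, t)) <= expR (- x ^+ 2) * cabs (u t).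
    by rewrite /K /= 2!cabsM cabs_ph mul1r cabsC ger0_norm ?expR_ge0.
  have [_ _ _ iK _] := @cfubini_bound R _ _ T2 T2 leb leb K _ _ mK (fun x => expR_ge0 _)
    (fun t => cabs_ge0 (u t)) (@integrable_gauss R) (integrable_cabs (@measurableT _ T2) u1) KAB.
  have := cmeasM (cmeasC (u := fun x : T2 => expR (x ^+ 2)) ltac:(cmeas_tac)) (cintegrable_cmeas iK).
  apply: eq_cmeas => x; rewrite /K /=.
  rewrite (@cintegralZ R _ T2 leb setT measurableT); last first.
    by apply: (@cintegrableMb R _ T2 leb setT measurableT 1 _ _ (cmeas_slice1 x cmeas_ph) _ u1) => t _; rewrite cabs_ph.
  by rewrite mulrA -rmorphM -expRD subrr expR0 mul1r.
move=> x; rewrite /frft_integral 2!cabsM cabs_phase mulr1; apply: ler_wpM2l; first exact: cabs_ge0.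
apply: (@cabs_cintegral_le R _ T2 leb setT measurableT).
- by apply: cmeasM; [exact: (cmeas_slice1 x cmeas_ph)|exact: mu].
- by move=> t _; rewrite cabsM (cabs_ph x t) mul1r.
- exact: (integrable_cabs (@measurableT _ T2) u1).
Qed.

Let phase_identity z t : 'i%C * (cot a * t ^+ 2)%:C - z ^+ 2 / 2 + (z - 'i%C * (t * csc a)%:C) ^+ 2 / fp a =
  2 * t%:C * (cexp (- ('i%C * a%:C)) * z) - t%:C ^+ 2 - (cexp (- ('i%C * a%:C)) * z) ^+ 2 / 2.
Proof.
have i2 : 'i%C ^+ 2 + 1 = 0 :> R[i] by apply: complexP; rewrite !expr2 !reimE /=; ring.
pose C := (cos a)%:C : R[i]; pose S := (sin a)%:C : R[i].
have CS : C ^+ 2 + S ^+ 2 - 1 = 0.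
  by rewrite /C /S -!complexX -complexD cos2Dsin2 subrr.
have S0 : S != 0 by rewrite /S -cabs_eq0 cabsC normr_eq0.
have -> : cexp (- ('i%C * a%:C)) = C - 'i%C * S.
  by rewrite -mulrN -complexN cexp_i cosN sinN; apply: complexP; rewrite !reimE /=; ring.
have fpV : (fp a)^-1 = S * (S + 'i%C * C).
  apply: (mulfI (fp_neq0 a)); rewrite divff ?fp_neq0// /fp /cot !castC -/C -/S.
  rewrite -[LHS]addr0 -CS -[X in _ = X]addr0 -[X in _ = _ + X](mulr0 (C ^+ 2)) -i2.
  by field.
rewrite fpV /cot /csc !castC -/C -/S; apply/eqP; rewrite -subr_eq0; apply/eqP.
(* [field] treats i, cos a and sin a as independent variables. The difference of both sides is
   therefore written as an explicit combination of i^2 + 1 and cos^2 + sin^2 - 1. *)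
transitivity (('i%C * C * t%:C ^+ 2 / S + 2^-1 * S ^+ 2 * z ^+ 2 - 2 * C * z * t%:C + t%:C ^+ 2) *
  ('i%C ^+ 2 + 1) + 2^-1 * z ^+ 2 * (C ^+ 2 + S ^+ 2 - 1)).
  by field.
by rewrite i2 CS !mulr0 addr0.
Qed.

(** After Fubini the integral in x is a Gaussian with p = 1 - i cot a and linear coefficient z - i t
    csc a. [phase_identity] recognizes the resulting exponent as that of the Bargmann kernel at
    e^(-ia) z. *)
Lemma bargmann_frft_integral z :
  bargmann (frft_integral a u) z = frft_cst a * bargmann u (cexp (- ('i%C * a%:C)) * z).
Proof.
have mu := cintegrable_cmeas u1.
set k := sqrtc (fp a) / (Num.sqrt pi)%:C.
set J := cintegral leb setT (fun x : R => cexp (- (fp a * x%:C ^+ 2))).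
pose c x := cexp ('i%C * (x ^+ 2 * cot a)%:C).
have c1 x : cabs (c x) = 1 by exact: cabs_phase.
have mc : cmeas setT (c : T2 -> R[i]) by apply: cmeas_phase; cmeas_tac.
pose K (p : T2 * T2) : R[i] := c p.1 * bker z p.1 * (ph p.1 p.2 * u p.2).
have mK : cmeas setT K.
  apply: cmeasM; last by apply: cmeasM; [exact: cmeas_ph|exact: (cmeas_comp measurable_snd mu)].
  by apply: cmeasM; [exact: (cmeas_comp measurable_fst mc)|exact: (cmeas_comp measurable_fst (cmeas_bker z))].
have ib : cintegrable leb setT (bker z).
  have h1 : wL2 (fun _ : R => 1 : R[i]).
    by apply: (@bounded_wL2 _ _ 1) => [|x]; [exact: cmeas_cst|rewrite cabs1].
  by apply: (eq_cintegrable (@measurableT _ T2) _ (integrable_bker z h1)) => x _; rewrite mul1r.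
have KAB x t : cabs (K (x, t)) <= cabs (bker z x) * cabs (u t).
  by rewrite /K /= cabsM (cabsM (c x)) c1 mul1r (cabsM (ph x t)) cabs_ph mul1r.
have [_ s2 s1 _ e] := @cfubini_bound R _ _ T2 T2 leb leb K _ _ mK (fun x => cabs_ge0 (bker z x))
    (fun t => cabs_ge0 (u t)) (integrable_cabs (@measurableT _ T2) ib)
    (integrable_cabs (@measurableT _ T2) u1) KAB.
have iph x : cintegrable leb setT (fun t => ph x t * u t).
  by apply: (@cintegrableMb R _ T2 leb setT measurableT 1 _ _ (cmeas_slice1 x cmeas_ph) _ u1) => t _; rewrite cabs_ph.
have iK : cintegrable leb setT (fun x => cintegral leb setT (fun t => K (x, t))).
  by have [_ _ _ i _] := @cfubini_bound R _ _ T2 T2 leb leb K _ _ mK (fun x => cabs_ge0 (bker z x))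
    (fun t => cabs_ge0 (u t)) (integrable_cabs (@measurableT _ T2) ib)
    (integrable_cabs (@measurableT _ T2) u1) KAB.
have E1 : cintegral leb setT (fun x => frft_integral a u x * bker z x) =
    k * cintegral leb setT (fun x => cintegral leb setT (fun t => K (x, t))).
  rewrite -(cintegralZ (@measurableT _ T2) k iK); apply: eq_cintegral => x _.
  rewrite /K /= (cintegralZ (@measurableT _ T2) _ (iph x)) /frft_integral.
  by rewrite -/k -/(c x); ring.
have E2 t : cintegral leb setT (fun x => K (x, t)) =
    J * (u t * bker (cexp (- ('i%C * a%:C)) * z) t).
  pose q := z - 'i%C * (t * csc a)%:C.
  have [i h] := cintegral_cgauss_lin (fp_gt0 a) q.
  transitivity (cintegral leb setT (fun x : R =>
     (u t * cexp ('i%C * (cot a * t ^+ 2)%:C - z ^+ 2 / 2)) * cexp (2 * q * x%:C - fp a * x%:C ^+ 2))).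
    apply: eq_cintegral => x _; rewrite /K /c /ph /bker /q /fp /=.
    rewrite [LHS]mulrA [LHS]mulrC -!cexpD -[RHS]mulrA -cexpD; congr (_ * cexp _).
    rewrite (complexM (x ^+ 2)) (complexX x) (complexB (x * t * csc a)) (complexM (x * t)) (complexM x t).
    rewrite (complexM (cot a / 2)) (complexM (cot a)) (complexM (cot a)) (complexX t).
    rewrite (complexM t) (complexV 2%:R) (complexn 2).
    by move: x%:C t%:C (cot a)%:C (csc a)%:C => X t' C S; field.
  transitivity ((u t * cexp ('i%C * (cot a * t ^+ 2)%:C - z ^+ 2 / 2)) * (cexp (q ^+ 2 / fp a) * J)).
    exact: etrans (cintegralZ (@measurableT _ T2) _ i) (congr1 _ h).
  transitivity (J * (u t * (cexp ('i%C * (cot a * t ^+ 2)%:C - z ^+ 2 / 2) * cexp (q ^+ 2 / fp a)))).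
    by ring.
  by rewrite -cexpD phase_identity.
rewrite !bargmannE E1 e.
transitivity (bcst%:C * (k * (J * cintegral leb setT (fun t => u t * bker (cexp (- ('i%C * a%:C)) * z) t)))).
  congr (_ * (_ * _)); rewrite -(cintegralZ (@measurableT _ T2) J (integrable_bker _ (L2_wL2 u2))).
  by apply: eq_cintegral => t _; exact: E2.
by rewrite /frft_cst -/k -/J; ring.
Qed.

End regular.
End fractional_fourier.

(** * Extension to L^2 and the degenerate angles *)

Section frft_extension.
Context {R : realType}.
Local Notation leb := (@lebesgue_measure R).
Local Notation T2 := (measurableTypeR R).
Implicit Types (a x t : R) (g p : R -> R[i]) (z w : R[i]).

Let rot a : R[i] := cexp (- ('i%C * a%:C)).

Let cabs_rot a : cabs (rot a) = 1.
Proof. by rewrite cabs_cexp (_ : Re _ = 0) ?expR0// !reimE /=; ring. Qed.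

(** Surjectivity produces the candidate for the value of the extension on the Fock side, where a
    rotation followed by a scaling is visibly bounded. *)
Lemma frft_lift a g : L2 g -> exists p, L2 p /\
  bargmann p = (fun z => frft_cst a * bargmann g (rot a * z)).
Proof.
by move=> gL; exact: bargmann_surj (fock_rot (frft_cst a) (cabs_rot a) (bargmann_fock gL)).
Qed.

Lemma sqn_lift a g p : wL2 g -> wL2 p ->
  bargmann p = (fun z => frft_cst a * bargmann g (rot a * z)) ->
  sqn p = ((cabs (frft_cst a) ^+ 2)%:E * sqn g)%E.
Proof.
move=> gw pw e; rewrite -(bargmann_isometry pw) -(bargmann_isometry gw) e.
have eg := bargmann_entire gw.
by rewrite (fnormZ _ (entire_rot (c := rot a) eg)) (fnorm_rot (cabs_rot a) eg).
Qed.

Lemma sqn_cvg0Z (c : R) (s s' : nat -> \bar R) : 0 <= c -> (forall n, 0 <= s n)%E ->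
  (forall n, s' n <= c%:E * s n)%E -> (forall n, 0 <= s' n)%E ->
  s n @[n --> \oo] --> 0%E -> s' n @[n --> \oo] --> 0%E.
Proof.
move=> c0 s0 ss' s'0 /(ecvg0P s0) h; apply/(ecvg0P s'0) => e e0.
have c1 : 0 < c + 1 by rewrite ltr_wpDl.
have := h (e / (c + 1)) (divr_gt0 e0 c1); apply: filterS => n hn.
apply: le_trans (ss' n) _; apply: (@le_trans _ _ (c%:E * (e / (c + 1))%:E)%E).
  by rewrite lee_wpmul2l// lee_fin.
by rewrite -EFinM lee_fin mulrCA ler_piMr ?(ltW e0)// ler_pdivrMr// mul1r lerDl.
Qed.

(** Under the Bargmann transform, the integral transform of u n and the candidate p are the same
    scaled rotation of u n and g. Their distance is thus |k| times that of u n and g. *)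
Lemma frft_ext_lift a g p : sin a != 0 -> L2 g -> L2 p ->
  bargmann p = (fun z => frft_cst a * bargmann g (rot a * z)) -> is_frft_ext a g p.
Proof.
move=> sa gL pL e; split => // u hu /L2norm_cvg0 ug; apply/L2norm_cvg0.
have c0 : 0 <= cabs (frft_cst a) ^+ 2 by rewrite sqr_ge0.
apply: (sqn_cvg0Z c0 (fun n => sqn_ge0 _) _ (fun n => sqn_ge0 _) ug) => n.
have [u1 u2] := hu n; have uw := L2_wL2 u2; have gw := L2_wL2 gL.
have fw := wL2_frft_integral a u1; have pw := L2_wL2 pL.
rewrite (@sqn_lift a _ _ (wL2B uw gw) (wL2B fw pw)) ?lexx//.
apply/funext => z; rewrite (bargmannB z fw pw) (bargmann_frft_integral sa u1 u2) e.
by rewrite (bargmannB _ uw gw) mulrBr.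
Qed.

Lemma L1_L2_dense g : L2 g -> exists u : nat -> R -> R[i],
  (forall n, L1 (u n) /\ L2 (u n)) /\ L2norm (fun x => u n x - g x) @[n --> \oo] --> 0%E.
Proof.
move=> gL; have [mg gfin] := (L2P g).1 gL; have ig := sqn_integrable gL.
pose I n : set T2 := `[- n%:R, n%:R]%classic.
have mI n : measurable (I n) by exact: measurable_itv.
pose u n (x : T2) : R[i] := (\1_(I n) x)%:C * g x.
have mu n : cmeas setT (u n) by apply: cmeasM; [exact: cmeas_indic|exact: mg].
have i1 n (x : T2) : cabs (\1_(I n) x : R)%:C <= 1.
  by rewrite cabsC ger0_norm ?indic_ge0// indic_le1.
exists u; split => [n|].
  have u2 : L2 (u n).
    apply: (@L2_bound R _ g 1 (mu n)) => // x; rewrite cabsM ler_wpM2r//; exact: i1.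
  split => //.
  have c1 : cintegrable leb setT (fun x : T2 => (\1_(I n) x)%:C * (1 : R[i])).
    have h : ccont (fun _ : R => 1 : R[i]) by split => x; exact: cvg_cst.
    exact: ((@cintegrable_indic R _ T2 leb _ _ (mI n)).1 (ccont_integrable _ _ h)).
  apply: (@le_cintegrable R _ T2 leb setT measurableT _ _ (mu n) _
    (integrableRD (@measurableT _ T2) (integrable_cabs (@measurableT _ T2) c1) ig)) => x _.
  rewrite /u cabsM mulr1 cabsC (ger0_norm (indic_ge0 _ _)) indicE.
  case: (x \in I n); rewrite ?mul1r ?mul0r ?add0r ?sqr_ge0//=.
  have := sqr_ge0 (cabs (g x) - 1); have := sqr_ge0 (cabs (g x) + 1).
  by move: (cabs (g x)) => y; lra.
apply/L2norm_cvg0.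
have mf_ n : cmeas setT (fun x : T2 => (cabs (u n x - g x) ^+ 2)%:C).
  by apply: cmeasC; apply: measurable_sqr_cabs; exact: cmeasB.
have lim (x : T2) : setT x -> ccvg (fun n => (cabs (u n x - g x) ^+ 2)%:C) 0.
  move=> _; rewrite /ccvg; apply: cvg_near_cst; exists (Num.truncn `|x : R|).+1 => // n Nn.
  have xn : `|x : R| <= n%:R.
    by apply: le_trans (ltW (truncnS_gt _)) _; rewrite ler_nat.
  rewrite /u indicE (_ : x \in I n); first by rewrite mul1r subrr cabs0 expr0n subrr cabs0.
  by rewrite inE /I /= in_itv/= -ler_norml.
have le n x : cabs (u n x - g x) ^+ 2 <= cabs (g x) ^+ 2.
  rewrite /u indicE; case: (x \in I n); first by rewrite mul1r subrr cabs0 expr0n sqr_ge0.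
  by rewrite mul0r sub0r cabsN.
have bnd n (x : T2) : setT x -> cabs (cabs (u n x - g x) ^+ 2)%:C <= cabs (g x) ^+ 2.
  by move=> _; rewrite cabsC (ger0_norm (sqr_ge0 _)); exact: le.
have [_] := @cdominated_cvg R _ T2 leb setT measurableT _ (fun=> 0) _ mf_ lim ig bnd.
rewrite cintegral0 /ccvg => /cvgrPdist_le h.
apply/(ecvg0P (fun n => sqn_ge0 _)) => e /h; apply: filterS => n.
rewrite sub0r normrN subr0 (ger0_norm (cabs_ge0 _)).
have dL : L2 (fun x => u n x - g x).
  apply: (@L2_bound R _ g 1) => //; first exact: (cmeasB (mu n) mg).
  by move=> x; rewrite mul1r -(@ler_pXn2r _ 2)// ?nnegrE ?cabs_ge0//; exact: le.
rewrite (sqnE dL) lee_fin cintegralC cabsC; exact: le_trans (ler_norm _).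
Qed.

(** The condition in [is_frft_ext] ranges over all approximating sequences and would be vacuous if
    there were none; [L1_L2_dense] supplies one, and its transforms have a single limit. *)
Lemma frft_ext_unique a g p q : L2 g -> is_frft_ext a g p -> is_frft_ext a g q ->
  (forall u, L1 u -> L2 u -> cmeas setT (frft_integral a u)) ->
  {ae leb, forall x, p x = q x}.
Proof.
move=> gL [pL hp] [qL hq] mF; have [u [hu ug]] := L1_L2_dense gL.
have /L2norm_cvg0 hp' := hp u hu ug; have /L2norm_cvg0 hq' := hq u hu ug.
have mp := (L2_wL2 pL).1; have mq := (L2_wL2 qL).1.
have : sqn (fun x => p x - q x) = 0%E.
  apply/eqP; rewrite eq_le sqn_ge0 andbT; apply/lee_addgt0Pr => e e0; rewrite add0e.
  have e4 : 0 < e / 4 by rewrite divr_gt0.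
  have h1 := (ecvg0P (fun n => sqn_ge0 _)).1 hp' _ e4.
  have h2 := (ecvg0P (fun n => sqn_ge0 _)).1 hq' _ e4.
  have [n [k1 k2]] : exists n, (sqn (fun x => (frft_integral a (u n) x - p x)%R) <= (e / 4)%:E)%E /\
      (sqn (fun x => (frft_integral a (u n) x - q x)%R) <= (e / 4)%:E)%E.
    by have [n _ hn] := filterI h1 h2; exists n; apply: hn => /=.
  have mf := mF _ (hu n).1 (hu n).2.
  have m1 : cmeas setT (fun x => -1 * (frft_integral a (u n) x - p x)).
    by apply: cmeasM; [exact: cmeas_cst|exact: cmeasB].
  have m2 : cmeas setT (fun x => frft_integral a (u n) x - q x) by exact: cmeasB.
  have -> : (fun x => p x - q x) =
      (fun x => -1 * (frft_integral a (u n) x - p x) + (frft_integral a (u n) x - q x)).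
    by apply/funext => x; ring.
  apply: le_trans (sqnD_le m1 m2) _.
  rewrite (sqnZ _ (cmeasB mf mp)) cabsN cabs1 expr1n mul1e.
  apply: (@le_trans _ _ (2%:E * ((e / 4)%:E + (e / 4)%:E))%E).
    by rewrite lee_wpmul2l// leeD.
  by rewrite -EFinD -EFinM lee_fin; lra.
move=> /(sqn_eq0 (cmeasB mp mq)); apply: ae_imply => x /eqP.
by rewrite subr_eq0 => /eqP.
Qed.

Lemma cexp_2pi_int (k : int) : cexp ('i%C * (k%:~R * (2 * pi))%:C) = 1 :> R[i].
Proof.
have e1 : cexp ('i%C * (2 * pi)%:C) = 1 :> R[i] by rewrite cexp_i mulr_natl cos2pi sin2pi.
have en (n : nat) : cexp ('i%C * (n%:R * (2 * pi))%:C) = 1 :> R[i].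
  elim: n => [|n ih]; first by rewrite mul0r mulr0 cexp0.
  by rewrite -natr1 mulrDl mul1r complexD mulrDr cexpD ih e1 mulr1.
case: k => n; first exact: en.
by rewrite NegzE mulrNz mulNr complexN mulrN cexpN en invr1.
Qed.

Lemma cexp_sin_eq0 a : sin a = 0 ->
  cexp (- ('i%C * a%:C)) = if a / (2 * pi) \is a Num.int then 1 else -1.
Proof.
move=> s0; have p0 := @pi_gt0 R; have p2 : 0 < 2 * pi :> R by rewrite mulr_gt0.
case: ifPn => [/intrP[k ak]|nk].
  have -> : a = k%:~R * (2 * pi) by rewrite -ak divfK// gt_eqF.
  by rewrite cexpN cexp_2pi_int invr1.
have nc : cos a != 1.
  (* The remainder r of a modulo 2 pi lies in [0, 2 pi) and has sine 0 and cosine 1, which forces r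
     = 0. *)
  apply: contra nk => /eqP c1; apply/intrP; exists (Num.floor (a / (2 * pi))).
  pose k := Num.floor (a / (2 * pi)); pose r := a - k%:~R * (2 * pi).
  have /andP[k1 k2] := floor_itv (a / (2 * pi)).
  have r0 : 0 <= r by rewrite subr_ge0 -ler_pdivlMr.
  have r1 : r < 2 * pi by rewrite ltrBlDr -{1}[2 * pi]mul1r -mulrDl addrC -(intrD _ k 1) -ltr_pdivrMr.
  have er : cexp ('i%C * r%:C) = cexp ('i%C * a%:C).
    by rewrite /r complexB mulrBr cexpD cexpN cexp_2pi_int invr1 mulr1.
  move: er; rewrite !cexp_i => -[cr sr]; rewrite c1 in cr; rewrite s0 in sr.
  have r00 : r = 0.
    have [rp|rp] := ltP r pi.
      apply/eqP; move: r0; rewrite le_eqVlt eq_sym => /orP[//|r0].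
      by have := @sin_gt0_pi R r; rewrite r0 rp sr ltxx => /(_ isT).
    have := cosDpi (r - pi); have := sinDpi (r - pi); rewrite subrK sr cr => sr' cr'.
    have [rp'|rp'] := eqVneq r pi.
      by move: cr; rewrite rp' cospi => /eqP; rewrite eq_sym -subr_eq0 opprK gt_eqF// addr_gt0.
    have := @sin_gt0_pi R (r - pi).
    have -> : sin (r - pi) = 0 by apply/eqP; rewrite -oppr_eq0 -sr'.
    rewrite ltxx subr_gt0 (lt_neqAle pi) eq_sym rp' rp /= ltrBlDr.
    by rewrite -mulr2n -mulr_natl r1 => /(_ isT).
  have ea : a = k%:~R * (2 * pi) by rewrite -[LHS](subrK (k%:~R * (2 * pi))) -/r r00 add0r.
  by apply: (mulIf (lt0r_neq0 p2)); rewrite divfK ?lt0r_neq0//; exact: ea.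
have := sin0cos1 s0; rewrite -mulrN -complexN cexp_i cosN sinN s0 oppr0.
have [c0|c0] := leP 0 (cos a).
  by rewrite ger0_norm// => c1; rewrite c1 eqxx in nc.
rewrite ltr0_norm// => c1; apply: complexP; rewrite ?reimE //= ?oppr0//.
by rewrite -c1 opprK.
Qed.

(* The constant k cancels in the fractional Hilbert transform, so that its value, hence the branch
   of the square root, is irrelevant. *)
Lemma bargmann_frft a : exists2 k : R[i], k != 0 & forall g, L2 g ->
  L2 (frft a g) /\ forall z, bargmann (frft a g) z = k * bargmann g (cexp (- ('i%C * a%:C)) * z).
Proof.
have [sa|sa] := eqVneq (sin a) 0; last first.
  exists (frft_cst a); first exact: frft_cst_neq0.
  move=> g gL; have [p [pL ep]] := frft_lift a gL.
  have hp := frft_ext_lift sa gL pL ep.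
  have hf : is_frft_ext a g (frft a g).
    by rewrite /frft sa; apply: xgetPex; exists p.
  split; first exact: hf.1.
  move=> z; have := frft_ext_unique gL hf hp (fun u u1 _ => (wL2_frft_integral a u1).1).
  by move=> /(bargmann_ae z (L2_wL2 hf.1).1 (L2_wL2 pL).1) ->; rewrite ep.
exists 1; first exact: oner_neq0.
move=> g gL; rewrite /frft sa eqxx /= (cexp_sin_eq0 sa); case: ifP => _.
  by split => // z; rewrite !mul1r.
have [mg gfin] := (L2P g).1 gL.
have mgN : cmeas setT (fun x : T2 => g (- x)).
  by apply: (@cmeas_comp R _ _ T2 T2 (fun x => - x) g); [exact: (@mpres_opp R).1|exact: mg].
split.
  apply/L2P; split; first exact: mgN.
  rewrite /sqn (_ : (\int[leb]_x _)%E = sqn g)//.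
  apply: ((@mpres_opp R).2 (fun x => (cabs (g x) ^+ 2)%:E)).
    by apply/measurable_EFinP; exact: measurable_sqr_cabs.
  by move=> x; rewrite lee_fin sqr_ge0.
move=> z; rewrite mul1r mulN1r !bargmannE; congr (_ * _).
have mB : cmeas setT (fun x : T2 => g x * bker (- z) x).
  by apply: cmeasM; [exact: mg|exact: cmeas_bker].
rewrite -(mpres_cintegral (@mpres_opp R) mB); apply: eq_cintegral => x _; congr (_ * _).
by rewrite /bker !complexN; congr cexp; field.
Qed.

End frft_extension.

(** * The integral kernel *)

Section kernel.
Context {R : realType}.
Local Notation leb := (@lebesgue_measure R).
Local Notation T2 := (measurableTypeR R).
Implicit Types (phi : R) (z w : R[i]).

Definition mult phi (x : R) : R[i] := cexp (- ('i%C * phi%:C)) * heaviside x +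
  cexp ('i%C * phi%:C) * heaviside (- x).

Lemma cmeas_mult phi : cmeas setT (mult phi : T2 -> R[i]).
Proof.
apply: cmeasD; apply: cmeasM; try exact: cmeas_cst; first exact: cmeas_heaviside.
exact: cmeas_heavisideN.
Qed.

(** The bound is 2 because at x = 0 both Heaviside values are 1 and the two unimodular terms add
    up. *)
Lemma cabs_mult phi x : cabs (mult phi x) <= 2.
Proof.
have e r : Re r = 0 -> cabs (cexp r) = 1 by rewrite cabs_cexp => ->; rewrite expR0.
apply: le_trans (cabsD _ _) _; rewrite !cabsM !e ?mul1r.
- by have := cabs_heaviside x; have := cabs_heaviside (- x); lra.
- by rewrite !reimE /=; ring.
- by rewrite !reimE /=; ring.
Qed.

Lemma entire_cexp_sqr : entire (fun w => cexp (- w ^+ 2)).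
Proof.
rewrite (_ : (fun w => _) = (fun w => cexp (-1 * (w * w)))); last first.
  by apply/funext => w; rewrite mulN1r.
apply/entireP => z; eexists.
apply: (cderiv_comp (f := cexp) (g := fun w => -1 * (w * w))); first exact: cderiv_cexp.
by apply: cderivZ; apply: cderivM; exact: cderiv_id.
Qed.

(** The product of the kernels at z and w is exp (z w) times a Gaussian with p = 2 centred at s = (z
    + w) / 2. Rescaling by sqrt 2 to normalize this Gaussian puts the end point of the error
    integral at (z + w) / sqrt 2. The half-sum and the difference of the two phases give cos phi and
    -2 i sin phi. *)
Lemma bargmann_mult phi z w :
  bargmann (fun x => mult phi x * (bcst%:C * bker z x)) w =
  ((Num.sqrt pi)^-1)%:C * (cexp (z * w) * A_fun phi ((z + w) / (Num.sqrt 2)%:C)).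
Proof.
pose s := (z + w) / 2.
pose I := cintegral leb `[0, 1] (fun t : R => cexp (- (2%:R%:C * (t%:C * s) ^+ 2))).
have two0 : 0 < Re (2%:R%:C : R[i]) by [].
have H := cintegral_cgauss_heaviside two0 (cexp (- ('i%C * phi%:C))) (cexp ('i%C * phi%:C)) s.
have i : cintegrable leb setT (fun x : R => mult phi x * cexp (- (2%:R%:C * (x%:C - s) ^+ 2))).
  apply: (@cintegrableMb R _ T2 leb setT measurableT 2 _ _ (cmeas_mult phi)) => [x _|].
    exact: cabs_mult.
  exact: cintegrable_cgauss.
rewrite bargmannE.
transitivity (bcst%:C * (bcst%:C * cexp (z * w) *
    cintegral leb setT (fun x : R => mult phi x * cexp (- (2%:R%:C * (x%:C - s) ^+ 2))))).
  congr (_ * _); rewrite -(cintegralZ (@measurableT _ T2) _ i); apply: eq_cintegral => x _.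
  transitivity (bcst%:C * (mult phi x * (bker z x * bker w x))); first by ring.
  transitivity (bcst%:C * (mult phi x * (cexp (z * w) * cexp (- (2%:R%:C * (x%:C - s) ^+ 2))))); last by ring.
  congr (_ * (_ * _)); rewrite /bker -!cexpD; congr cexp; rewrite complexn /s.
  by move: x%:C => X; field.
rewrite H (cintegral_rgauss (ltr0Sn R 1)) -/I.
have ab : (cexp (- ('i%C * phi%:C)) + cexp ('i%C * phi%:C)) / 2 = (cos phi)%:C.
  rewrite -mulrN -complexN !cexp_i cosN sinN.
  rewrite (_ : _ + _ = 2 * (cos phi)%:C); last by apply: complexP; rewrite ?natrC !reimE /=; ring.
  by rewrite mulrC mulKf.
have amb : cexp (- ('i%C * phi%:C)) - cexp ('i%C * phi%:C) = - (2 * 'i%C * (sin phi)%:C).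
  rewrite -mulrN -complexN !cexp_i cosN sinN.
  by apply: complexP; rewrite ?natrC !reimE /=; ring.
rewrite ab amb.
have s2 : Num.sqrt 2 ^+ 2 = 2 :> R by rewrite sqr_sqrtr.
have s2C : (Num.sqrt 2)%:C ^+ 2 = 2 :> R[i] by rewrite -complexX s2 complexn.
have s20 : (Num.sqrt 2)%:C != 0 :> R[i].
  by rewrite -cabs_eq0 cabsC normr_eq0 gt_eqF// sqrtr_gt0.
have zs : (z + w) / (Num.sqrt 2)%:C = (Num.sqrt 2)%:C * s.
  by apply: (mulIf s20); rewrite divfK// mulrAC -expr2 s2C /s mulrC divfK.
have -> : A_fun phi ((z + w) / (Num.sqrt 2)%:C) = (Num.sqrt pi * cos phi)%:C -
    2 * 'i%C * (sin phi)%:C * ((Num.sqrt 2)%:C * s * I).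
  rewrite /A_fun zs; congr (_ - _ * _).
  have c : ccont (fun t : R => cexp (- (2%:R%:C * (t%:C * s) ^+ 2))).
    have := entire_ccont 0 ((Num.sqrt 2)%:C * s) entire_cexp_sqr.
    congr ccont; apply/funext => t; rewrite add0r; congr (cexp (- _)).
    by rewrite complexn -s2C; ring.
  have mI : measurable (`[0, 1]%classic : set T2) by exact: measurable_itv.
  rewrite -(cintegralZ mI _ (ccont_integrable 0 1 c)).
  apply: eq_cintegral => t _; rewrite mulrC; congr (_ * cexp (- _)).
  by rewrite complexn -s2C; ring.
have b2 : (bcst%:C : R[i]) * bcst%:C = (Num.sqrt 2)%:C * ((Num.sqrt pi)^-1)%:C.
  by rewrite -!complexM -expr2 bcst_sqr sqrtrM// sqrtrV ?pi_ge0.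
have sp : (Num.sqrt (pi / 2))%:C = (Num.sqrt pi)%:C / (Num.sqrt 2)%:C :> R[i].
  by rewrite sqrtrM ?pi_ge0// sqrtrV// complexM complexV.
have p0 : (Num.sqrt pi)%:C != 0 :> R[i].
  by rewrite -cabs_eq0 cabsC normr_eq0 gt_eqF// sqrtr_gt0 pi_gt0.
rewrite mulrA mulrA b2 sp complexM complexV.
move: ((Num.sqrt pi)%:C) ((Num.sqrt 2)%:C) p0 s20 => P Q P0 Q0.
by field; rewrite P0 Q0.
Qed.

(** The integral to be computed is bilinear in p and the kernel, whereas [bargmann_polar] is
    sesquilinear. The kernel is conjugated before and after, which turns w into its conjugate in the
    result. *)
Lemma bargmann_mult_polar phi p z : L2 p ->
  gauss_integrable (fun w => bargmann p w *
    (((Num.sqrt pi)^-1)%:C * (cexp (z * w^*%C) * A_fun phi ((z + w^*%C) / (Num.sqrt 2)%:C)))) /\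
  bargmann (fun x => mult phi x * p x) z = gauss_integral (fun w => bargmann p w *
    (((Num.sqrt pi)^-1)%:C * (cexp (z * w^*%C) * A_fun phi ((z + w^*%C) / (Num.sqrt 2)%:C)))).
Proof.
move=> pL.
pose q x := mult phi x * (bcst%:C * bker z x).
have qL : L2 q.
  apply: (@L2_bound R _ (fun x => bcst%:C * bker z x) 2).
  - by apply: cmeasM; [exact: cmeas_mult|apply: cmeasM; [exact: cmeas_cst|exact: cmeas_bker]].
  - by move=> x; rewrite /q [leLHS]cabsM; apply: ler_wpM2r; [exact: cabs_ge0|exact: cabs_mult].
  - exact: L2Z (L2_bker z).
have JK (x : R[i]) : (x^*%C)^*%C = x by apply: complexP; rewrite !reimE ?opprK.
have qJ : L2 (fun x => (q x)^*%C).
  apply: (@L2_bound R _ q 1) => //; first exact: (cmeasJ (L2_wL2 qL).1).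
  by move=> x; rewrite cabsJ mul1r.
have e w : (bargmann (fun x => (q x)^*%C) w)^*%C =
    ((Num.sqrt pi)^-1)%:C * (cexp (z * w^*%C) * A_fun phi ((z + w^*%C) / (Num.sqrt 2)%:C)).
  apply: etrans (esym (bargmannJ w (L2_wL2 qJ))) (etrans _ (bargmann_mult phi z w^*%C)).
  have -> : (fun x => ((q x)^*%C)^*%C) = q by apply/funext => x; exact: JK.
  by [].
have [i h] := bargmann_polar pL qJ.
have ef : (fun w => bargmann p w * (bargmann (fun x => (q x)^*%C) w)^*%C) = (fun w => bargmann p w *
    (((Num.sqrt pi)^-1)%:C * (cexp (z * w^*%C) * A_fun phi ((z + w^*%C) / (Num.sqrt 2)%:C)))).
  by apply/funext => w; rewrite e.
rewrite -ef; split; first exact: i.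
rewrite -h bargmannE.
have mpL : L2 (fun x => mult phi x * p x).
  apply: (@L2_bound R _ p 2) => //.
    by apply: cmeasM; [exact: cmeas_mult|exact: (L2_wL2 pL).1].
  by move=> x; rewrite cabsM; apply: ler_wpM2r; [exact: cabs_ge0|exact: cabs_mult].
rewrite -(cintegralZ (@measurableT _ T2) _ (integrable_bker z (L2_wL2 mpL))).
by apply: eq_cintegral => x _; rewrite JK /q; ring.
Qed.

End kernel.

(** * The inverse transforms and the integral formula *)

Lemma inv_bargmannP {R : realType} (f : R[i] -> R[i]) : fock f ->
  L2 (inv_bargmann f) /\ bargmann (inv_bargmann f) = f.
Proof. by move=> ff; exact: (xgetPex _ (bargmann_surj ff)). Qed.

(** Surjectivity exhibits a function with the property that [inv_frft] selects by, so the selected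
    one has it. This property then determines its Bargmann transform, whichever representative was
    taken. *)
Lemma inv_frft_bargmann {R : realType} (a : R) (k : R[i]) (q : R -> R[i]) : k != 0 ->
  (forall g, L2 g -> L2 (frft a g) /\
    forall z, bargmann (frft a g) z = k * bargmann g (cexp (- ('i%C * a%:C)) * z)) ->
  L2 q -> L2 (inv_frft a q) /\
  forall z, bargmann (inv_frft a q) z = k^-1 * bargmann q (cexp ('i%C * a%:C) * z).
Proof.
move=> k0 hk qL.
have c1 : cabs (cexp ('i%C * a%:C)) = 1 by rewrite cabs_cexp (_ : Re _ = 0) ?expR0// !reimE /=; ring.
have cV z : cexp ('i%C * a%:C) * (cexp (- ('i%C * a%:C)) * z) = z.
  by rewrite mulrA -cexpD subrr cexp0 mul1r.
have cV' z : cexp (- ('i%C * a%:C)) * (cexp ('i%C * a%:C) * z) = z.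
  by rewrite mulrA -cexpD addNr cexp0 mul1r.
have [sL hs] : L2 (inv_frft a q) /\ {ae lebesgue_measure, forall x, frft a (inv_frft a q) x = q x}.
  have [s [sL es]] := bargmann_surj (fock_rot k^-1 c1 (bargmann_fock qL)).
  have [fL ef] := hk s sL.
  apply: (@xgetPex _ (fun=> 0)
    [set g | L2 g /\ {ae lebesgue_measure, forall x, frft a g x = q x}]).
  exists s; split => //; apply: (bargmann_inj (L2_wL2 fL) (L2_wL2 qL)); apply/funext => z.
  by rewrite ef es cV mulVKf.
have [fL ef] := hk _ sL; split => // z.
by rewrite -(bargmann_ae _ (L2_wL2 fL).1 (L2_wL2 qL).1 hs) ef cV' mulKf.
Qed.

Lemma sqrt_piV_neq0 {R : realType} : ((Num.sqrt pi)^-1)%:C != 0 :> R[i].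
Proof. by rewrite -cabs_eq0 cabsC normr_eq0 invr_eq0 gt_eqF// sqrtr_gt0 pi_gt0. Qed.

Lemma mulVf_split {F : fieldType} (k s b : F) : s != 0 -> k^-1 * b = s * ((k * s)^-1 * b).
Proof. by move=> s0; rewrite invfM !mulrA (mulrC _ k^-1) mulrK// unitfE. Qed.

Theorem theorem7 (R : realType) (alpha phi : R) (f : R[i] -> R[i]) (hf : fock f) :
  let T := fun g : R[i] -> R[i] =>
    bargmann (frac_hilbert alpha phi (inv_bargmann g)) in
  let K := fun z w : R[i] =>
    cexp (z * w^*) *
    A_fun phi ((cexp ('i%C * alpha%:C) * z + cexp (- ('i%C * alpha%:C)) * w^*)
               / (Num.sqrt 2)%:C) in
  fock (T f) /\
  forall z : R[i],
    gauss_integrable (fun w => f w * K z w) /\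
    T f z = ((Num.sqrt pi)^-1)%:C * gauss_integral (fun w => f w * K z w).
Proof.
move=> T K.
have [k k0 hk] := bargmann_frft alpha.
have [pL ep] := inv_bargmannP hf.
have [FL eF] := hk _ pL; rewrite ep in eF.
set c := cexp ('i%C * alpha%:C) in K *; set c' := cexp (- ('i%C * alpha%:C)) in K hk eF *.
have cc' : c * c' = 1 by rewrite -cexpD subrr cexp0.
have cJ : c^*%C = c'.
  by rewrite cexpJ; congr cexp; apply: complexP; rewrite !reimE /=; ring.
have c1 : cabs c = 1 by rewrite cabs_cexp (_ : Re _ = 0) ?expR0// !reimE /=; ring.
have qL : L2 (fun x => mult phi x * frft alpha (inv_bargmann f) x).
  apply: (@L2_bound R _ (frft alpha (inv_bargmann f)) 2) => //.
    by apply: cmeasM; [exact: cmeas_mult|exact: (L2_wL2 FL).1].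
  by move=> x; rewrite cabsM; apply: ler_wpM2r; [exact: cabs_ge0|exact: cabs_mult].
have [sL es] := inv_frft_bargmann k0 hk qL.
split; first exact: bargmann_fock sL.
move=> z; have [Gi eG] := bargmann_mult_polar phi (c * z) FL.
(* Replacing w by c w undoes the rotation that the fractional Fourier transform imposed on f. *)
have [Ri eR] := gauss_integral_rot c1 Gi.
have sp := @sqrt_piV_neq0 R.
(* The conjugate of c w is c' times that of w and c c' = 1: the exponential becomes exp (z conj w),
   the argument of [A_fun] takes the required form, and k remains as a factor, to meet the k^-1
   coming from [inv_frft]. *)
have kern w : bargmann (frft alpha (inv_bargmann f)) (c * w) *
    (((Num.sqrt pi)^-1)%:C * (cexp (c * z * (c * w)^*%C) *
      A_fun phi ((c * z + (c * w)^*%C) / (Num.sqrt 2)%:C))) =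
    k * ((Num.sqrt pi)^-1)%:C * (f w * K z w).
  have JM (x y : R[i]) : (x * y)^*%C = x^*%C * y^*%C by apply: complexP; rewrite !reimE; ring.
  rewrite eF mulrA (mulrC c') cc' mul1r JM cJ.
  have -> : c * z * (c' * w^*%C) = z * w^*%C by rewrite mulrACA cc' mul1r.
  by rewrite /K; ring.
have eK : (fun w => f w * K z w) = (fun w => (k * ((Num.sqrt pi)^-1)%:C)^-1 *
    (bargmann (frft alpha (inv_bargmann f)) (c * w) *
    (((Num.sqrt pi)^-1)%:C * (cexp (c * z * (c * w)^*%C) *
      A_fun phi ((c * z + (c * w)^*%C) / (Num.sqrt 2)%:C))))).
  apply/funext => w; apply: esym.
  exact: etrans (congr1 ( *%R (k * ((Num.sqrt pi)^-1)%:C)^-1) (kern w)) (mulKf (mulf_neq0 k0 sp) _).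
have [i e] := gauss_integralZ (k * ((Num.sqrt pi)^-1)%:C)^-1 Ri.
rewrite eK; split; first exact: i.
apply: etrans (es z) _; rewrite e eR -eG.
exact: (mulVf_split _ _ sp).
Qed.
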